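(* Let $f:\mathbb{R}\to\mathbb{R}$ be a $\mathcal{C}^\infty$-function all of whose derivatives grow at most polynomially at infinity and such that $f''>0$ on $\mathbb{R}$. Let $\mu\in(0,1)$, $p_1\in\mathbb{R}$, and suppose that the tempered distribution $u_0$ satisfies Condition (C2$_{p_1,\mu}$) (see context), with associated function $\tilde u$. Let $u_f$ be the solution of $[i\partial_t-f(D)]u_f(t)=0$ $(t\geqslant0)$, $u_f(0)=u_0$. Let $\varepsilon>0$ and let $\tilde p_1<\tilde p_2$ be finite real numbers with $p_1\notin[\tilde p_1,\tilde p_2]$. Write $\|\tilde u\|_\infty:=\|\tilde u\|_{L^\infty(\mathbb{R})}$, $\|\tilde u'\|_1:=\|\tilde u'\|_{L^1(\mathbb{R})}$. (i) Fix any finite $\eta>\varepsilon$. Then $$\forall\,(t,x)\in\mathfrak{C}_f(p_1-\varepsilon,p_1+\varepsilon)\qquad |u_f(t,x)|\leqslant c^{(1)}(u_0,f)\,t^{-\frac{\mu}{2}}+c^{(2)}_{\varepsilon}(u_0,f)\,t^{-1},$$ where, with $J_1:=[p_1-\eta,p_1]$, $J_2:=[p_1,p_1+\eta]$, $m_{j,\eta}:=\min_{p\in J_j}f''(p)>0$, $\tilde m_{1,\eta,\varepsilon}:=f'(p_1+\eta)-f'(p_1+\varepsilon)>0$ and $\tilde m_{2,\eta,\varepsilon}:=f'(p_1-\varepsilon)-f'(p_1-\eta)>0$, $$c^{(1)}(u_0,f):=\sum_{j=1,2}\left[\frac{1}{2\pi}\,\frac3\mu\,\|\tilde u\|_{L^\infty(J_j)}+\frac1\pi\left(4\|\tilde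 u\|_{L^\infty(J_j)}+\|\tilde u'\|_{L^1(J_j)}\right)m_{j,\eta}^{-1}\right],$$ $$c^{(2)}_{\varepsilon}(u_0,f):=\sum_{j=1,2}\frac{1}{2\pi}\,\eta^{\mu-1}\left(4\|\tilde u\|_{\infty}+\|\tilde u'\|_{1}\right)\tilde m_{j,\eta,\varepsilon}^{-1}.$$ (ii) Fix any $\eta\in\big(0,\min\{|\tilde p_1-p_1|,|\tilde p_2-p_1|\}\big)$. Then $$\forall\,(t,x)\in\mathfrak{C}_f(\tilde p_1,\tilde p_2)\qquad |u_f(t,x)|\leqslant c^{(1)}_{\tilde p_1,\tilde p_2}(u_0,f)\,t^{-\frac12}+c^{(2)}_{\tilde p_1,\tilde p_2}(u_0,f)\,t^{-\mu}+c^{(3)}_{\tilde p_1,\tilde p_2}(u_0,f)\,t^{-1},$$ where, with $m_1:=\min_{p\in[\tilde p_1-\eta,\tilde p_2+\eta]}f''(p)>0$, $\tilde m_2:=f'(\tilde p_1)-f'(\tilde p_1-\eta)>0$ and $\tilde m_3:=f'(\tilde p_2+\eta)-f'(\tilde p_2)>0$: if $p_1<\tilde p_1$, $$c^{(1)}_{\tilde p_1,\tilde p_2}:=\frac{(\tilde p_1-\eta-p_1)^{\mu-1}}{\pi}\Big(\|\tilde u\|_\infty+\big(4\|\tilde u\|_\infty+\|\tilde u'\|_1\big)m_1^{-1}\Big),$$ $$c^{(2)}_{\tilde p_1,\tilde p_2}:=\frac1\pi\Big(\frac1\mu\|\tilde u\|_\infty+\big(4\|\tilde u\|_\infty+\|\tilde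 u'\|_1\big)\tilde m_2^{-1}\Big),\qquad c^{(3)}_{\tilde p_1,\tilde p_2}:=\frac{(\tilde p_2+\eta-p_1)^{\mu-1}}{2\pi}\big(4\|\tilde u\|_\infty+\|\tilde u'\|_1\big)\tilde m_3^{-1};$$ and if $p_1>\tilde p_2$, $$c^{(1)}_{\tilde p_1,\tilde p_2}:=\frac{(p_1-\tilde p_2-\eta)^{\mu-1}}{\pi}\Big(\|\tilde u\|_\infty+\big(4\|\tilde u\|_\infty+\|\tilde u'\|_1\big)m_1^{-1}\Big),$$ $$c^{(2)}_{\tilde p_1,\tilde p_2}:=\frac1\pi\Big(\frac1\mu\|\tilde u\|_\infty+\big(4\|\tilde u\|_\infty+\|\tilde u'\|_1\big)\tilde m_3^{-1}\Big),\qquad c^{(3)}_{\tilde p_1,\tilde p_2}:=\frac{(p_1-\tilde p_1+\eta)^{\mu-1}}{2\pi}\big(4\|\tilde u\|_\infty+\|\tilde u'\|_1\big)\tilde m_2^{-1}.$$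
   Context: Fourier transform: $\mathcal{F}u(p)=\int_{\mathbb{R}}u(x)e^{-ixp}\,dx$, extended to tempered distributions $\mathcal{S}'(\mathbb{R})$. The Fourier multiplier $f(D):\mathcal{S}'(\mathbb{R})\to\mathcal{S}'(\mathbb{R})$ is $f(D)u=\mathcal{F}^{-1}(f\,\mathcal{F}u)$. The evolution equation has a unique solution in $\mathcal{C}^1(\mathbb{R}_+,\mathcal{S}'(\mathbb{R}))$, namely $u_f(t)=\mathcal{F}^{-1}(e^{-itf}\mathcal{F}u_0)$; when $\mathcal{F}u_0\in L^1(\mathbb{R})$ it is the function $$u_f(t,x)=\frac{1}{2\pi}\int_{\mathbb{R}}\mathcal{F}u_0(p)\,e^{-itf(p)+ixp}\,dp,\qquad (t,x)\in\mathbb{R}_+\times\mathbb{R}.$$ Condition (C2$_{p_1,\mu}$) ($\mu\in(0,1)$, $p_1\in\mathbb{R}$): $\mathcal{F}u_0\in L^1(\mathbb{R})$ and there exists a bounded differentiable function $\tilde u:\mathbb{R}\to\mathbb{C}$ such that $\tilde u(p_1)\neq0$, $\tilde u'\in L^1(\mathbb{R})$ and $\mathcal{F}u_0(p)=|p-p_1|^{\mu-1}\,\tilde u(p)$ for all $p\in\mathbb{R}\setminus\{p_1\}$. Space-time cone: $\mathfrak{C}_f(a,b):=\{(t,x)\in(0,+\infty)\times\mathbb{R} : f'(a)<\frac{x}{t}<f'(b)\}$. *)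

(* Defs.v *)
From HB Require Import structures.
From mathcomp Require Import all_boot all_order all_algebra.
From mathcomp Require Import all_classical all_reals all_analysis.
From mathcomp Require Import complex.

Set Implicit Arguments.
Unset Strict Implicit.
Unset Printing Implicit Defensive.

Import Order.TTheory GRing.Theory Num.Theory.
Import numFieldNormedType.Exports.

Local Open Scope ring_scope.
Local Open Scope complex_scope.
Local Open Scope classical_set_scope.

(** * Complex-valued functions of a real variable

    The modulus is the real-valued [Normc.normc]: the norm [`|z|] of [R[i]]
    lives in [R[i]].  Integrals and derivatives are taken componentwise. *)

Section ComplexValued.
Context {R : realType}.
Implicit Types (g : R -> R[i]) (D : set R).

Definition expi (x : R) : R[i] := cos x +i* sin x.

Definition cintegrable g : Prop :=
  (@lebesgue_measure R).-integrable setT (fun x => (complex.Re (g x))%:E) /\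
  (@lebesgue_measure R).-integrable setT (fun x => (complex.Im (g x))%:E).

Definition cintegral g : R[i] :=
  (\int[lebesgue_measure]_x complex.Re (g x)) +i*
  (\int[lebesgue_measure]_x complex.Im (g x)).

Definition cdifferentiable g : Prop := forall x,
  derivable (fun y => complex.Re (g y)) x 1 /\
  derivable (fun y => complex.Im (g y)) x 1.

Definition cderiv g : R -> R[i] := fun x =>
  (fun y => complex.Re (g y))^`() x +i* (fun y => complex.Im (g y))^`() x.

(** The norm of [L^q(D)], as a real number (and 0 if the norm is infinite). *)
Definition cLnorm (q : \bar R) D g : R :=
  fine ('N[lebesgue_measure]_q[(fun x => (Normc.normc (g x))%:E) \_ D])%E.

End ComplexValued.

(** * Schwartz functions and tempered distributions

    A distribution is a map on all functions [R -> R[i]]; only its values on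
    Schwartz functions matter, and equality of distributions is [eqS]. *)

Section TemperedDistributions.
Context {R : realType}.
Implicit Types (phi psi g : R -> R[i]) (T : (R -> R[i]) -> R[i]).

(** [M] bounds the Schwartz seminorms of [phi] of orders at most [N]. *)
Definition schwartz_le (N : nat) (M : R) phi : Prop :=
  forall (k n : nat) (x : R), (k <= N)%N -> (n <= N)%N ->
    `|x| ^+ k * Normc.normc (iter n cderiv phi x) <= M.

Definition schwartz phi : Prop :=
  (forall n, cdifferentiable (iter n cderiv phi)) /\
  (forall N, exists M, schwartz_le N M phi).

Definition tempered T : Prop :=
  (forall (a : R[i]) phi psi, schwartz phi -> schwartz psi ->
     T (fun x => a * phi x + psi x) = a * T phi + T psi) /\
  (exists (N : nat) (K : R), forall phi M,
     schwartz phi -> schwartz_le N M phi -> Normc.normc (T phi) <= K * M).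

Definition eqS T1 T2 : Prop := forall phi, schwartz phi -> T1 phi = T2 phi.

Definition regular_dist g : (R -> R[i]) -> R[i] :=
  fun phi => cintegral (fun x => g x * phi x).

Definition fourier phi : R -> R[i] :=
  fun p => cintegral (fun x => phi x * expi (- (x * p))).

Definition inv_fourier phi : R -> R[i] :=
  fun x => ((2 * pi)^-1)%:C * cintegral (fun p => phi p * expi (x * p)).

Definition fourierS T : (R -> R[i]) -> R[i] := fun phi => T (fourier phi).

Definition inv_fourierS T : (R -> R[i]) -> R[i] :=
  fun phi => T (inv_fourier phi).

Definition mulS g T : (R -> R[i]) -> R[i] :=
  fun phi => T (fun p => g p * phi p).

Definition multiplier (f : R -> R) T : (R -> R[i]) -> R[i] :=
  inv_fourierS (mulS (fun p => (f p)%:C) (fourierS T)).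

(** ** The space C^1([0, +oo[, S'), for the strong dual topology of S' *)

Definition schwartz_bounded (B : set (R -> R[i])) : Prop :=
  (forall phi, B phi -> schwartz phi) /\
  (forall N, exists M, forall phi, B phi -> schwartz_le N M phi).

Definition cvgS (F : set_system R) (w : R -> (R -> R[i]) -> R[i]) T : Prop :=
  forall B, schwartz_bounded B -> forall e : R, 0 < e ->
    \forall s \near F, forall phi, B phi -> Normc.normc (w s phi - T phi) <= e.

Definition C1S (u v : R -> (R -> R[i]) -> R[i]) : Prop :=
  forall t : R, 0 <= t ->
  [/\ tempered (u t),
      tempered (v t),
      cvgS (within [set s | 0 <= s] t^')
        (fun s phi => ((s - t)^-1)%:C * (u s phi - u t phi)) (v t) &
      cvgS (within [set s | 0 <= s] (nbhs t)) v (v t)].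

Definition evolution_solution (f : R -> R) (u0 : (R -> R[i]) -> R[i])
    (u : R -> (R -> R[i]) -> R[i]) : Prop :=
  exists v, [/\ C1S u v,
    (forall t, 0 <= t ->
       eqS (fun phi => ('i)%C * v t phi - multiplier f (u t) phi) (fun=> 0)) &
    eqS (u 0) u0].

End TemperedDistributions.

Section Hypotheses.
Context {R : realType}.

Definition smooth_poly_growth (f : R -> R) : Prop :=
  (forall (n : nat) (x : R), derivable (f^`(n)) x 1) /\
  (forall n : nat, exists (K : R) (N : nat),
     forall x, `|f^`(n) x| <= K * (1 + `|x|) ^+ N).

(** [u0hat] is the function which represents the distribution [F u0]. *)
Definition condC2 (p1 mu : R) (u0 : (R -> R[i]) -> R[i])
    (u0hat ut : R -> R[i]) : Prop :=
  [/\ cintegrable u0hat /\ eqS (fourierS u0) (regular_dist u0hat),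
      (exists M : R, forall p, Normc.normc (ut p) <= M) /\ cdifferentiable ut,
      ut p1 != 0,
      cintegrable (cderiv ut) &
      forall p, p != p1 -> u0hat p = (`|p - p1| `^ (mu - 1))%:C * ut p].

Definition solution_fun (f : R -> R) (u0hat : R -> R[i]) (t x : R) : R[i] :=
  ((2 * pi)^-1)%:C *
  cintegral (fun p => u0hat p * expi (- (t * f p) + x * p)).

Definition cone (f : R -> R) (a b : R) : set (R * R) :=
  [set tx | 0 < tx.1 /\ derive1 f a < tx.2 / tx.1 < derive1 f b].

End Hypotheses.

(** * The constants of the estimates *)

Section Constants.
Context {R : realType}.
Variables (f : R -> R) (mu p1 : R) (ut : R -> R[i]).

(** The minimum of f'' on [a, b]: f'' is continuous, so it is attained. *)
Definition min_f2 (a b : R) : R := inf (f^`(2) @` `[a, b]).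

Let supu := cLnorm +oo%E setT ut.
Let varu := cLnorm 1%E setT (cderiv ut).

Definition near_term (a b : R) : R :=
  (2 * pi)^-1 * (3 / mu) * cLnorm +oo%E `[a, b] ut +
  pi^-1 * (4 * cLnorm +oo%E `[a, b] ut + cLnorm 1%E `[a, b] (cderiv ut)) *
    (min_f2 a b)^-1.

Definition near_c1 (eta : R) : R :=
  near_term (p1 - eta) p1 + near_term p1 (p1 + eta).

Definition near_mt1 (eps eta : R) : R :=
  derive1 f (p1 + eta) - derive1 f (p1 + eps).
Definition near_mt2 (eps eta : R) : R :=
  derive1 f (p1 - eps) - derive1 f (p1 - eta).

Definition near_c2 (eps eta : R) : R :=
  (2 * pi)^-1 * eta `^ (mu - 1) * (4 * supu + varu) *
    (near_mt1 eps eta)^-1 +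
  (2 * pi)^-1 * eta `^ (mu - 1) * (4 * supu + varu) *
    (near_mt2 eps eta)^-1.

Variables (pt1 pt2 eta : R).

Definition far_m1 : R := min_f2 (pt1 - eta) (pt2 + eta).
Definition far_mt2 : R := derive1 f pt1 - derive1 f (pt1 - eta).
Definition far_mt3 : R := derive1 f (pt2 + eta) - derive1 f pt2.

(** For p1 outside [pt1, pt2], the [else] branches are the case pt2 < p1. *)

Definition far_c1 : R :=
  (if p1 < pt1 then (pt1 - eta - p1) `^ (mu - 1)
   else (p1 - pt2 - eta) `^ (mu - 1)) / pi *
  (supu + (4 * supu + varu) * far_m1^-1).

Definition far_c2 : R :=
  pi^-1 * (mu^-1 * supu +
    (4 * supu + varu) * (if p1 < pt1 then far_mt2^-1 else far_mt3^-1)).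

Definition far_c3 : R :=
  if p1 < pt1 then
    (pt2 + eta - p1) `^ (mu - 1) / (2 * pi) * (4 * supu + varu) * far_mt3^-1
  else
    (p1 - pt1 + eta) `^ (mu - 1) / (2 * pi) * (4 * supu + varu) * far_mt2^-1.

End Constants.

(* Main.v *)
Require Import Defs.
From HB Require Import structures.
From mathcomp Require Import all_boot all_order all_algebra.
From mathcomp Require Import all_classical all_reals all_analysis.
From mathcomp Require Import complex.
From mathcomp Require Import measurable_realfun ess_sup_inf ring lra.

Set Implicit Arguments.
Unset Strict Implicit.
Unset Printing Implicit Defensive.

Import Order.TTheory GRing.Theory Num.Theory.
Import numFieldNormedType.Exports.

Local Open Scope ring_scope.
Local Open Scope complex_scope.
Local Open Scope classical_set_scope.

(** The theorem has two independent parts: the solution of the evolution equation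
    is the function given by the oscillatory integral, and this integral decays in
    the two cones.

    _The solution._ Since [S'] carries its strong topology, uniqueness is a duality
    argument. For a Schwartz function [phi] and a time [t], let [Phi s] be the
    Fourier transform of [e^(i (s - t) f)] times the inverse transform of [phi].
    Then [s |-> u s (Phi s)] has derivative zero on [[0, t]] ([duality]), because
    [Phi] solves the adjoint equation in the Schwartz space; comparing the values at
    [t] and at 0 gives [u t phi] in terms of the Fourier transform of [u0], and an
    interchange of integrals gives the formula ([solution_is_function]). This needs
    the Fourier inversion theorem on Schwartz functions ([fourier_inversion], by
    Abel summation), the continuity of the Fourier transform on bounded families
    ([schwartz_family_fourier]), and Taylor expansions of [e^(i h f)] with
    remainders that are multipliers of the Schwartz space uniformly in [h]
    ([multiplier_family_expi_taylor2]).

    _The decay._ Let [P] be a primitive of the integrand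
    [|p - p1|^(mu - 1) ut(p) e^(i (x p - t f(p)))]. The phase speed [x - t f'(p)] is
    monotone and vanishes at a stationary point [p0], which lies in the cone
    considered. The line is cut into intervals of three kinds. Near the singularity
    [p1] the increment of [P] is bounded by that of a primitive of
    [|p - p1|^(mu - 1)] ([singular_estimate]); near [p0] it is bounded by the length
    of the interval ([flat_estimate]); elsewhere an integration by parts gains one
    factor [t^-1] over the phase speed ([oscillation_estimate]). Windows of radius
    [t^(-1/2)] around [p0] and [p1] yield the powers [t^(-mu/2)]
    ([near_estimate]) and [t^(-1/2)] ([stationary_estimate]); when the phase speed
    does not vanish near [p1], a window of radius [t^-1] yields [t^(-mu)]
    ([half_singular_estimate]).

    The derivative of [ut] is only integrable, so the fundamental theorem of
    calculus for [ut] is not elementary. It is replaced by a mean value inequality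
    ([mean_value_le]): if [T] is differentiable and the modulus of [T'] is at most
    [L' + k] with [k] integrable, then the increment of [T] is at most that of [L]
    plus the integral of [k]. Its proof dominates [k] by the slopes of a
    nondecreasing function whose total increment exceeds the integral of [k] by an
    arbitrarily small amount ([monotone_majorant]). Applied to [P] minus the boundary
    term of the integration by parts, this inequality gives the exact constants
    without evaluating an integral. *)

(** * Complex numbers as pairs of reals *)

Section ComplexAlgebra.
Context {R : realType}.
Implicit Types (z w : R[i]) (x y : R).
Local Notation N := (@Normc.normc R).

Lemma Re_add z w : complex.Re (z + w) = complex.Re z + complex.Re w.
Proof. by case: z w => [a b] [c d]. Qed.
Lemma Im_add z w : complex.Im (z + w) = complex.Im z + complex.Im w.
Proof. by case: z w => [a b] [c d]. Qed.
Lemma Re_opp z : complex.Re (- z) = - complex.Re z.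
Proof. by case: z. Qed.
Lemma Im_opp z : complex.Im (- z) = - complex.Im z.
Proof. by case: z. Qed.
Lemma Re_mul z w : complex.Re (z * w) =
  complex.Re z * complex.Re w - complex.Im z * complex.Im w.
Proof. by case: z w => [a b] [c d]. Qed.
Lemma Im_mul z w : complex.Im (z * w) =
  complex.Re z * complex.Im w + complex.Im z * complex.Re w.
Proof. by case: z w => [a b] [c d]. Qed.

Definition ReImE := (Re_add, Im_add, Re_opp, Im_opp, Re_mul, Im_mul).

Lemma complexP z w :
  complex.Re z = complex.Re w -> complex.Im z = complex.Im w -> z = w.
Proof. by case: z w => [a b] [c d] /= -> ->. Qed.

Lemma normc_ge0 z : 0 <= N z.
Proof. by case: z => a b; exact: sqrtr_ge0. Qed.

Lemma normcE_sqrt z : N z = Num.sqrt (complex.Re z ^+ 2 + complex.Im z ^+ 2).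
Proof. by case: z. Qed.

Lemma normc_real x : N x%:C = `|x|.
Proof. by rewrite normcE_sqrt /= expr0n addr0 sqrtr_sqr. Qed.

Lemma normc_i : N 'i%C = 1.
Proof. by rewrite normcE_sqrt /= expr0n add0r expr1n sqrtr1. Qed.

Lemma normc_expi x : N (expi x) = 1.
Proof. by rewrite normcE_sqrt /= cos2Dsin2 sqrtr1. Qed.

Lemma normcN z : N (- z) = N z.
Proof. by rewrite !normcE_sqrt Re_opp Im_opp !sqrrN. Qed.

Lemma normcB z w : N (z - w) = N (w - z).
Proof. by rewrite -normcN opprB. Qed.

Lemma normcD z w : N (z + w) <= N z + N w.
Proof. exact: le_normcD. Qed.

Lemma normc_le_sub z w : N z <= N w + N (z - w).
Proof. by rewrite -{1}(subrKC w z) normcD. Qed.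

Lemma normRe z : `|complex.Re z| <= N z.
Proof. by rewrite normcE_sqrt -sqrtr_sqr ler_wsqrtr// lerDl sqr_ge0. Qed.

Lemma normIm z : `|complex.Im z| <= N z.
Proof. by rewrite normcE_sqrt -sqrtr_sqr ler_wsqrtr// lerDr sqr_ge0. Qed.

Lemma normc_le z : N z <= `|complex.Re z| + `|complex.Im z|.
Proof.
rewrite -(ger0_norm (addr_ge0 (normr_ge0 _) (normr_ge0 _))) -sqrtr_sqr normcE_sqrt.
rewrite ler_wsqrtr// sqrrD !real_normK ?num_real// -addrAC lerDl.
by rewrite mulrn_wge0// mulr_ge0.
Qed.

Lemma normc_eq0 z : N z = 0 -> z = 0.
Proof. exact: Normc.eq0_normc. Qed.

Lemma normc0 : N 0 = 0. Proof. by rewrite normc_real normr0. Qed.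

Lemma expiD x y : expi (x + y) = expi x * expi y.
Proof. by apply: complexP; rewrite !ReImE /= ?cosD ?sinD// addrC. Qed.

Lemma expi0 : expi 0 = 1 :> R[i].
Proof. by rewrite /expi cos0 sin0. Qed.

End ComplexAlgebra.

(** * Derivatives of complex-valued functions *)

Section ComplexDerivative.
Context {R : realType}.
Implicit Types (g h : R -> R[i]) (f : R -> R) (x y l : R).
Local Notation N := (@Normc.normc R).

Definition cis_derive g x (l : R[i]) : Prop :=
  is_derive x 1 (fun y => complex.Re (g y)) (complex.Re l) /\
  is_derive x 1 (fun y => complex.Im (g y)) (complex.Im l).

Lemma cderivE g x (l : R[i]) : cis_derive g x l -> cderiv g x = l.
Proof.
by case=> hr hi; rewrite /cderiv !derive1E !derive_val; case: l {hr hi}.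
Qed.

Lemma cis_deriveP g : cdifferentiable g <-> forall x, cis_derive g x (cderiv g x).
Proof.
split=> [dg x|dg x].
  have [hr hi] := dg x.
  by split; [apply: (DeriveDef hr)|apply: (DeriveDef hi)]; rewrite /= derive1E.
by have [hr hi] := dg x; split; exact: ex_derive.
Qed.

Lemma cis_derive_cst (z : R[i]) x : cis_derive (fun=> z) x 0.
Proof. by split => /=; exact: is_derive_cst. Qed.

Lemma cis_deriveD g h x (l m : R[i]) : cis_derive g x l -> cis_derive h x m ->
  cis_derive (fun y => g y + h y) x (l + m).
Proof.
move=> [gr gi] [hr hi]; split.
  by under eq_fun do rewrite Re_add; rewrite Re_add; exact: is_deriveD.
by under eq_fun do rewrite Im_add; rewrite Im_add; exact: is_deriveD.
Qed.

Lemma cis_deriveM g h x (l m : R[i]) : cis_derive g x l -> cis_derive h x m ->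
  cis_derive (fun y => g y * h y) x (l * h x + g x * m).
Proof.
move=> [gr gi] [hr hi]; split.
  under eq_fun do rewrite Re_mul.
  apply: is_derive_eq (is_deriveB (is_deriveM gr hr) (is_deriveM gi hi)) _.
  by rewrite !ReImE /GRing.scale /=; ring.
under eq_fun do rewrite Im_mul.
apply: is_derive_eq (is_deriveD (is_deriveM gr hi) (is_deriveM gi hr)) _.
by rewrite !ReImE /GRing.scale /=; ring.
Qed.

Lemma cis_derive_eq g x (l m : R[i]) : cis_derive g x l -> l = m -> cis_derive g x m.
Proof. by move=> ? <-. Qed.

Lemma cis_deriveZ (z : R[i]) g x (l : R[i]) : cis_derive g x l ->
  cis_derive (fun y => z * g y) x (z * l).
Proof.
move=> hg; apply: cis_derive_eq (cis_deriveM (cis_derive_cst z x) hg) _.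
by rewrite mul0r add0r.
Qed.

Lemma cis_deriveN g x (l : R[i]) : cis_derive g x l ->
  cis_derive (fun y => - g y) x (- l).
Proof.
move=> [gr gi]; split.
  by under eq_fun do rewrite Re_opp; rewrite Re_opp; exact: is_deriveN.
by under eq_fun do rewrite Im_opp; rewrite Im_opp; exact: is_deriveN.
Qed.

Lemma cis_deriveB g h x (l m : R[i]) : cis_derive g x l -> cis_derive h x m ->
  cis_derive (fun y => g y - h y) x (l - m).
Proof. by move=> hg hh; apply: cis_deriveD => //; exact: cis_deriveN. Qed.

Lemma cis_derive_real f x l : is_derive x 1 f l ->
  cis_derive (fun y => (f y)%:C) x l%:C.
Proof. by move=> hf; split => //=; exact: is_derive_cst. Qed.

Lemma cis_derive_expi f x l : is_derive x 1 f l ->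
  cis_derive (fun y => expi (f y)) x ('i%C * l%:C * expi (f x)).
Proof.
move=> hf; split => /=.
  apply: is_derive_eq (is_derive1_comp (is_derive_cos _) hf) _.
  by rewrite /GRing.scale /=; ring.
apply: is_derive_eq (is_derive1_comp (is_derive_sin _) hf) _.
by rewrite /GRing.scale /=; ring.
Qed.

(** Without division by the increment, differentiability combines directly with
    estimates of moduli and of integrals. *)
Lemma is_derive_expansion f x l :
  is_derive x 1 f l <-> forall e, 0 < e -> exists2 d, 0 < d &
    forall y, `|y - x| < d -> `|f y - f x - (y - x) * l| <= e * `|y - x|.
Proof.
split=> [[df <-] e e0|H].
  have cv : (fun k : R => k^-1 *: (f (k *: 1 + x) - f x)) @ 0^' --> 'D_1 f x := df.
  move: cv => /cvgrPdist_le /(_ _ e0) /= /nbhs_ballP[/= d d0 hd].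
  exists d => // y yxd.
  have [->|yx] := eqVneq y x; first by rewrite !subrr mul0r !subrr normr0 mulr0.
  have yx0 : y - x != 0 by rewrite subr_eq0.
  have := hd (y - x); rewrite /ball /= sub0r normrN => /(_ yxd yx0).
  set D := 'D_1 f x.
  have yn : 0 < `|y - x| by rewrite normr_gt0.
  rewrite -(ler_pM2r yn) -normrM distrC mulrBl.
  by rewrite /GRing.scale /= mulr1 subrK mulrAC mulVf// mul1r (distrC _ (f y - f x)) (mulrC D).
have cv : (fun k : R => k^-1 *: (f (k *: 1 + x) - f x)) @ 0^' --> l.
  apply/cvgrPdist_le => e e0; have [d d0 hd] := H e e0.
  near=> h.
  have h0 : h != 0 by near: h; exact: nbhs_dnbhs_neq.
  have hn : 0 < `|h| by rewrite normr_gt0.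
  rewrite -(ler_pM2r hn) -normrM mulrBl /GRing.scale /= mulr1 mulrAC mulVf// mul1r.
  rewrite distrC; have := hd (h + x); rewrite addrK (mulrC h l); apply.
  by near: h; apply: dnbhs0_lt.
apply: DeriveDef; first by apply/cvg_ex; exists l.
by apply/cvg_lim.
Unshelve. all: by end_near. Qed.

Lemma cis_derive_expansion g x (l : R[i]) : cis_derive g x l ->
  forall e, 0 < e -> exists2 d, 0 < d &
    forall y, `|y - x| < d -> N (g y - g x - (y - x)%:C * l) <= e * `|y - x|.
Proof.
move=> [/is_derive_expansion hr /is_derive_expansion hi] e e0.
have e20 : 0 < e / 2 by rewrite divr_gt0.
have [d1 d10 h1] := hr _ e20; have [d2 d20 h2] := hi _ e20.
exists (Num.min d1 d2); first by rewrite lt_min d10.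
move=> y; rewrite lt_min => /andP[/h1 h1y /h2 h2y].
apply: le_trans (normc_le _) _; rewrite [e in leRHS]splitr mulrDl lerD//.
  by apply: le_trans h1y; rewrite !ReImE /= mul0r subr0.
by apply: le_trans h2y; rewrite !ReImE /= mul0r addr0.
Qed.

Lemma expansion_cis_derive g x (l : R[i]) :
  (forall e, 0 < e -> exists2 d, 0 < d &
    forall y, `|y - x| < d -> N (g y - g x - (y - x)%:C * l) <= e * `|y - x|) ->
  cis_derive g x l.
Proof.
move=> H; split; apply/is_derive_expansion => e e0; have [d d0 hd] := H e e0;
  exists d => // y /hd; apply: le_trans.
  by have := normRe (g y - g x - (y - x)%:C * l); rewrite !ReImE /= mul0r subr0.
by have := normIm (g y - g x - (y - x)%:C * l); rewrite !ReImE /= mul0r addr0.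
Qed.

(** The real-valued modulus is used because the norm of [R[i]], on which its
    topology rests, takes its values in [R[i]]. *)
Definition ccontinuous_at g x : Prop :=
  forall e, 0 < e -> exists2 d, 0 < d & forall y, `|y - x| < d -> N (g y - g x) <= e.

Lemma ccontinuous_atP g x : ccontinuous_at g x <->
  {for x, continuous (fun y => complex.Re (g y))} /\
  {for x, continuous (fun y => complex.Im (g y))}.
Proof.
split=> [H|[hr hi]].
  split; apply/cvgrPdist_le => e e0; have [d d0 hd] := H e e0;
    apply/nbhs_ballP; exists d => // y; rewrite /ball /= distrC => /hd.
    by apply: le_trans; rewrite distrC; have := normRe (g y - g x); rewrite !ReImE.
  by apply: le_trans; rewrite distrC; have := normIm (g y - g x); rewrite !ReImE.
move=> e e0; have e20 : 0 < e / 2 by rewrite divr_gt0.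
move: hr => /cvgrPdist_le /(_ _ e20) /nbhs_ballP[/= d1 d10 h1].
move: hi => /cvgrPdist_le /(_ _ e20) /nbhs_ballP[/= d2 d20 h2].
exists (Num.min d1 d2); first by rewrite lt_min d10.
move=> y; rewrite distrC lt_min => /andP[/h1 h1y /h2 h2y].
apply: le_trans (normc_le _) _; rewrite [e in leRHS]splitr lerD//.
  by rewrite !ReImE distrC.
by rewrite !ReImE distrC.
Qed.

Lemma cis_derive_continuous g x (l : R[i]) : cis_derive g x l -> ccontinuous_at g x.
Proof.
move=> [hr hi]; apply/ccontinuous_atP.
by split; apply/differentiable_continuous/derivable1_diffP; exact: ex_derive.
Qed.

End ComplexDerivative.

(** * Integrals of complex-valued functions *)

Section ComplexIntegral.
Context {R : realType}.
Implicit Types (g h : R -> R[i]) (k : R -> R) (x y : R).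
Local Notation N := (@Normc.normc R).
Local Notation mu := (@lebesgue_measure R).

Definition cmeasurable g : Prop :=
  measurable_fun setT (fun x => complex.Re (g x)) /\
  measurable_fun setT (fun x => complex.Im (g x)).

Lemma cmeasurableM g h : cmeasurable g -> cmeasurable h ->
  cmeasurable (fun x => g x * h x).
Proof.
move=> [gr gi] [hr hi]; split.
  by under eq_fun do rewrite Re_mul; apply: measurable_funB; exact: measurable_funM.
by under eq_fun do rewrite Im_mul; apply: measurable_funD; exact: measurable_funM.
Qed.

Lemma cmeasurable_continuous g : (forall x, ccontinuous_at g x) -> cmeasurable g.
Proof.
move=> hg; split; apply: continuous_measurable_fun => x;
  by have /ccontinuous_atP[] := hg x.
Qed.

Lemma cmeasurable_norm g : cmeasurable g -> measurable_fun setT (fun x => N (g x)).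
Proof.
move=> [gr gi]; under eq_fun do rewrite normcE_sqrt.
apply: (@measurableT_comp _ _ _ _ _ _ (@Num.sqrt R)).
  by apply: continuous_measurable_fun; exact: sqrt_continuous.
by apply: measurable_funD; apply: measurable_funX.
Qed.

Lemma cintegrable_measurable g : cintegrable g -> cmeasurable g.
Proof. by move=> [/measurable_int/measurable_EFinP ? /measurable_int/measurable_EFinP]. Qed.

Lemma integrable_scale k C : mu.-integrable setT (EFin \o k) ->
  mu.-integrable setT (EFin \o (fun x => C * k x)).
Proof. by move=> ik; exact: (integrableZl measurableT C ik). Qed.

Lemma cintegrable_le g k : cmeasurable g -> mu.-integrable setT (EFin \o k) ->
  (forall x, N (g x) <= k x) -> cintegrable g.
Proof.
move=> [gr gi] ik gk; split; apply: le_integrable ik => //.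
- exact/measurable_EFinP.
- move=> x _ /=; rewrite lee_fin (le_trans (normRe _))//.
  by rewrite (le_trans (gk x))// ler_norm.
- exact/measurable_EFinP.
- move=> x _ /=; rewrite lee_fin (le_trans (normIm _))//.
  by rewrite (le_trans (gk x))// ler_norm.
Qed.

Lemma cintegrable_norm g : cintegrable g -> mu.-integrable setT (EFin \o (fun x => N (g x))).
Proof.
move=> hg; have [gr gi] := hg.
have mN := cmeasurable_norm (cintegrable_measurable hg).
apply: le_integrable (integrableD _ (integrable_abse gr) (integrable_abse gi)) => //.
  exact/measurable_EFinP.
move=> x _ /=; rewrite lee_fin ger0_norm ?normc_ge0//.
by rewrite (le_trans (normc_le _))// ler_norm.
Qed.

Lemma cintegrableM g h C : cintegrable g -> cmeasurable h ->
  (forall x, N (h x) <= C) -> cintegrable (fun x => g x * h x).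
Proof.
move=> ig mh hC; apply: (@cintegrable_le _ (fun x => C * N (g x))).
- by apply: cmeasurableM => //; exact: cintegrable_measurable.
- by apply: integrable_scale; exact: cintegrable_norm.
- by move=> x; rewrite Normc.normcM mulrC ler_wpM2r ?normc_ge0.
Qed.

Lemma cintegrableD g h : cintegrable g -> cintegrable h ->
  cintegrable (fun x => g x + h x).
Proof.
move=> [gr gi] [hr hi]; split.
  under eq_fun do rewrite Re_add EFinD; exact: integrableD.
under eq_fun do rewrite Im_add EFinD; exact: integrableD.
Qed.

Lemma cintegralD g h : cintegrable g -> cintegrable h ->
  cintegral (fun x => g x + h x) = cintegral g + cintegral h.
Proof.
move=> [gr gi] [hr hi]; apply: complexP; rewrite ?Re_add ?Im_add /=.
  by under eq_Rintegral do rewrite Re_add; rewrite RintegralD.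
by under eq_Rintegral do rewrite Im_add; rewrite RintegralD.
Qed.

Lemma cintegrableZ (z : R[i]) g : cintegrable g -> cintegrable (fun x => z * g x).
Proof.
move=> ig; under eq_fun do rewrite mulrC; by apply: (cintegrableM (C := N z)).
Qed.

Lemma cintegralZ (z : R[i]) g : cintegrable g ->
  cintegral (fun x => z * g x) = z * cintegral g.
Proof.
move=> [gr gi]; apply: complexP; rewrite ?Re_mul ?Im_mul /=.
  under eq_Rintegral do rewrite Re_mul.
  rewrite RintegralB//; [|exact: integrable_scale..].
  by rewrite !RintegralZl.
under eq_Rintegral do rewrite Im_mul.
rewrite RintegralD//; [|exact: integrable_scale..].
by rewrite !RintegralZl.
Qed.

Lemma cintegralB g h : cintegrable g -> cintegrable h ->
  cintegral (fun x => g x - h x) = cintegral g - cintegral h.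
Proof.
move=> ig ih; have ihN := cintegrableZ (-1) ih.
under eq_fun do rewrite -mulN1r.
by rewrite cintegralD// cintegralZ// mulN1r.
Qed.

Lemma cintegrableB g h : cintegrable g -> cintegrable h ->
  cintegrable (fun x => g x - h x).
Proof.
move=> ig /(cintegrableZ (-1)) ih; under eq_fun do rewrite -mulN1r.
exact: cintegrableD.
Qed.

(** The factor 2 comes from treating the real and imaginary parts separately; it
    is harmless, because the sharp estimates below never integrate moduli of
    complex integrals. *)
Lemma cintegral_bound g k : cmeasurable g -> mu.-integrable setT (EFin \o k) ->
  (forall x, N (g x) <= k x) -> N (cintegral g) <= 2 * (\int[mu]_x k x).
Proof.
move=> mg ik gk; have [gr gi] := cintegrable_le mg ik gk.
apply: le_trans (normc_le _) _; rewrite /= mulr_natl mulr2n lerD//.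
  apply: le_trans (le_normr_Rintegral _ gr) _ => //.
  apply: le_Rintegral => //; first exact: integrable_norm.
  by move=> x _; exact: le_trans (normRe _) (gk x).
apply: le_trans (le_normr_Rintegral _ gi) _ => //.
apply: le_Rintegral => //; first exact: integrable_norm.
by move=> x _; exact: le_trans (normIm _) (gk x).
Qed.

Definition ccvg (z_ : nat -> R[i]) (z : R[i]) : Prop :=
  forall e : R, 0 < e -> \forall n \near \oo, N (z_ n - z) <= e.

Lemma ccvgP (z_ : nat -> R[i]) (z : R[i]) : ccvg z_ z <->
  ((fun n => complex.Re (z_ n)) @ \oo --> complex.Re z /\
   (fun n => complex.Im (z_ n)) @ \oo --> complex.Im z).
Proof.
split=> [H|[hr hi] e e0].
  split; apply/cvgrPdist_le => e e0; near=> n.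
    apply: (@le_trans _ _ (N (z_ n - z))); last by near: n; exact: H.
    by rewrite distrC; have := normRe (z_ n - z); rewrite !ReImE.
  apply: (@le_trans _ _ (N (z_ n - z))); last by near: n; exact: H.
  by rewrite distrC; have := normIm (z_ n - z); rewrite !ReImE.
have e20 : 0 < e / 2 by rewrite divr_gt0.
near=> n; apply: le_trans (normc_le _) _; rewrite [e in leRHS]splitr !ReImE.
by rewrite lerD//; near: n; [move/cvgrPdistC_le : hr|move/cvgrPdistC_le : hi]; exact.
Unshelve. all: by end_near. Qed.

Lemma ccvg_unique (z_ : nat -> R[i]) (z w : R[i]) : ccvg z_ z -> ccvg z_ w -> z = w.
Proof.
move=> /ccvgP[r1 i1] /ccvgP[r2 i2].
by apply: complexP; [apply: cvg_unique r1 r2|apply: cvg_unique i1 i2]; exact: Rhausdorff.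
Qed.

Lemma ccvg_le (z_ : nat -> R[i]) (z : R[i]) (C : R) : ccvg z_ z ->
  (\forall n \near \oo, N (z_ n) <= C) -> N z <= C.
Proof.
move=> zz hC; apply/ler_addgt0Pr => e e0.
near \oo => n; apply: le_trans (normc_le_sub z (z_ n)) _.
rewrite normcB lerD//; near: n; [exact: hC|exact: zz].
Unshelve. all: by end_near. Qed.

Lemma cintegral_dominated (g_ : nat -> R -> R[i]) g k :
  (forall n, cmeasurable (g_ n)) -> cmeasurable g ->
  mu.-integrable setT (EFin \o k) ->
  (forall n x, N (g_ n x) <= k x) ->
  (forall x, ccvg (g_ ^~ x) (g x)) ->
  ccvg (fun n => cintegral (g_ n)) (cintegral g).
Proof.
move=> mg_ mg ik gk gg; apply/ccvgP; split => /=.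
  apply: fine_cvg => /=; rewrite fineK; last first.
    apply: integrable_fin_num => //.
    apply: le_integrable ik => //; first by apply/measurable_EFinP; case: mg.
    move=> x _ /=; rewrite lee_fin (le_trans (normRe _))//.
    by rewrite (le_trans _ (ler_norm _))// (ccvg_le (gg x))//; exact: nearW.
  have [] := @dominated_convergence _ _ _ mu setT measurableT
    (fun n x => (complex.Re (g_ n x))%:E) (fun x => (complex.Re (g x))%:E) (EFin \o k).
  - by move=> n; apply/measurable_EFinP; case: (mg_ n).
  - by apply/measurable_EFinP; case: mg.
  - apply: aeW => x _; apply: cvg_EFin; first exact: nearW.
    by have /ccvgP[] := gg x.
  - exact: ik.
  - by apply: aeW => x n _ /=; rewrite lee_fin (le_trans (normRe _)).
  - by move=> _ _; exact.
apply: fine_cvg => /=; rewrite fineK; last first.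
  apply: integrable_fin_num => //.
  apply: le_integrable ik => //; first by apply/measurable_EFinP; case: mg.
  move=> x _ /=; rewrite lee_fin (le_trans (normIm _))//.
  by rewrite (le_trans _ (ler_norm _))// (ccvg_le (gg x))//; exact: nearW.
have [] := @dominated_convergence _ _ _ mu setT measurableT
  (fun n x => (complex.Im (g_ n x))%:E) (fun x => (complex.Im (g x))%:E) (EFin \o k).
- by move=> n; apply/measurable_EFinP; case: (mg_ n).
- by apply/measurable_EFinP; case: mg.
- apply: aeW => x _; apply: cvg_EFin; first exact: nearW.
  by have /ccvgP[] := gg x.
- exact: ik.
- by apply: aeW => x n _ /=; rewrite lee_fin (le_trans (normIm _)).
- by move=> _ _; exact.
Qed.

End ComplexIntegral.

(** * Primitives of integrable functions *)

Section Primitive.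
Context {R : realType}.
Implicit Types (g h : R -> R[i]) (k : R -> R) (x y : R).
Local Notation N := (@Normc.normc R).
Local Notation mu := (@lebesgue_measure R).

Definition rprimitive k x : R := \int[mu]_(t in `]-oo, x]) k t.

Lemma rprimitiveB k a b : mu.-integrable setT (EFin \o k) -> a <= b ->
  rprimitive k b - rprimitive k a = \int[mu]_(t in `]a, b]) k t.
Proof.
move=> ik ab; rewrite /rprimitive Rintegral_itvB//.
exact: integrableS ik.
Qed.

Lemma rprimitive_is_derive k x : mu.-integrable setT (EFin \o k) ->
  {for x, continuous k} -> is_derive x 1 (rprimitive k) (k x).
Proof.
move=> ik kx.
have xx1 : x < x + 1 by rewrite ltrDl.
have [] := @continuous_FTC1 R k -oo%O x (x + 1) xx1 _ _ kx.
- exact: integrableS ik.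
- exact: ltNyr.
by move=> dk kE; apply: (DeriveDef dk); rewrite -derive1E; exact: kE.
Qed.

Lemma rprimitive_continuous k x : mu.-integrable setT (EFin \o k) ->
  {for x, continuous (rprimitive k)}.
Proof.
move=> ik; apply/cvgrPdist_le => e e0.
have [d [d0 hd]] := integral_normr_continuous ik e0.
have main a b : a <= b -> b - a < d -> `|rprimitive k b - rprimitive k a| <= e.
  move=> ab bad; rewrite rprimitiveB//.
  apply: (@le_trans _ _ (\int[mu]_(t in `]a, b]) `|k t|)).
    by apply: le_normr_Rintegral => //; exact: integrableS ik.
  apply/ltW/hd; first exact: measurable_itv.
  rewrite [X in (X < _)%E]lebesgue_measure_itv /= lte_fin.
  by case: ifPn => _; rewrite -?EFinD lte_fin.
apply/nbhs_ballP; exists d => // y; rewrite /ball /= ltr_norml => /andP[h1 h2].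
have [xy|/ltW yx] := leP x y; last by apply: main.
by rewrite distrC; apply: main => //; lra.
Qed.


Definition cprimitive g x : R[i] :=
  rprimitive (fun t => complex.Re (g t)) x +i*
  rprimitive (fun t => complex.Im (g t)) x.

Lemma cprimitive_derive g x : cintegrable g -> ccontinuous_at g x ->
  cis_derive (cprimitive g) x (g x).
Proof.
by move=> [gr gi] /ccontinuous_atP[cr ci]; split; exact: rprimitive_is_derive.
Qed.

Lemma cprimitive_continuous g x : cintegrable g -> ccontinuous_at (cprimitive g) x.
Proof.
by move=> [gr gi]; apply/ccontinuous_atP; split; exact: rprimitive_continuous.
Qed.

(** This is how an integral over the line enters the estimates: they only ever
    handle increments of a primitive over bounded intervals. *)
Lemma cprimitive_cvg g : cintegrable g ->
  ccvg (fun n => cprimitive g n%:R - cprimitive g (- n%:R)) (cintegral g).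
Proof.
move=> ig; have mg := cintegrable_measurable ig.
pose I n : set R := `](- n%:R), n%:R].
pose g_ n x : R[i] := (\1_(I n) x : R)%:C * g x.
have -> : (fun n => cprimitive g n%:R - cprimitive g (- n%:R)) =
    (fun n => cintegral (g_ n)).
  apply/funext => n; have nn : - n%:R <= n%:R :> R.
    by rewrite (@le_trans _ _ 0) ?oppr_le0.
  have [gr gi] := ig.
  apply: complexP; rewrite ?Re_add ?Im_add ?Re_opp ?Im_opp /= rprimitiveB//.
    rewrite Rintegral_mkcond; apply: eq_Rintegral => x _.
    by rewrite /g_ Re_mul /= mul0r subr0 patchE indicE /I; case: ifP; rewrite ?mul1r ?mul0r.
  rewrite Rintegral_mkcond; apply: eq_Rintegral => x _.
  by rewrite /g_ Im_mul /= mul0r addr0 patchE indicE /I; case: ifP; rewrite ?mul1r ?mul0r.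
apply: (cintegral_dominated (k := fun x => N (g x))) => //.
- move=> n; apply: cmeasurableM => //; split => //=.
  by apply: measurable_indic; exact: measurable_itv.
- exact: cintegrable_norm.
- move=> n x; rewrite /g_ Normc.normcM normc_real indicE.
  by case: (x \in _); rewrite ?normr0 ?normr1 ?mul0r ?mul1r ?normc_ge0.
- move=> x e e0; near=> n; rewrite /g_ indicE mem_set ?mul1r ?subrr ?normc0 ?ltW//.
  have xn : `|x| < n%:R by near: n; exact: nbhs_infty_gtr.
  by rewrite /I /= in_itv /=; move: xn; rewrite ltr_norml => /andP[-> /ltW].
Unshelve. all: by end_near. Qed.

End Primitive.

(** * Monotone functions with prescribed slopes *)

Section Majorant.
Context {R : realType}.
Implicit Types (k : R -> R) (x y : R).
Local Notation mu := (@lebesgue_measure R).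

Section Layers.
Variables (k : R -> R) (a b e : R).
Hypothesis k_ge0 : forall x, 0 <= k x.
Hypothesis mk : measurable_fun setT k.
Hypothesis e_gt0 : 0 < e.

(** The strict upper bound leaves room, at each point of the layer, for a slope
    larger than [k]. *)
Definition layer n : set R :=
  `[a, b] `&` k @^-1` `[n%:R * e, n.+1%:R * e[.

Lemma measurable_layer n : measurable (layer n).
Proof.
apply: measurableI; first exact: measurable_itv.
by rewrite -[X in measurable X]setTI; apply: mk => //; exact: measurable_itv.
Qed.

Lemma bigcup_layer : \bigcup_n layer n = `[a, b].
Proof.
apply/seteqP; split=> [x [n _ []]//|x abx].
exists (Num.truncn (k x / e)) => //; split => //=.
rewrite in_itv /= -ler_pdivlMr// -ltr_pdivrMr//.
by apply: truncn_itv; rewrite divr_ge0// ltW.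
Qed.

Lemma trivIset_layer : trivIset setT layer.
Proof.
have main m n x : m%:R * e <= k x -> k x < n.+1%:R * e -> (m <= n)%N.
  by move=> h1 h2; have := le_lt_trans h1 h2; rewrite ltr_pM2r// ltr_nat ltnS.
move=> m n _ _ [x [[_ /=]]]; rewrite in_itv /= => /andP[h1 h2] [_ /=].
rewrite in_itv /= => /andP[h3 h4].
by apply/eqP; rewrite eqn_leq (main _ _ _ h1 h4) (main _ _ _ h3 h2).
Qed.

(** Rounding [k] up to the next multiple of [e] costs at most [e] at each point. *)
Lemma layer_sum : a <= b -> mu.-integrable setT (EFin \o k) ->
  (\sum_(n <oo) (n.+1%:R * e)%:E * mu (layer n) <=
   (\int[mu]_(x in `[a, b]) k x + e * (b - a))%:E)%E.
Proof.
move=> ab ik.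
have mke : measurable_fun `[a, b] (EFin \o (fun x => k x + e)).
  by apply/measurable_EFinP; apply: measurable_funD => //; exact: measurable_funTS.
have -> : (\int[mu]_(x in `[a, b]) k x + e * (b - a))%:E =
    (\int[mu]_(x in `[a, b]) (k x + e)%:E)%E.
  under eq_integral do rewrite EFinD.
  rewrite ge0_integralD//=.
  - rewrite integral_cst//= lebesgue_measure_itv /= lte_fin EFinD.
    congr (_ + _)%E.
      rewrite /Rintegral fineK//; apply: integrable_fin_num => //.
      exact: integrableS ik.
    rewrite (_ : (if _ then _ else _) = (b - a)%:E) ?EFinM//.
    by case: ltP => // ba; congr EFin; lra.
  - by move=> x _; rewrite lee_fin.
  - by apply/measurable_EFinP; exact: measurable_funTS.
  - by move=> x _; rewrite lee_fin ltW.
rewrite -bigcup_layer ge0_integral_bigcup//; last 4 first.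
- exact: measurable_layer.
- by rewrite bigcup_layer.
- by move=> x _; rewrite lee_fin addr_ge0// ltW.
- exact: trivIset_layer.
apply: lee_nneseries => [n _ _|n _].
  by rewrite mule_ge0// lee_fin mulr_ge0// ltW.
rewrite -integral_cst; last exact: measurable_layer.
apply: ge0_le_integral => //.
- exact: measurable_layer.
- by move=> x _; rewrite lee_fin mulr_ge0// ltW.
- by apply: (measurable_funS _ _ mke) => //; exact: subIsetl.
- move=> x [_ /=]; rewrite in_itv /= lee_fin => /andP[+ _].
  by rewrite -(natr1 n) mulrDl mul1r lerD2r.
Qed.

End Layers.

(** The Vitali-Caratheodory idea: covering each layer of [k] by a slightly
    larger open set gives a nondecreasing function whose increments to the right
    of every point dominate those of slope [k], at an arbitrarily small cost. *)
Lemma monotone_majorant k a b (eps : R) : (forall x, 0 <= k x) ->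
  mu.-integrable setT (EFin \o k) -> a < b -> 0 < eps ->
  exists F : R -> R, [/\ forall x y, a <= x -> x <= y -> y <= b -> F x <= F y,
    F b - F a <= \int[mu]_(x in `[a, b]) k x + eps &
    forall x, a <= x < b -> exists c, k x < c /\ exists2 d, 0 < d &
      forall y, x < y -> y < x + d -> y <= b -> c * (y - x) <= F y - F x].
Proof.
move=> k0 ik ab eps0.
have mk : measurable_fun setT k by move/measurable_int/measurable_EFinP : ik.
have ba0 : 0 < b - a by rewrite subr_gt0.
(* Half of [eps] pays for the rounding, the other half for the open covers. *)
pose e := eps / 2 / (b - a).
have e0 : 0 < e by rewrite /e !divr_gt0.
pose E := layer k a b e.
pose c n : R := n.+1%:R * e.
have c0 n : 0 < c n by rewrite /c mulr_gt0.
have mE n : measurable (E n) by exact: measurable_layer.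
have le_mu (A B : set R) : measurable A -> measurable B -> A `<=` B -> (mu A <= mu B)%E.
  by move=> mA mB sAB; apply: le_measure => //; rewrite inE.
have muU2 (A B : set R) : measurable A -> measurable B ->
    (mu (A `|` B) <= mu A + mu B)%E by move=> mA mB; exact: measureU2.
have muU (A B : set R) : measurable A -> measurable B -> A `&` B = set0 ->
    (mu (A `|` B) = mu A + mu B)%E by move=> mA mB AB; exact: (@measureU _ _ _ mu).
have muab : mu `[a, b] = (b - a)%:E.
  by rewrite lebesgue_measure_itv /= lte_fin ab.
have Efin n : (mu (E n) < +oo)%E.
  apply: (@le_lt_trans _ _ (mu `[a, b])); last by rewrite muab ltry.
  by apply: le_mu => //; exact: subIsetl.
have eta0 n : 0 < (eps / 2) / (2 ^ n.+1)%:R / c n.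
  by rewrite !divr_gt0// ltr0n expn_gt0.
have /choice[V hV] n := lebesgue_regularity_outer (mE n) (Efin n) (eta0 n).
have mV n : measurable (V n) by apply: open_measurable; case: (hV n).
pose nu (A : set R) : \bar R := (\sum_(n <oo) (c n)%:E * mu (V n `&` A))%E.
have nu_ge0 A : (0 <= nu A)%E.
  by apply: nneseries_ge0 => n _ _; rewrite mule_ge0// lee_fin ltW.
have nu_tot : (nu `[a, b]%classic <= (\int[mu]_(x in `[a, b]) k x + eps)%:E)%E.

  have h := @epsilon_trick R (fun n => ((c n)%:E * mu (E n))%E) (eps / 2) xpredT
    (fun n => mule_ge0 (ltW (c0 n : (0 < (c n)%:E)%E)) (measure_ge0 _ _))
    (ltW (divr_gt0 eps0 (ltr0n _ 2))).
  apply: (@le_trans _ _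
      (\sum_(n <oo) ((c n)%:E * mu (E n) + (eps / 2 / (2 ^ n.+1)%:R)%:E)))%E.
    apply: lee_nneseries => [n _ _|n _]; first by rewrite mule_ge0// lee_fin ltW.
    have [oV EV muV] := hV n.
    apply: (@le_trans _ _ ((c n)%:E * (mu (E n) + mu (V n `\` E n))))%E.
      rewrite lee_pmul2l ?lte_fin//.
      have mVE : measurable (V n `\` E n) by exact: measurableD.
      apply: le_trans (muU2 _ _ (mE n) mVE).
      apply: le_mu.
      - by apply: measurableI => //; exact: measurable_itv.
      - by apply: measurableU => //; exact: measurableD.
      - move=> x [Vx _]; have [Ex|nEx] := pselect (E n x); first by left.
        by right; split.
    rewrite ge0_muleDr// leeD2l//.
    apply: (@le_trans _ _ ((c n)%:E * (eps / 2 / (2 ^ n.+1)%:R / c n)%:E))%E.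
      by rewrite lee_pmul2l ?lte_fin// ltW.
    by rewrite -EFinM lee_fin mulrCA divff ?mulr1// gt_eqF.
  apply: (le_trans h); have hl := layer_sum (b := b) k0 mk e0 (ltW ab) ik.
  apply: le_trans (leeD2r _ hl) _; rewrite -EFinD lee_fin -addrA lerD2l.
  have -> : e * (b - a) = eps / 2 by rewrite /e mulfVK ?gt_eqF.
  by rewrite -splitr.
have nu_fin A : measurable A -> A `<=` `[a, b] -> nu A \is a fin_num.
  move=> mA sA; rewrite ge0_fin_numE//.
  apply: (@le_lt_trans _ _ (nu `[a, b]%classic)).
    apply: lee_nneseries => [n _ _|n _]; first by rewrite mule_ge0// lee_fin ltW.
    rewrite lee_pmul2l ?lte_fin//; apply: le_mu.
    - exact: measurableI.
    - by apply: measurableI => //; exact: measurable_itv.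
    - exact: setIS.
  by apply: le_lt_trans nu_tot _; rewrite ltry.
have nuU x y : a <= x -> x <= y -> y <= b ->
    (nu `[a, y] = nu `[a, x] + nu `]x, y])%E.
  move=> ax xy yb; rewrite /nu -nneseriesD; last 2 first.
  - by move=> n _ _; rewrite mule_ge0// lee_fin ltW.
  - by move=> n _ _; rewrite mule_ge0// lee_fin ltW.
  apply: eq_eseriesr => n _; rewrite -ge0_muleDr// -muU; last 3 first.
  - by apply: measurableI => //; exact: measurable_itv.
  - by apply: measurableI => //; exact: measurable_itv.
  - rewrite -setIIr (_ : `[a, x] `&` `]x, y] = set0) ?setI0//.
    rewrite -subset0 => z [] /=; rewrite !in_itv /= => /andP[_ zx] /andP[xz _].
    by move: (lt_le_trans xz zx); rewrite ltxx.
  by rewrite -setIUr -itv_bndbnd_setU// bnd_simp.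
pose F x := fine (nu `[a, x]).
have sub x y : a <= x -> y <= b -> `]x, y] `<=` `[a, b].
  move=> ax yb z /=; rewrite !in_itv /= => /andP[xz zy].
  by rewrite (le_trans zy yb) (le_trans ax (ltW xz)).
have sub' y : y <= b -> `[a, y] `<=` `[a, b].
  move=> yb z /=; rewrite !in_itv /= => /andP[-> zy].
  by rewrite (le_trans zy yb).
have FB x y : a <= x -> x <= y -> y <= b -> F y - F x = fine (nu `]x, y]).
  move=> ax xy yb; rewrite /F (nuU _ _ ax xy yb) fineD.
  - by rewrite addrC addKr.
  - by apply: nu_fin; [exact: measurable_itv|apply: sub'; exact: le_trans xy yb].
  - by apply: nu_fin; [exact: measurable_itv|exact: sub].
exists F; split.
- by move=> x y ax xy yb; rewrite -subr_ge0 FB// fine_ge0.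
- rewrite FB ?lexx ?(ltW ab)// -lee_fin fineK.
    apply: le_trans nu_tot; apply: lee_nneseries => [n _ _|n _].
      by rewrite mule_ge0// lee_fin ltW.
    rewrite lee_pmul2l ?lte_fin//; apply: le_mu.
    + by apply: measurableI => //; exact: measurable_itv.
    + by apply: measurableI => //; exact: measurable_itv.
    + by apply: setIS; exact: sub.
  by apply: nu_fin; [exact: measurable_itv|exact: sub].
- move=> x /andP[ax xb].
  have : (\bigcup_n E n) x by rewrite bigcup_layer//= in_itv /= ax ltW.
  move=> [n _ Enx]; exists (c n); split.
    by case: Enx => _ /=; rewrite in_itv /= => /andP[].
  have [oV EV _] := hV n.
  have /nbhs_ballP[d /= d0 hd] : nbhs x (V n) by apply: open_nbhs_nbhs; split => //; exact: EV.
  exists d => // y xy yxd yb; rewrite FB ?(ltW xy)//.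
  rewrite -lee_fin fineK; last by apply: nu_fin; [exact: measurable_itv|exact: sub].
  apply: (@le_trans _ _ (\sum_(0 <= i < n.+1) (c i)%:E * mu (V i `&` `]x, y]))%E).
    rewrite big_nat_recr//= -[X in (X <= _)%E]add0e leeD//.
      by apply: sume_ge0 => i _; rewrite mule_ge0// lee_fin ltW.
    rewrite setIidr ?lebesgue_measure_itv /= ?lte_fin ?xy ?EFinM//.
    move=> z /=; rewrite in_itv /= => /andP[xz zy]; apply: hd.
    by rewrite /ball /= ltr_norml; apply/andP; split; lra.
  by apply: nneseries_lim_ge => i _ _; rewrite mule_ge0// lee_fin ltW.
Qed.

End Majorant.

(** * A mean value inequality *)

Section MeanValue.
Context {R : realType}.
Implicit Types (T : R -> R[i]) (F L k : R -> R) (x y a b : R).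
Local Notation N := (@Normc.normc R).
Local Notation mu := (@lebesgue_measure R).

Definition ccontinuous_on a b T : Prop := forall x, a <= x <= b ->
  forall e, 0 < e -> exists2 d, 0 < d &
    forall y, a <= y <= b -> `|y - x| < d -> N (T y - T x) <= e.

Lemma ccontinuous_on_at a b T : (forall x, a <= x <= b -> ccontinuous_at T x) ->
  ccontinuous_on a b T.
Proof. by move=> h x xab e e0; have [d d0 hd] := h x xab e e0; exists d => // y _ /hd. Qed.

Lemma ccontinuous_on_sub a b c d T : a <= c -> d <= b ->
  ccontinuous_on a b T -> ccontinuous_on c d T.
Proof.
move=> ac db h x /andP[cx xd] e e0.
have [|r r0 hr] := h x _ e e0; first by rewrite (le_trans ac cx) (le_trans xd db).
exists r => // y /andP[cy yd]; apply: hr.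
by rewrite (le_trans ac cy) (le_trans yd db).
Qed.

(** The supremum of the points up to which the inequality holds from [a] on has
    that property itself, by continuity of [T] and monotonicity of [F]; the local
    hypothesis would push it further if it were smaller than [b]. *)
Lemma increment_le_halfopen a b T F : a <= b -> ccontinuous_on a b T ->
  (forall x y, a <= x -> x <= y -> y <= b -> F x <= F y) ->
  (forall x, a <= x < b -> exists2 d, 0 < d &
    forall y, x < y -> y < x + d -> y <= b -> N (T y - T x) <= F y - F x) ->
  N (T b - T a) <= F b - F a.
Proof.
move=> ab cT hF hloc.
pose S := [set x | a <= x <= b /\ N (T x - T a) <= F x - F a].
have Sa : S a by split; rewrite ?lexx ?ab// !subrr normc0.
have supS : has_sup S by split; [exists a|exists b => x [/andP[]]].
set s := sup S.
have as_ : a <= s by apply: ub_le_sup => //; case: supS.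
have sb : s <= b by apply: ge_sup; [exists a|move=> x [/andP[]]].
have Ss : N (T s - T a) <= F s - F a.
  apply/ler_addgt0Pr => e e0.
  have [|d d0 hd] := cT s _ e e0; first by rewrite as_ sb.
  have [x [/andP[ax xb] Sx] sdx] := sup_adherent d0 supS.
  have xs : x <= s by apply: ub_le_sup; [case: supS|split => //; rewrite ax xb].
  apply: (@le_trans _ _ (N (T s - T x) + N (T x - T a))).
    by rewrite (_ : T s - T a = (T s - T x) + (T x - T a)) ?normcD//; ring.
  have hFx : F x <= F s by exact: hF.
  have : N (T x - T s) <= e.
    apply: hd; first by rewrite ax xb.
    by rewrite distrC ger0_norm ?subr_ge0//; move: sdx; rewrite -/s; lra.
  by rewrite normcB; lra.
have [sltb|] := ltP s b; last first.
  by move=> bs; have -> : b = s by apply/eqP; rewrite eq_le bs sb.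
have [|d d0 hd] := hloc s; first by rewrite as_ sltb.
pose y := Num.min b (s + d / 2).
have sy : s < y by rewrite lt_min sltb ltrDl divr_gt0.
have yb : y <= b by rewrite ge_min lexx.
have ysd : y < s + d by rewrite gt_min ltrD2l ltr_pdivrMr// ltr_pMr// ltr1n orbT.
have Sy : S y.
  split; first by rewrite yb andbT (le_trans as_ (ltW sy)).
  have := hd y sy ysd yb.
  have := normcD (T y - T s) (T s - T a).
  by rewrite (_ : T y - T s + (T s - T a) = T y - T a); [lra|ring].
have : y <= s by apply: ub_le_sup => //; case: supS.
by rewrite leNgt sy.
Qed.

(** At [a] continuity suffices: start from a point slightly to the right. *)
Lemma increment_le a b T F : a <= b -> ccontinuous_on a b T ->
  (forall x y, a <= x -> x <= y -> y <= b -> F x <= F y) ->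
  (forall x, a < x < b -> exists2 d, 0 < d &
    forall y, x < y -> y < x + d -> y <= b -> N (T y - T x) <= F y - F x) ->
  N (T b - T a) <= F b - F a.
Proof.
rewrite le_eqVlt => /predU1P[->|ab]; first by rewrite !subrr normc0.
move=> cT hF hloc; apply/ler_addgt0Pr => e e0.
have [|d d0 hd] := cT a _ e e0; first by rewrite lexx ltW.
pose c := Num.min b (a + d / 2).
have ac : a < c by rewrite lt_min ab ltrDl divr_gt0.
have cb : c <= b by rewrite ge_min lexx.
have cd : c < a + d by rewrite gt_min ltrD2l ltr_pdivrMr// ltr_pMr// ltr1n orbT.
have h : N (T b - T c) <= F b - F c.
  apply: increment_le_halfopen => //.
  - by apply: ccontinuous_on_sub cT => //; exact: ltW.
  - by move=> x y cx; apply: hF; exact: le_trans (ltW ac) cx.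
  - by move=> x /andP[cx xb]; apply: hloc; rewrite xb (lt_le_trans ac cx).
have hFc : F a <= F c by apply: hF => //; exact: ltW.
have : N (T c - T a) <= e.
  by apply: hd; rewrite ?cb ?(ltW ac)// ger0_norm ?subr_ge0 ?(ltW ac)//; lra.
have := normcD (T b - T c) (T c - T a).
by rewrite (_ : T b - T c + (T c - T a) = T b - T a); [lra|ring].
Qed.

(** The derivative [T'] need not be continuous, nor bounded, so that [T] is not
    known to be the integral of [T']; the majorant of [k] constructed above takes
    the place of a primitive of [k]. The differentiable part [L] of the bound is
    kept apart since its increments are known exactly. *)
Lemma mean_value_le a b T (T' : R -> R[i]) L (L' k : R -> R) : a <= b ->
  ccontinuous_on a b T ->
  (forall x, a < x < b -> cis_derive T x (T' x)) ->
  (forall x y, a <= x -> x <= y -> y <= b -> L x <= L y) ->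
  (forall x, a < x < b -> is_derive x 1 L (L' x)) ->
  (forall x, 0 <= k x) -> mu.-integrable setT (EFin \o k) ->
  (forall x, a < x < b -> N (T' x) <= L' x + k x) ->
  N (T b - T a) <= L b - L a + \int[mu]_(x in `[a, b]) k x.
Proof.
rewrite le_eqVlt => /predU1P[->|ab].
  by move=> *; rewrite !subrr normc0 add0r Rintegral_ge0.
move=> cT dT hL dL k0 ik hT; apply/ler_addgt0Pr => e e0.
have [F [hF Fe Floc]] := monotone_majorant k0 ik ab e0.
suff : N (T b - T a) <= (L b + F b) - (L a + F a) by lra.
apply: (increment_le (F := fun x => L x + F x) (ltW ab) cT).
  by move=> x y ax xy yb; rewrite lerD ?hL ?hF.
move=> x axb; have /andP[ax xb] := axb.
have [|c [kc [d1 d10 h1]]] := Floc x; first by rewrite xb ltW.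
have e1 : 0 < (c - k x) / 2 by rewrite divr_gt0// subr_gt0.
have [d2 d20 h2] := cis_derive_expansion (dT x axb) e1.
have [d3 d30 h3] := (is_derive_expansion _ _ _).1 (dL x axb) _ e1.
exists (Num.min d1 (Num.min d2 d3)); first by rewrite !lt_min d10 d20.
move=> y xy; rewrite -ltrBlDl !lt_min => /and3P[yd1 yd2 yd3] yb.
have yx0 : 0 < y - x by rewrite subr_gt0.
have := h1 y xy; rewrite -ltrBlDl => /(_ yd1 yb) {}h1.
have := h2 y; rewrite (gtr0_norm yx0) => /(_ yd2) {}h2.
have := h3 y; rewrite (gtr0_norm yx0) => /(_ yd3) /ler_normlP[{}h3 _].
have := hT x axb; rewrite -(ler_pM2r yx0) => hTx.
have := normcD (T y - T x - (y - x)%:C * T' x) ((y - x)%:C * T' x).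
rewrite subrK Normc.normcM normc_real (gtr0_norm yx0) => h4.
rewrite (_ : L y + F y - (L x + F x) = (L y - L x) + (F y - F x)); last by ring.
rewrite mulrDl in hTx; rewrite (mulrC (y - x) (L' x)) in h3.
rewrite (mulrC (y - x) (N _)) in h4.
move: h1 h2 h3 hTx h4; set A := (c - k x) / 2 * (y - x).
have -> : c * (y - x) = k x * (y - x) + 2 * A by rewrite /A; field.
lra.
Qed.

End MeanValue.

(** * Oscillatory increments *)

Section Oscillation.
Context {R : realType}.
Implicit Types (P v : R -> R[i]) (A phi L : R -> R) (x y a b p q : R).
Local Notation N := (@Normc.normc R).
Local Notation mu := (@lebesgue_measure R).

Lemma mvt_closed (g dg : R -> R) a b : a <= b ->
  (forall x, a <= x <= b -> is_derive x 1 g (dg x)) ->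
  exists2 c, a <= c <= b & g b - g a = dg c * (b - a).
Proof.
move=> ab hg; have [x||c] := @MVT_segment R g dg a b ab.
- by rewrite in_itv /= => /andP[ax xb]; apply: hg; rewrite !ltW.
- apply: derivable_within_continuous => x; rewrite in_itv /= => xab.
  by have hgx := hg x xab; apply: (@ex_derive _ _ _ _ _ _ _ hgx).
- by rewrite in_itv /= => cab ->; exists c.
Qed.

Lemma derive_ge0_nondecreasing L (L' : R -> R) a b :
  (forall x, a <= x <= b -> is_derive x 1 L (L' x)) ->
  (forall x, a <= x <= b -> 0 <= L' x) ->
  forall x y, a <= x -> x <= y -> y <= b -> L x <= L y.
Proof.
move=> dL L0 x y ax xy yb.
have [z /andP[xz zy]|c /andP[xc cy] h] := @mvt_closed L L' x y xy.
  by apply: dL; rewrite (le_trans ax xz) (le_trans zy yb).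
rewrite -subr_ge0 h mulr_ge0 ?subr_ge0// L0//.
by rewrite (le_trans ax xc) (le_trans cy yb).
Qed.

(** Integration by parts without integrals: if [P' = v A phi' e^(i phi)] then
    [P + i v A e^(i phi)] has derivative [i (v' A + v A') e^(i phi)], from which
    the phase speed [phi'] has disappeared. The mean value inequality applies to
    it although [v'] is merely integrable. *)
Lemma oscillation_by_parts P v A A' phi phi' L L' a b S M :
  a <= b ->
  (forall x, a <= x <= b -> cis_derive P x
    (v x * (A x * phi' x)%:C * expi (phi x))) ->
  cdifferentiable v -> cintegrable (cderiv v) ->
  (forall x, a <= x <= b -> N (v x) <= S) ->
  (forall x, a <= x <= b -> is_derive x 1 A (A' x)) ->
  (forall x, a <= x <= b -> is_derive x 1 phi (phi' x)) ->
  (forall x, a <= x <= b -> is_derive x 1 L (L' x)) ->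
  (forall x, a <= x <= b -> `|A x| <= M) ->
  (forall x, a <= x <= b -> S * `|A' x| <= L' x) ->
  N (P b - P a) <=
    2 * (S * M) + (L b - L a) + M * \int[mu]_(x in `[a, b]) N (cderiv v x).
Proof.
move=> ab dP dv iv vS dA dphi dL AM AL.
have aab : a <= a <= b by rewrite lexx.
have bab : a <= b <= b by rewrite ab lexx.
have S0 : 0 <= S := le_trans (normc_ge0 _) (vS a aab).
have M0 : 0 <= M := le_trans (normr_ge0 _) (AM a aab).
pose H x : R[i] := v x * (A x)%:C * expi (phi x).
pose T x : R[i] := P x + 'i%C * H x.
have dT x : a <= x <= b -> cis_derive T x
    ('i%C * (cderiv v x * (A x)%:C + v x * (A' x)%:C) * expi (phi x)).
  move=> xab; have := cis_deriveD (dP x xab) (cis_deriveZ 'i%C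
    (cis_deriveM (cis_deriveM ((cis_deriveP _).1 dv x) (cis_derive_real (dA x xab)))
    (cis_derive_expi (dphi x xab)))).
  move/cis_derive_eq; apply.
  have ii : 'i%C * 'i%C = -1 :> R[i] by rewrite -expr2 sqr_i.
  rewrite rmorphM /=; set e := expi _; set i := 'i%C in ii *.
  transitivity ((1 + i * i) * v x * (A x)%:C * (phi' x)%:C * e +
     i * (cderiv v x * (A x)%:C + v x * (A' x)%:C) * e); first by ring.
  by rewrite ii subrr !mul0r add0r.
have HM x : a <= x <= b -> N (H x) <= S * M.
  move=> xab; rewrite /H !Normc.normcM normc_expi mulr1 normc_real.
  by rewrite ler_pM ?normc_ge0 ?vS ?AM.
have L'0 x : a <= x <= b -> 0 <= L' x.
  by move=> xab; apply: le_trans (AL x xab); rewrite mulr_ge0.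
have := @mean_value_le R a b T _ L L' (fun x => M * N (cderiv v x)) ab _ _
  (derive_ge0_nondecreasing dL L'0).
move=> /(_ (fun x => 'i%C * (cderiv v x * (A x)%:C + v x * (A' x)%:C) * expi (phi x))).
have oc x : a < x < b -> a <= x <= b by move=> /andP[ax xb]; rewrite !ltW.
have -> : \int[mu]_(x in `[a, b]) (M * N (cderiv v x)) =
    M * \int[mu]_(x in `[a, b]) N (cderiv v x).
  rewrite RintegralZl//; apply: integrableS (cintegrable_norm iv) => //.
move=> h.
have {}h : N (T b - T a) <= L b - L a + M * \int[mu]_(x in `[a, b]) N (cderiv v x).
  apply: h.
  - by apply: ccontinuous_on_at => x /dT; exact: cis_derive_continuous.
  - by move=> x /oc/dT.
  - by move=> x /oc/dL.
  - by move=> x; rewrite mulr_ge0 ?normc_ge0.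
  - by apply: integrable_scale; exact: cintegrable_norm.
  - move=> x /oc xab; rewrite !Normc.normcM normc_expi normc_i mul1r mulr1.
    apply: le_trans (normcD _ _) _; rewrite !Normc.normcM !normc_real addrC lerD//.
      by apply: le_trans (AL x xab); rewrite ler_wpM2r ?vS.
    by rewrite mulrC ler_wpM2r ?normc_ge0 ?AM.
have -> : P b - P a = (T b - T a) + (- ('i%C * H b) + 'i%C * H a) by rewrite /T; ring.
apply: le_trans (normcD _ _) _; have := normcD (- ('i%C * H b)) ('i%C * H a).
rewrite normcN (Normc.normcM _ (H b)) (Normc.normcM _ (H a)) normc_i !mul1r.
by have := HM a aab; have := HM b bab; lra.
Qed.

Variables (f f1 f2 : R -> R) (al p1 t x : R) (ut P : R -> R[i]).
Hypotheses (al01 : 0 < al < 1) (t_gt0 : 0 < t).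
Hypothesis df : forall p, is_derive p 1 f (f1 p).
Hypothesis df2 : forall p, is_derive p 1 (f1) (f2 p).
Hypothesis f2_gt0 : forall p, 0 < f2 p.
Hypothesis dut : cdifferentiable ut.
Hypothesis iut : cintegrable (cderiv ut).
Hypothesis cP : forall p, ccontinuous_at P p.
Hypothesis dP : forall p, p != p1 -> cis_derive P p
  ((`|p - p1| `^ (al - 1))%:C * ut p * expi (- (t * f p) + x * p)).

(** Orientations: [s] tells the side of the singularity [p1] on which an interval
    lies, [r] the sign of the phase speed there. *)
Definition unit_sign (s : R) := s = 1 \/ s = -1.

Lemma unit_signE s (y : R) : unit_sign s -> 0 < s * y -> `|y| = s * y.
Proof. by move=> [->|->] h; [rewrite mul1r in h * | rewrite mulN1r in h *]; [rewrite gtr0_norm|rewrite ltr0_norm// -oppr_gt0]. Qed.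

Lemma unit_sign_sqr s : unit_sign s -> s * s = 1.
Proof. by move=> [->|->]; rewrite ?mulr1 ?mulrNN ?mulr1. Qed.

(** In [oscillation_by_parts], [A] is up to the factor [- t^-1] the product of
    the power [w] and of the inverse [1 / rho] of the phase speed. Each factor is
    monotone with constant sign on the interval, so its variation is at most its
    bound, [D] or [m^-1]; with the two boundary terms this makes the constant 4. *)
Lemma oscillation_estimate s r d m a b S :
  unit_sign s -> unit_sign r -> a <= b -> 0 < d -> 0 < m ->
  (forall p, a <= p <= b -> d <= s * (p - p1)) ->
  (forall p, a <= p <= b -> m <= r * (f1 p - x / t)) ->
  (forall p, a <= p <= b -> N (ut p) <= S) ->
  N (P b - P a) <= t^-1 * d `^ (al - 1) * m^-1 *
    (4 * S + \int[mu]_(p in `[a, b]) N (cderiv ut p)).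
Proof.
move=> hs hr ab d0 m0 hd hm uS; have /andP[al0 al1] := al01.
have aab : a <= a <= b by rewrite lexx.
have bab : a <= b <= b by rewrite ab lexx.
have S0 : 0 <= S := le_trans (normc_ge0 _) (uS a aab).
pose D := d `^ (al - 1); have D0 : 0 <= D by exact: powR_ge0.
pose w p := (s * (p - p1)) `^ (al - 1).
pose w' p := (al - 1) * (s * (p - p1)) `^ (al - 1 - 1) * s.
pose rho p := f1 p - x / t.
have sp p : a <= p <= b -> 0 < s * (p - p1) by move=> /hd; exact: lt_le_trans.
have wE p : a <= p <= b -> `|p - p1| `^ (al - 1) = w p.
  by move=> /sp h; rewrite (unit_signE hs h).
have dw p : a <= p <= b -> is_derive p 1 w (w' p).
  move=> /sp h.
  have d1 : is_derive p 1 (fun y => s * (y - p1)) s.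
    apply: is_derive_eq (is_deriveM (is_derive_cst s p 1)
      (is_deriveB (is_derive_id p 1) (is_derive_cst p1 p 1))) _.
    by rewrite /GRing.scale /= subr0 mulr1 mulr0 addr0.
  have d2 := is_derive1_powR (al - 1) h.
  exact: (@is_derive1_comp _ _ (fun y => s * (y - p1)) p _ _ d2 d1).
have wD p : a <= p <= b -> 0 <= w p <= D.
  move=> pab; rewrite powR_ge0 /=.
  rewrite /w /D -(opprB 1 al) !powRN lef_pV2 ?posrE ?powR_gt0 ?sp//.
  by rewrite ge0_ler_powR ?nnegrE ?subr_ge0 ?(ltW al1) ?(ltW d0) ?(ltW (sp _ _)) ?hd.
have rho0 p : a <= p <= b -> rho p != 0.
  move=> /hm h; apply: contraTneq (lt_le_trans m0 h).
  by rewrite -/(rho p) => ->; rewrite mulr0 ltxx.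
have rhom p : a <= p <= b -> `|(rho p)^-1| <= m^-1.
  move=> pab; rewrite normfV lef_pV2 ?posrE ?normr_gt0 ?rho0//.
  by rewrite (unit_signE hr) ?hm// (lt_le_trans m0 (hm p pab)).
have drho p : is_derive p 1 rho (f2 p).
  apply: is_derive_eq (is_deriveB (df2 p) (is_derive_cst (x / t) p 1)) _.
  by rewrite subr0.
have drhoV p : a <= p <= b -> is_derive p 1 (fun y => (rho y)^-1) (- (f2 p / rho p ^+ 2)).
  move=> pab; apply: is_derive_eq (is_deriveV (rho0 _ pab) (drho p)) _.
  by rewrite /GRing.scale /= mulNr mulrC.
pose A p := - t^-1 * (w p * (rho p)^-1).
pose A' p := - t^-1 * (w' p * (rho p)^-1 - w p * (f2 p / rho p ^+ 2)).
pose phi p := - (t * f p) + x * p.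
pose phi' p := - (t * rho p).
pose L p := (S / t) * (- s * w p / m - D * (rho p)^-1).
pose L' p := (S / t) * (- s * w' p / m + D * (f2 p / rho p ^+ 2)).
have t0 : t != 0 by rewrite gt_eqF.
have dphi p : is_derive p 1 phi (phi' p).
  apply: is_derive_eq (is_deriveD (is_deriveN (is_deriveM (is_derive_cst t p 1) (df p)))
    (is_deriveM (is_derive_cst x p 1) (is_derive_id p 1))) _.
  by rewrite /GRing.scale /= !mulr0 !addr0 mulr1 /phi' /rho; field.
have dA p : a <= p <= b -> is_derive p 1 A (A' p).
  move=> pab; apply: is_derive_eq (is_deriveM (is_derive_cst (- t^-1) p 1)
    (is_deriveM (dw _ pab) (drhoV _ pab))) _.
  by rewrite /GRing.scale /= mulr0 addr0 /A'; ring.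
have dL p : a <= p <= b -> is_derive p 1 L (L' p).
  move=> pab; apply: is_derive_eq (is_deriveM (is_derive_cst (S / t) p 1)
    (is_deriveB (is_deriveM (is_deriveM (is_derive_cst (- s) p 1) (dw _ pab)) (is_derive_cst m^-1 p 1))
    (is_deriveM (is_derive_cst D p 1) (drhoV _ pab)))) _.
  by rewrite /GRing.scale /= /L' !mulr0 !addr0 add0r; ring.
have AM p : a <= p <= b -> `|A p| <= t^-1 * D * m^-1.
  move=> pab; rewrite /A !normrM normrN normfV (gtr0_norm t_gt0) -mulrA.
  rewrite ler_wpM2l ?invr_ge0 ?(ltW t_gt0)//.
  have /andP[w0 wpD] := wD _ pab.
  by rewrite (ger0_norm w0) ler_pM ?rhom.
have AL p : a <= p <= b -> S * `|A' p| <= L' p.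
  move=> pab; rewrite /A' /L' normrM normrN normfV (gtr0_norm t_gt0) [leLHS]mulrA.
  rewrite ler_wpM2l ?divr_ge0 ?(ltW t_gt0)//.
  apply: le_trans (ler_normB _ _) _; apply: lerD.
    rewrite normrM ler_pM ?rhom//.
    have := sp _ pab; rewrite /w' => sp0.
    have pw0 : 0 <= (s * (p - p1)) `^ (al - 1 - 1) by exact: powR_ge0.
    rewrite !normrM (ger0_norm pw0) ltr0_norm ?subr_lt0//.
    by case: hs => ->; rewrite ?normrN normr1; lra.
  have /andP[w0 wpD] := wD _ pab.
  have q0 : 0 <= f2 p / rho p ^+ 2 by rewrite divr_ge0 ?sqr_ge0 ?(ltW (f2_gt0 _)).
  by rewrite normrM (ger0_norm w0) (ger0_norm q0) ler_wpM2r.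
have hP p : a <= p <= b -> cis_derive P p
    (ut p * (A p * phi' p)%:C * expi (phi p)).
  move=> pab; have pp1 : p != p1.
    by apply: contraTneq (sp _ pab) => ->; rewrite subrr mulr0 ltxx.
  apply: cis_derive_eq (dP pp1) _; rewrite wE//.
  have -> : A p * phi' p = w p by rewrite /A /phi'; field; rewrite t0 rho0.
  by rewrite (mulrC _ (ut p)).
apply: le_trans (oscillation_by_parts ab hP dut iut uS dA (fun p _ => dphi p) dL AM AL) _.
have hL : L b - L a <= t^-1 * D * m^-1 * (2 * S).
  rewrite /L -mulrBr -[leRHS]/(t^-1 * D * m^-1 * (2 * S)).
  have -> : t^-1 * D * m^-1 * (2 * S) = S / t * (2 * D / m) by field; rewrite t0 gt_eqF.
  rewrite ler_wpM2l ?divr_ge0 ?(ltW t_gt0)//.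
  have mV0 : 0 <= m^-1 by rewrite invr_ge0 ltW.
  have e1 : - s * w b / m - (- s * w a / m) <= D / m.
    rewrite -mulrBl ler_wpM2r//.
    have /andP[wa0 waD] := wD _ aab; have /andP[wb0 wbD] := wD _ bab.
    by case: hs => ->; lra.
  have e2 : (rho a)^-1 - (rho b)^-1 <= m^-1.
    have ra := hm _ aab; have rb := hm _ bab.
    have := rhom _ aab => /ler_normlP[_ ra1]; have := rhom _ bab => /ler_normlP[rb1 _].
    case: hr ra rb => ->; rewrite ?mul1r ?mulN1r => ra rb.
      have : 0 <= (rho b)^-1 by rewrite invr_ge0 (le_trans (ltW m0) rb).
      by lra.
    have : (rho a)^-1 <= 0 by rewrite invr_le0 -oppr_ge0 (le_trans (ltW m0) ra).
    by lra.
  have e3 : D * ((rho a)^-1 - (rho b)^-1) <= D / m by rewrite ler_wpM2l.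
  by rewrite -[2 * D / m]mulrA; lra.
by rewrite -/D; lra.
Qed.

(** Next to the singularity the oscillations are ignored: the amplitude
    [|p - p1|^(al - 1)] has the primitive [s |p - p1|^al / al], which is continuous
    up to the singularity. *)
Lemma singular_estimate s a b S : unit_sign s -> a <= b -> 
  (forall p, a <= p <= b -> 0 <= s * (p - p1)) ->
  (forall p, a <= p <= b -> N (ut p) <= S) ->
  N (P b - P a) <= S * (s * ((s * (b - p1)) `^ al - (s * (a - p1)) `^ al)) / al.
Proof.
move=> hs ab hp uS; have /andP[al0 al1] := al01.
have S0 : 0 <= S by apply: le_trans (normc_ge0 _) (uS a _); rewrite lexx.
pose L p := S / al * s * (s * (p - p1)) `^ al.
have := @mean_value_le R a b P (fun p => (`|p - p1| `^ (al - 1))%:C * ut p * expi (- (t * f p) + x * p)) L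
  (fun p => S * (s * (p - p1)) `^ (al - 1)) (fun=> 0) ab _ _ _ _ _ _ _.
have sp p : a < p < b -> 0 < s * (p - p1).
  move=> /andP[ap pb]; case: hs hp => ->.
    move=> /(_ a); rewrite lexx ab !mul1r => /(_ isT); lra.
  by move=> /(_ b); rewrite lexx ab !mulN1r => /(_ isT); lra.
have pne p : a < p < b -> p != p1.
  by move=> /sp; apply: contraTneq => ->; rewrite subrr mulr0 ltxx.
rewrite Rintegral_cst// mul0r addr0 => h.
have -> : S * (s * ((s * (b - p1)) `^ al - (s * (a - p1)) `^ al)) / al = L b - L a.
  by rewrite /L; ring.
apply: h.
- by apply: ccontinuous_on_at => p _; exact: cP.
- by move=> p pab; apply: dP; exact: pne.
- move=> p q ap pq qb; rewrite /L -!mulrA ler_wpM2l// ler_wpM2l ?invr_ge0 ?(ltW al0)//.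
  have /hp : a <= p <= b by rewrite ap (le_trans pq qb).
  have /hp : a <= q <= b by rewrite qb (le_trans ap pq).
  case: hs => ->; rewrite ?mul1r ?mulN1r => q0 p0.
    by rewrite ge0_ler_powR ?nnegrE ?(ltW al0)// lerB.
  by rewrite lerN2 ge0_ler_powR ?nnegrE ?(ltW al0)// lerN2 lerB.
- move=> p /sp h0.
  have d1 : is_derive p 1 (fun y => s * (y - p1)) s.
    apply: is_derive_eq (is_deriveM (is_derive_cst s p 1)
      (is_deriveB (is_derive_id p 1) (is_derive_cst p1 p 1))) _.
    by rewrite /GRing.scale /= subr0 mulr1 mulr0 addr0.
  have d2 := is_derive1_powR al h0.
  apply: is_derive_eq (is_deriveM (is_derive_cst (S / al * s) p 1)
    (@is_derive1_comp _ _ (fun y => s * (y - p1)) p _ _ d2 d1)) _.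
  rewrite /GRing.scale /= mulr0 addr0.
  have ss := unit_sign_sqr hs.
  set W := _ `^ _; transitivity (S / al * al * W * (s * s)); first by ring.
  by rewrite ss mulr1 mulfVK// gt_eqF.
- by [].
- exact: integrable0.
- move=> p pab; rewrite addr0 !Normc.normcM normc_expi mulr1 normc_real.
  rewrite (unit_signE hs (sp _ pab)) ger0_norm ?powR_ge0// mulrC ler_wpM2r ?powR_ge0//.
  by apply: uS; case/andP: pab => ap pb; rewrite !ltW.
Qed.

End Oscillation.

(** * Lebesgue norms of continuous functions *)

Section Norms.
Context {R : realType}.
Implicit Types (g : R -> R[i]) (x y a b p : R) (D : set R).
Local Notation N := (@Normc.normc R).
Local Notation mu := (@lebesgue_measure R).

(** A strict inequality at one point would persist on an interval, which is not
    negligible. *)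
Lemma ae_le_continuous (h : R -> R) a b (C : R) : a < b ->
  (forall x, {for x, continuous h}) ->
  {ae mu, forall x, a <= x <= b -> h x <= C} ->
  forall x, a <= x <= b -> h x <= C.
Proof.
move=> ab ch [A [mA A0 sA]] x /andP[ax xb]; rewrite leNgt; apply/negP => Chx.
have /nbhs_ballP[d /= d0 hd] : \forall y \near x, C < h y.
  by have /cvgr_gt := ch x; exact.
pose c := Num.max a (x - d); pose e := Num.min b (x + d).
have ce : c < e.
  rewrite lt_min !gt_max ab (le_lt_trans ax) ?ltrDl//=.
  by rewrite (lt_le_trans _ xb) ?ltrBlDr ?ltrDl//=; lra.
have sub : `]c, e[ `<=` A.
  move=> y /=; rewrite in_itv /= /c /e gt_max lt_min => /andP[/andP[ay xdy] /andP[yb yxd]].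
  apply: sA => /= H; have : h y <= C by apply: H; rewrite !ltW.
  by apply/negP; rewrite -ltNge; apply: hd; rewrite /ball /= ltr_norml; apply/andP; split; lra.
have : (mu `]c, e[ <= mu A)%E by apply: le_measure; rewrite ?inE.
rewrite lebesgue_measure_itv /= lte_fin ce A0 -EFinD lee_fin subr_le0.
by rewrite leNgt ce.
Qed.

Lemma normc_continuous g x : ccontinuous_at g x -> {for x, continuous (fun y => N (g y))}.
Proof.
move=> cg; apply/cvgrPdist_le => e e0; have [d d0 hd] := cg e e0.
apply/nbhs_ballP; exists d => // y; rewrite /ball /= distrC => /hd; apply: le_trans.
rewrite ler_norml; apply/andP; split.
  by have := normc_le_sub (g y) (g x); lra.
by have := normc_le_sub (g x) (g y); rewrite normcB; lra.
Qed.

Lemma le_cLnorm_infty D g (M : R) :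
  (forall x, N (g x) <= M) ->
  {ae mu, forall x, D x -> N (g x) <= cLnorm +oo%E D g}.
Proof.
move=> gM; rewrite /cLnorm unlock.
have mu0 : (0 < mu [set: R])%E by rewrite -set_itvNyy lebesgue_measure_itv /= addye// ltry.
have M0 : 0 <= M := le_trans (normc_ge0 _) (gM 0).
rewrite ifT//; set h := _ \o _; set E := ess_sup _ _.
have EM : (E <= M%:E)%E.
  apply/ess_supP; apply: aeW => x; rewrite /h /= patchE.
  by case: ifP => _; rewrite ?abse0 ?lee_fin//= ger0_norm ?normc_ge0.
have E0 : (0 <= E)%E by apply: ess_sup_gee => //; apply: aeW => x; exact: abse_ge0.
have Efin : E \is a fin_num by rewrite ge0_fin_numE// (le_lt_trans EM) ?ltry.
have : {ae mu, forall x, (h x <= E)%E} by exact: ess_sup_ge.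
apply: filterS; first exact: (ae_filter_ringOfSetsType mu).
move=> x + Dx; rewrite /h /= patchE mem_set//= ger0_norm ?normc_ge0//.
by rewrite -{1}(fineK Efin) lee_fin.
Qed.

Lemma le_cLnorm_itv a b g (M : R) : a < b -> (forall x, ccontinuous_at g x) ->
  (forall x, N (g x) <= M) ->
  forall x, a <= x <= b -> N (g x) <= cLnorm +oo%E `[a, b] g.
Proof.
move=> ab cg gM; apply: ae_le_continuous ab _ _.
  by move=> x; exact: normc_continuous.
have := le_cLnorm_infty `[a, b] gM.
apply: filterS; first exact: (ae_filter_ringOfSetsType mu).
move=> x H axb; by apply: H; rewrite /= in_itv.
Qed.

Lemma le_cLnorm_setT g (M : R) : (forall x, ccontinuous_at g x) ->
  (forall x, N (g x) <= M) -> forall x, N (g x) <= cLnorm +oo%E setT g.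
Proof.
move=> cg gM x; apply: (@ae_le_continuous (fun y => N (g y)) (x - 1) (x + 1)).
- lra.
- by move=> y; exact: normc_continuous.
- have := le_cLnorm_infty setT gM.
  apply: filterS; first exact: (ae_filter_ringOfSetsType mu).
  by move=> y H _; exact: H.
- by apply/andP; split; lra.
Qed.

Lemma cLnorm1E D g : measurable D -> cintegrable g ->
  cLnorm 1%E D g = \int[mu]_(x in D) N (g x).
Proof.
move=> mD ig; rewrite /cLnorm Lnorm1 /Rintegral; congr fine.
rewrite [RHS]integral_mkcond; apply: eq_integral => x _.
rewrite /= !patchE; case: ifP => _; last by rewrite abse0.
by rewrite /= ger0_norm ?normc_ge0.
Qed.

Lemma le_Rintegral_norm D D' g : measurable D -> measurable D' -> D `<=` D' ->
  cintegrable g -> \int[mu]_(x in D) N (g x) <= \int[mu]_(x in D') N (g x).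
Proof.
move=> mD mD' DD' ig; rewrite Rintegral_mkcond [leRHS]Rintegral_mkcond.
have iN := cintegrable_norm ig.
apply: le_Rintegral => //.
- by rewrite -restrict_EFin; apply/integrable_restrict => //; rewrite setTI; exact: integrableS iN.
- by rewrite -restrict_EFin; apply/integrable_restrict => //; rewrite setTI; exact: integrableS iN.
- move=> x _; rewrite !patchE; case: ifPn => [/set_mem/DD'/mem_set ->//|_].
  by case: ifP => // _; exact: normc_ge0.
Qed.

End Norms.

(** * Estimates around the singularity and the stationary point *)

Lemma clamp_increment_le (R : realDomainType) (a b p q : R) : p <= q ->
  Num.max a (Num.min b q) - Num.max a (Num.min b p) <= q - p.
Proof.
move=> pq; have qp0 : 0 <= q - p by rewrite subr_ge0.
rewrite lerBlDr ge_max; apply/andP; split.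
  by rewrite ler_wpDl// le_max lexx.
apply: (@le_trans _ _ (q - p + Num.min b p)); last by rewrite lerD2l le_max lexx orbT.
rewrite -lerBlDl le_min; apply/andP; split.
  by rewrite lerBlDr ler_wpDr// ge_min lexx.
by rewrite lerBlDr addrC subrK ge_min lexx orbT.
Qed.


Section Decay.
Context {R : realType}.
Implicit Types (a b p q : R).
Local Notation N := (@Normc.normc R).
Local Notation mu := (@lebesgue_measure R).

Variables (f f1 f2 : R -> R).
Hypothesis df : forall p, is_derive p 1 f (f1 p).
Hypothesis df1 : forall p, is_derive p 1 f1 (f2 p).
Hypothesis f2_gt0 : forall p, 0 < f2 p.

Lemma increment_ge_of_derive m a b : a <= b -> (forall p, a <= p <= b -> m <= f2 p) ->
  m * (b - a) <= f1 b - f1 a.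
Proof.
move=> ab hm; have [c cab ->] := @mvt_closed R f1 f2 a b ab (fun p _ => df1 p).
by rewrite ler_wpM2r ?subr_ge0 ?hm.
Qed.

Lemma f1_nondecreasing a b : a <= b -> f1 a <= f1 b.
Proof.
move=> ab; rewrite -subr_ge0; apply: le_trans (increment_ge_of_derive (m := 0) ab _).
  by rewrite mul0r.
by move=> p _; exact: ltW.
Qed.

Lemma f1_increasing a b : a < b -> f1 a < f1 b.
Proof.
move=> ab; have [c cab h] := @mvt_closed R f1 f2 a b (ltW ab) (fun p _ => df1 p).
by rewrite -subr_gt0 h mulr_gt0 ?subr_gt0.
Qed.

(** Projecting a stationary point on the interval [[a, b]] keeps the lower
    bounds on the phase speed that a bound [m] of [f''] on [[a, b]] provides. At
    the projection [q] itself the speed may have the wrong sign when [p0] lies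
    outside, hence the strict comparisons with [q]. *)
Lemma phase_gap m a b c p0 : a <= b -> (forall p, a <= p <= b -> m <= f2 p) ->
  f1 p0 = c -> exists q, forall p, a <= p <= b ->
    (q < p -> m * (p - q) <= f1 p - c) /\ (p < q -> m * (q - p) <= c - f1 p).
Proof.
move=> ab hm p0c.
pose q := Num.max a (Num.min b p0).
have aq : a <= q by rewrite le_max lexx.
have qb : q <= b by rewrite ge_max ab ge_min lexx.
exists q => p /andP[ap pb]; split=> [qp|pq].
  have : f1 p0 <= f1 q.
    apply: f1_nondecreasing; move: qp; rewrite /q gt_max => /andP[_].
    by rewrite gt_min => /orP[bp|p0p]; [lra|rewrite le_max le_min lexx andbT (_ : p0 <= b) ?orbT//; lra].
  have : m * (p - q) <= f1 p - f1 q.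
    apply: increment_ge_of_derive (ltW qp) _ => y /andP[qy yp].
    by apply: hm; apply/andP; split; lra.
  by lra.
have : f1 q <= f1 p0.
  apply: f1_nondecreasing; move: pq; rewrite /q lt_max => /orP[|pm]; first by lra.
  by rewrite ge_max ge_min lexx orbT andbT; move: pm; rewrite lt_min => /andP[_]; lra.
have : m * (q - p) <= f1 q - f1 p.
  apply: increment_ge_of_derive (ltW pq) _ => y /andP[qy yp].
  by apply: hm; apply/andP; split; lra.
by lra.
Qed.

Variables (al p1 t x : R) (ut P : R -> R[i]).
Hypotheses (al01 : 0 < al < 1) (t_gt0 : 0 < t).
Hypothesis dut : cdifferentiable ut.
Hypothesis iut : cintegrable (cderiv ut).
Hypothesis cP : forall p, ccontinuous_at P p.
Hypothesis dP : forall p, p != p1 -> cis_derive P p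
  ((`|p - p1| `^ (al - 1))%:C * ut p * expi (- (t * f p) + x * p)).

Let V a b := \int[mu]_(p in `[a, b]) N (cderiv ut p).

Let oscE := oscillation_estimate al01 t_gt0 df df1 f2_gt0 dut iut dP.
Let singE := singular_estimate al01 cP dP.

Lemma le_V a b a' b' : a' <= a -> b <= b' -> V a b <= V a' b'.
Proof.
move=> aa bb; apply: le_Rintegral_norm => //.
move=> z /=; rewrite !in_itv /= => /andP[az zb].
by rewrite (le_trans aa az) (le_trans zb bb).
Qed.

Lemma oscillation_estimate_le s r d m a b S W :
  unit_sign s -> unit_sign r -> a <= b -> 0 < d -> 0 < m ->
  (forall p, a <= p <= b -> d <= s * (p - p1)) ->
  (forall p, a <= p <= b -> m <= r * (f1 p - x / t)) ->
  (forall p, a <= p <= b -> N (ut p) <= S) -> V a b <= W ->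
  N (P b - P a) <= t^-1 * d `^ (al - 1) * m^-1 * (4 * S + W).
Proof.
move=> hs hr ab d0 m0 hd hm uS VW; apply: le_trans (oscE hs hr ab d0 m0 hd hm uS) _.
rewrite ler_wpM2l ?lerD2l// !mulr_ge0 ?invr_ge0 ?powR_ge0 ?(ltW m0)//.
exact: ltW.
Qed.

Lemma split_increment c (C1 C2 : R[i]) (A B : R) :
  N (P c - C1) <= A -> N (C2 - P c) <= B -> N (C2 - C1) <= A + B.
Proof.
move=> h1 h2; have := normcD (P c - C1) (C2 - P c).
by rewrite (_ : P c - C1 + (C2 - P c) = C2 - C1); [lra|ring].
Qed.

Lemma flat_estimate s d a b S : unit_sign s -> a <= b -> 0 < d ->
  (forall p, a <= p <= b -> d <= s * (p - p1)) ->
  (forall p, a <= p <= b -> N (ut p) <= S) ->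
  N (P b - P a) <= d `^ (al - 1) * S * (b - a).
Proof.
move=> hs ab d0 hd uS; have /andP[al0 al1] := al01.
have S0 : 0 <= S by apply: le_trans (normc_ge0 _) (uS a _); rewrite lexx.
pose D := d `^ (al - 1).
have D0 : 0 <= D by exact: powR_ge0.
have := @mean_value_le R a b P
  (fun p => (`|p - p1| `^ (al - 1))%:C * ut p * expi (- (t * f p) + x * p))
  (fun p => D * S * p) (fun=> D * S) (fun=> 0) ab _ _ _ _ _ _ _.
rewrite Rintegral_cst// mul0r => h.
have -> : d `^ (al - 1) * S * (b - a) = D * S * b - D * S * a + 0 by rewrite /D; ring.
have sp p : a <= p <= b -> 0 < s * (p - p1) by move=> /hd; exact: lt_le_trans.
have pne p : a <= p <= b -> p != p1.
  by move=> /sp; apply: contraTneq => ->; rewrite subrr mulr0 ltxx.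
have oc p : a < p < b -> a <= p <= b by move=> /andP[ap pb]; rewrite !ltW.
apply: h.
- by apply: ccontinuous_on_at => p _; exact: cP.
- by move=> p /oc pab; apply: dP; exact: pne.
- by move=> p q ap pq qb; rewrite ler_wpM2l ?mulr_ge0.
- move=> p _; apply: is_derive_eq (is_deriveM (is_derive_cst (D * S) p 1) (is_derive_id p 1)) _.
  by rewrite /GRing.scale /= mulr0 addr0 mulr1.
- by [].
- exact: integrable0.
- move=> p /oc pab; rewrite addr0 !Normc.normcM normc_expi mulr1 normc_real.
  rewrite (unit_signE hs (sp _ pab)) ger0_norm ?powR_ge0// ler_pM ?powR_ge0 ?normc_ge0 ?uS//.
  rewrite /D -(opprB 1 al) !powRN lef_pV2 ?posrE ?powR_gt0 ?sp//.
  by rewrite ge0_ler_powR ?nnegrE ?subr_ge0 ?(ltW al1) ?(ltW d0) ?(ltW (sp _ _)) ?hd.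
Qed.

(** The classical second-derivative argument: the window of radius [dl] around
    the stationary point is estimated by its length, the rest by oscillations. *)
Lemma stationary_estimate s d m dl a b p0 S W : unit_sign s -> a <= b ->
  0 < d -> 0 < m -> 0 < dl ->
  (forall p, a <= p <= b -> d <= s * (p - p1)) ->
  (forall p, a <= p <= b ->
    (p0 < p -> m * (p - p0) <= f1 p - x / t) /\
    (p < p0 -> m * (p0 - p) <= x / t - f1 p)) ->
  (forall p, a <= p <= b -> N (ut p) <= S) -> V a b <= W ->
  N (P b - P a) <= 2 * dl * d `^ (al - 1) * S +
    2 * (t^-1 * d `^ (al - 1) * (m * dl)^-1 * (4 * S + W)).
Proof.
move=> hs ab d0 m0 dl0 hd hp0 uS VW.
have S0 : 0 <= S by apply: le_trans (normc_ge0 _) (uS a _); rewrite lexx.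
have W0 : 0 <= W by apply: le_trans VW; apply: Rintegral_ge0 => p _; exact: normc_ge0.
pose D := d `^ (al - 1).
have D0 : 0 <= D by exact: powR_ge0.
pose B := t^-1 * D * (m * dl)^-1 * (4 * S + W).
have B0 : 0 <= B.
  by rewrite !mulr_ge0 ?invr_ge0 ?mulr_ge0 ?(ltW t_gt0) ?(ltW m0) ?(ltW dl0)// addr_ge0 ?mulr_ge0.
pose cl p := Num.max a (Num.min b p).
have acl p : a <= cl p by rewrite le_max lexx.
have clb p : cl p <= b by rewrite ge_max ab ge_min lexx.
have cllt p : a < cl p -> cl p <= p.
  by rewrite lt_max ltxx /= => h; rewrite ge_max (ltW (lt_le_trans h _)) ?ge_min ?lexx ?orbT.
have clgt p : cl p < b -> p <= cl p.
  by rewrite gt_max => /andP[_]; rewrite gt_min ltxx /= => h; rewrite le_max le_min lexx (ltW h) orbT.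
have clm p q : p <= q -> cl p <= cl q /\ cl q - cl p <= q - p.
  move=> pq; split.
    by rewrite /cl ge_max !le_max lexx /= le_min !ge_min lexx pq !orbT.
  exact: clamp_increment_le.
pose c1 := cl (p0 - dl); pose c2 := cl (p0 + dl).
have [c12 c12d] : c1 <= c2 /\ c2 - c1 <= (p0 + dl) - (p0 - dl) by apply: clm; lra.
have in1 p : a <= p <= c1 -> a <= p <= b.
  by move=> /andP[-> h]; rewrite (le_trans h (clb _)).
have in2 p : c1 <= p <= c2 -> a <= p <= b.
  by move=> /andP[h h2]; rewrite (le_trans h2 (clb _)) (le_trans (acl _) h).
have in3 p : c2 <= p <= b -> a <= p <= b.
  by move=> /andP[h ->]; rewrite (le_trans (acl _) h).
have h1 : N (P c1 - P a) <= B.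
  have [ac1|] := ltP a c1; last first.
    by move=> h; rewrite (_ : c1 = a) ?subrr ?normc0//; apply/eqP; rewrite eq_le h acl.
  apply: (@oscillation_estimate_le s (-1) d (m * dl) a c1 S W) => //.
  - by right.
  - exact: ltW.
  - by rewrite mulr_gt0.
  - by move=> p /in1; exact: hd.
  - move=> p pac; have [_ hp] := hp0 p (in1 _ pac).
    have pc : p <= p0 - dl by apply: le_trans (cllt _ ac1); case/andP: pac.
    apply: (@le_trans _ _ (m * (p0 - p))); first by rewrite ler_pM2l//; lra.
    by rewrite mulN1r opprB; apply: hp; lra.
  - by move=> p /in1; exact: uS.
  - by apply: le_trans VW; apply: le_V => //; exact: clb.
have h3 : N (P b - P c2) <= B.
  have [ac1|] := ltP c2 b; last first.
    by move=> h; rewrite (_ : c2 = b) ?subrr ?normc0//; apply/eqP; rewrite eq_le h clb.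
  apply: (@oscillation_estimate_le s 1 d (m * dl) c2 b S W) => //.
  - by left.
  - exact: ltW.
  - by rewrite mulr_gt0.
  - by move=> p /in3; exact: hd.
  - move=> p pac; have [hp _] := hp0 p (in3 _ pac).
    have pc : p0 + dl <= p by apply: le_trans (clgt _ ac1) _; case/andP: pac.
    apply: (@le_trans _ _ (m * (p - p0))); first by rewrite ler_pM2l//; lra.
    by rewrite mul1r; apply: hp; lra.
  - by move=> p /in3; exact: uS.
  - by apply: le_trans VW; apply: le_V => //; exact: acl.
have h2 : N (P c2 - P c1) <= 2 * dl * D * S.
  apply: (@le_trans _ _ (D * S * (c2 - c1))).
    apply: flat_estimate hs c12 d0 _ _ => p /in2; [exact: hd|exact: uS].
  apply: (@le_trans _ _ (D * S * (2 * dl))); last by lra.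
  by rewrite ler_wpM2l ?mulr_ge0//; lra.
have := split_increment (split_increment h1 h2) h3.
by rewrite -/D -/B; lra.
Qed.

Lemma singular_increment s l S : unit_sign s -> 0 <= l ->
  (forall p, 0 <= s * (p - p1) <= l -> N (ut p) <= S) ->
  N (P (p1 + s * l) - P p1) <= S * l `^ al / al.
Proof.
move=> hs l0 uS; have /andP[al0 al1] := al01.
have al_neq0 : al != 0 by rewrite gt_eqF.
case: (hs) uS => -> uS.
  rewrite mul1r; apply: le_trans (singE (or_introl erefl : unit_sign 1) _ _ _) _ => //.
  - by lra.
  - by move=> p /andP[]; lra.
  - by move=> p /andP[pa pb]; apply: uS; rewrite mul1r; apply/andP; split; lra.
  - by rewrite subrr !mul1r [p1 + l]addrC addrK powR0// subr0.
rewrite mulN1r normcB; apply: le_trans (singE (or_intror erefl : unit_sign (-1)) _ _ _) _ => //.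
- by lra.
- by move=> p /andP[]; lra.
- by move=> p /andP[pa pb]; apply: uS; rewrite mulN1r; apply/andP; split; lra.
- rewrite subrr mulr0 powR0// sub0r mulrNN mul1r mulN1r opprB.
  by rewrite (_ : p1 - (p1 - l) = l)//; ring.
Qed.

Lemma oscillation_increment s r d l m S W :
  unit_sign s -> unit_sign r -> 0 < d -> d <= l -> 0 < m ->
  (forall p, d <= s * (p - p1) <= l -> m <= r * (f1 p - x / t)) ->
  (forall p, d <= s * (p - p1) <= l -> N (ut p) <= S) ->
  \int[mu]_p N (cderiv ut p) <= W ->
  N (P (p1 + s * l) - P (p1 + s * d)) <= t^-1 * d `^ (al - 1) * m^-1 * (4 * S + W).
Proof.
move=> hs hr d0 dl m0 hm uS VW.
have VW' a b : V a b <= W.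
  by apply: le_trans VW; apply: le_Rintegral_norm.
case: (hs) hm uS => -> hm uS; rewrite ?mul1r ?mulN1r.
  apply: (@oscillation_estimate_le 1 r d m) => //.
  - by left.
  - by lra.
  - by move=> p /andP[]; lra.
  - by move=> p /andP[h1 h2]; apply: hm; apply/andP; split; lra.
  - by move=> p /andP[h1 h2]; apply: uS; apply/andP; split; lra.
rewrite normcB; apply: (@oscillation_estimate_le (-1) r d m) => //.
- by right.
- by lra.
- by move=> p /andP[]; lra.
- by move=> p /andP[h1 h2]; apply: hm; apply/andP; split; lra.
- by move=> p /andP[h1 h2]; apply: uS; apply/andP; split; lra.
Qed.

(** A half-line starting at the singularity, without stationary point: the
    window around the singularity has radius [t^-1]. *)
Lemma half_singular_estimate s r l m S W :
  unit_sign s -> unit_sign r -> 0 <= l -> 0 < m ->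
  (forall p, 0 <= s * (p - p1) <= l -> m <= r * (f1 p - x / t)) ->
  (forall p, 0 <= s * (p - p1) <= l -> N (ut p) <= S) ->
  \int[mu]_p N (cderiv ut p) <= W ->
  N (P (p1 + s * l) - P p1) <= t `^ (- al) * (al^-1 * S + m^-1 * (4 * S + W)).
Proof.
move=> hs hr l0 m0 hm uS VW; have /andP[al0 al1] := al01.
have S0 : 0 <= S.
  by apply: le_trans (normc_ge0 _) (uS p1 _); rewrite subrr mulr0 lexx l0.
have W0 : 0 <= W by apply: le_trans VW; apply: Rintegral_ge0 => p _; exact: normc_ge0.
have tV0 : 0 < t^-1 by rewrite invr_gt0.
have tal : t `^ (- al) = t^-1 `^ al by rewrite -powR_inv1 ?(ltW t_gt0)// -powRrM mulN1r.
have B0 : 0 <= t `^ (- al) * (m^-1 * (4 * S + W)).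
  by rewrite mulr_ge0 ?powR_ge0// mulr_ge0 ?invr_ge0 ?(ltW m0)// addr_ge0 ?mulr_ge0.
have sing d : 0 <= d -> d <= l -> d <= t^-1 ->
    N (P (p1 + s * d) - P p1) <= t `^ (- al) * (al^-1 * S).
  move=> d0 dl dt; apply: (@le_trans _ _ (S * d `^ al / al)).
    apply: singular_increment => // p /andP[h1 h2]; apply: uS.
    by rewrite h1 (le_trans h2 dl).
  rewrite tal (_ : S * d `^ al / al = d `^ al * (al^-1 * S)); last by ring.
  rewrite ler_wpM2r ?mulr_ge0 ?invr_ge0 ?(ltW al0)//.
  by rewrite ge0_ler_powR ?nnegrE ?(ltW al0) ?(ltW tV0).
have [lt|tl] := leP l t^-1.
  by apply: le_trans (sing l l0 (lexx l) lt) _; rewrite mulrDr lerDl.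
have h1 := sing t^-1 (ltW tV0) (ltW tl) (lexx _).
have h2 : N (P (p1 + s * l) - P (p1 + s * t^-1)) <= t `^ (- al) * (m^-1 * (4 * S + W)).
  apply: le_trans (oscillation_increment hs hr tV0 (ltW tl) m0 _ _ VW) _.
  - by move=> p /andP[h2 h3]; apply: hm; rewrite h3 (le_trans (ltW tV0) h2).
  - by move=> p /andP[h2 h3]; apply: uS; rewrite h3 (le_trans (ltW tV0) h2).
  - by rewrite tal mulr_powRB1 ?(ltW tV0)// mulrA.
by rewrite mulrDr; exact: split_increment h1 h2.
Qed.

(** A half-neighbourhood of the singularity that may contain the stationary
    point: both windows have radius [t^(-1/2)]. *)
Lemma near_estimate s l m c0 S W : unit_sign s -> 0 < l -> 0 < m ->
  (forall p, 0 <= s * (p - p1) <= l -> m <= f2 p) ->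
  f1 c0 = x / t ->
  (forall p, 0 <= s * (p - p1) <= l -> N (ut p) <= S) ->
  (forall a b, (forall p, a <= p <= b -> 0 <= s * (p - p1) <= l) -> V a b <= W) ->
  N (P (p1 + s * l) - P p1) <=
    t `^ (- (al / 2)) * (3 / al * S + 2 * m^-1 * (4 * S + W)).
Proof.
move=> hs l0 m0 hm hc0 uS VW; have /andP[al0 al1] := al01.
have S0 : 0 <= S.
  by apply: le_trans (normc_ge0 _) (uS p1 _); rewrite subrr mulr0 lexx ltW.
have W0 : 0 <= W.
  apply: le_trans (VW 1 0 _) => [|p /andP[h1 h2]]; last by lra.
  by apply: Rintegral_ge0 => p _; exact: normc_ge0.
(* At this radius the windows and the oscillating parts contribute the same
   power of [t]. *)
pose dl := t `^ (- (1 / 2)).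
have dl0 : 0 < dl by exact: powR_gt0.
have dl2 : t^-1 = dl * dl.
  rewrite /dl -powRD; last by rewrite (gt_eqF t_gt0) implybT.
  by rewrite (_ : _ + _ = -1) ?powR_inv1 ?(ltW t_gt0)//; field.
have tal : t `^ (- (al / 2)) = dl `^ al by rewrite /dl -powRrM; congr (_ `^ _); field.
have B0 : 0 <= dl `^ al * (2 / al * S + 2 * m^-1 * (4 * S + W)).
  rewrite mulr_ge0 ?powR_ge0// addr_ge0// ?mulr_ge0 ?invr_ge0 ?(ltW m0) ?(ltW al0)//.
  by rewrite addr_ge0 ?mulr_ge0.
have sing d : 0 <= d -> d <= l -> d <= dl ->
    N (P (p1 + s * d) - P p1) <= dl `^ al * (al^-1 * S).
  move=> d0 dl' dt; apply: (@le_trans _ _ (S * d `^ al / al)).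
    apply: singular_increment => // p /andP[h1 h2]; apply: uS.
    by rewrite h1 (le_trans h2 dl').
  rewrite (_ : S * d `^ al / al = d `^ al * (al^-1 * S)); last by ring.
  rewrite ler_wpM2r ?mulr_ge0 ?invr_ge0 ?(ltW al0)//.
  by rewrite ge0_ler_powR ?nnegrE ?(ltW al0) ?(ltW dl0).
rewrite tal [leRHS](_ : _ = dl `^ al * (al^-1 * S) +
   dl `^ al * (2 / al * S + 2 * m^-1 * (4 * S + W))); last by field; rewrite !gt_eqF.
have [lt|tl] := leP l dl.
  by apply: le_trans (sing l (ltW l0) (lexx l) lt) _; rewrite lerDl.
have h1 := sing dl (ltW dl0) (ltW tl) (lexx _).
apply: split_increment h1 _.
have stat : N (P (p1 + s * l) - P (p1 + s * dl)) <=
    2 * dl * dl `^ (al - 1) * S + 2 * (t^-1 * dl `^ (al - 1) * (m * dl)^-1 * (4 * S + W)).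
  case: (hs) hm uS VW => -> hm uS VW; rewrite ?mul1r ?mulN1r.
    have [|p ab|q hq] := @phase_gap m (p1 + dl) (p1 + l) _ _ _ _ hc0; first by lra.
      by apply: hm; move/andP: ab => [? ?]; apply/andP; split; lra.
    apply: (@stationary_estimate 1 dl m dl _ _ q) => //.
    - by left.
    - by lra.
    - by move=> p /andP[]; lra.
    - by move=> p /andP[? ?]; apply: uS; apply/andP; split; lra.
    - by apply: VW => p /andP[? ?]; apply/andP; split; lra.
  rewrite normcB.
  have [|p ab|q hq] := @phase_gap m (p1 - l) (p1 - dl) _ _ _ _ hc0; first by lra.
    by apply: hm; move/andP: ab => [? ?]; apply/andP; split; lra.
  apply: (@stationary_estimate (-1) dl m dl _ _ q) => //.
  - by right.
  - by lra.
  - by move=> p /andP[]; lra.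
  - by move=> p /andP[? ?]; apply: uS; apply/andP; split; lra.
  - by apply: VW => p /andP[? ?]; apply/andP; split; lra.
apply: le_trans stat _.
have dlal : dl * dl `^ (al - 1) = dl `^ al by rewrite mulr_powRB1 ?(ltW dl0).
have -> : 2 * dl * dl `^ (al - 1) * S = 2 * dl `^ al * S by rewrite -dlal; ring.
have -> : t^-1 * dl `^ (al - 1) * (m * dl)^-1 = dl `^ al * m^-1.
  by rewrite dl2 -dlal; field; rewrite !gt_eqF.
rewrite [leRHS](_ : _ = 2 * (dl `^ al * S) * al^-1 +
  2 * (dl `^ al * m^-1 * (4 * S + W))); last by ring.
rewrite lerD2r (_ : 2 * _ * S = 2 * (dl `^ al * S) * 1); last by ring.
by rewrite ler_wpM2l ?mulr_ge0 ?powR_ge0// invf_ge1// ltW.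
Qed.

End Decay.

(** * Estimates in the two cones *)

Section Estimates.
Context {R : realType}.
Implicit Types (a b p q : R).
Local Notation N := (@Normc.normc R).
Local Notation mu := (@lebesgue_measure R).

Lemma ccontinuous_at_near (g h : R -> R[i]) x d : 0 < d ->
  (forall y, `|y - x| < d -> g y = h y) -> ccontinuous_at h x -> ccontinuous_at g x.
Proof.
move=> d0 gh ch e e0; have [r r0 hr] := ch e e0.
exists (Num.min d r); first by rewrite lt_min d0.
move=> y; rewrite lt_min => /andP[yd yr].
by rewrite (gh y yd) (gh x) ?subrr ?normr0//; exact: hr.
Qed.

Variable f : R -> R.
Hypothesis hf : smooth_poly_growth f.

Lemma smooth_derivable n p : derivable (derive1n n f) p 1.
Proof. by case: hf => + _; exact. Qed.

Lemma smooth_is_derive n p : is_derive p 1 (derive1n n f) (derive1n n.+1 f p).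
Proof.
by rewrite derive1nS derive1E; apply: DeriveDef => //; case: hf => + _; exact.
Qed.

Hypothesis f2_gt0 : forall p, 0 < derive1n 2 f p.

Lemma min_f2_gt0 a b : a <= b -> 0 < min_f2 f a b.
Proof.
move=> ab; have [|c cab hc] := @EVT_min R (derive1n 2 f) a b ab.
  apply: derivable_within_continuous => p _.
  exact: smooth_derivable.
apply: lt_le_trans (f2_gt0 c) _; apply: lb_le_inf.
  by exists (derive1n 2 f a); exists a => //=; rewrite in_itv /= lexx ab.
by move=> _ [p pab <-]; exact: hc.
Qed.

Lemma min_f2_le a b p : a <= p <= b -> min_f2 f a b <= derive1n 2 f p.
Proof.
move=> pab; apply: ge_inf; last by exists p => //=; rewrite in_itv.
by exists 0 => _ [q _ <-]; exact: ltW.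
Qed.

Lemma derive1_increasing a b : a < b -> derive1 f a < derive1 f b.
Proof.
exact: (@f1_increasing R (derive1 f) (derive1n 2 f) (smooth_is_derive 1) f2_gt0).
Qed.

Lemma derive1_nondecreasing a b : a <= b -> derive1 f a <= derive1 f b.
Proof.
exact: (@f1_nondecreasing R (derive1 f) (derive1n 2 f) (smooth_is_derive 1) f2_gt0).
Qed.

Lemma stationary_point a b c : derive1 f a < c < derive1 f b ->
  exists2 p0, a < p0 < b & derive1 f p0 = c.
Proof.
move=> /andP[ac cb].
have ab : a <= b.
  rewrite leNgt; apply/negP => /derive1_increasing; lra.
have [||p0 _ p0c] := @IVT R (derive1 f) a b c ab.
- apply: derivable_within_continuous => p _.
  exact: (@smooth_derivable 1%N p).
- by rewrite min_l ?max_r ?derive1_nondecreasing// !ltW.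
exists p0 => //; apply/andP; split; rewrite ltNge; apply/negP => /derive1_nondecreasing; lra.
Qed.

Variables (al p1 t x : R) (u0hat ut : R -> R[i]).
Hypotheses (al01 : 0 < al < 1) (t_gt0 : 0 < t).
Hypothesis iu : cintegrable u0hat.
Hypothesis ut_bounded : exists M : R, forall p, N (ut p) <= M.
Hypothesis dut : cdifferentiable ut.
Hypothesis iut : cintegrable (cderiv ut).
Hypothesis u0hatE : forall p, p != p1 -> u0hat p = (`|p - p1| `^ (al - 1))%:C * ut p.

Let e p := expi (- (t * f p) + x * p).
Let g p := u0hat p * e p.
Let P := cprimitive g.

Let de p : cis_derive e p ('i%C * (- (t * derive1 f p) + x)%:C * e p).
Proof.
apply: cis_derive_expi.
apply: is_derive_eq (is_deriveD (is_deriveN (is_deriveM (is_derive_cst t p 1)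
  (smooth_is_derive 0 p))) (is_deriveM (is_derive_cst x p 1) (is_derive_id p 1))) _.
by rewrite /GRing.scale /= !mulr0 !addr0 mulr1.
Qed.

Let ig : cintegrable g.
Proof.
apply: (cintegrableM (C := 1)) => //.
  by apply: cmeasurable_continuous => p; exact: cis_derive_continuous (de p).
by move=> p; rewrite normc_expi.
Qed.

Let cut p : ccontinuous_at ut p.
Proof. exact: cis_derive_continuous ((cis_deriveP _).1 dut p). Qed.

Let cP p : ccontinuous_at P p.
Proof. exact: cprimitive_continuous. Qed.

Let dP p : p != p1 -> cis_derive P p
  ((`|p - p1| `^ (al - 1))%:C * ut p * expi (- (t * f p) + x * p)).
Proof.
move=> pp1; rewrite -u0hatE// -/(e p) -/(g p); apply: cprimitive_derive => //.
have d0 : 0 < `|p - p1| by rewrite normr_gt0 subr_eq0.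
pose s : R := Num.sg (p - p1).
have sn : s * (p - p1) = `|p - p1| by rewrite -normrEsg.
have s1 : `|s| = 1 by rewrite normr_sg subr_eq0 pp1.
have near_s q : `|q - p| < `|p - p1| -> `|q - p1| = s * (q - p1) /\ q != p1.
  move=> qp.
  have : 0 < s * (q - p1).
    have -> : s * (q - p1) = s * (p - p1) + s * (q - p) by ring.
    have := ler_norm (- (s * (q - p))); rewrite normrN normrM s1 mul1r sn; lra.
  move=> h; split; first by rewrite -(gtr0_norm h) normrM s1 mul1r.
  by apply: contraTneq h => ->; rewrite subrr mulr0 ltxx.
apply: (@ccontinuous_at_near _ (fun q => ((s * (q - p1)) `^ (al - 1))%:C * ut q * e q) _ _ d0).
  by move=> q /near_s[h qp1]; rewrite /g u0hatE// h.
apply: cis_derive_continuous.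
apply: cis_deriveM (de p); apply: cis_deriveM ((cis_deriveP _).1 dut p).
apply: cis_derive_real.
have d1 : is_derive p 1 (fun y => s * (y - p1)) s.
  apply: is_derive_eq (is_deriveM (is_derive_cst s p 1)
    (is_deriveB (is_derive_id p 1) (is_derive_cst p1 p 1))) _.
  by rewrite /GRing.scale /= subr0 mulr1 mulr0 addr0.
have h : 0 < s * (p - p1) by rewrite sn.
exact: (@is_derive1_comp _ _ (fun y => s * (y - p1)) p _ _ (is_derive1_powR (al - 1) h) d1).
Qed.

Let dfE p : is_derive p 1 f (derive1 f p).
Proof. exact: (smooth_is_derive 0 p). Qed.
Let df1E p : is_derive p 1 (derive1 f) (derive1n 2 f p).
Proof. exact: (smooth_is_derive 1 p). Qed.

Let S := cLnorm +oo%E setT ut.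
Let W := cLnorm 1%E setT (cderiv ut).

Let leS p : N (ut p) <= S.
Proof. by have [M hM] := ut_bounded; exact: le_cLnorm_setT hM p. Qed.

Let leW : \int[mu]_p N (cderiv ut p) <= W.
Proof. by rewrite /W cLnorm1E. Qed.

Let nearE := near_estimate dfE df1E f2_gt0 al01 t_gt0 dut iut cP dP.
Let oscE := oscillation_increment dfE df1E f2_gt0 al01 t_gt0 dut iut dP.
Let halfE := half_singular_estimate dfE df1E f2_gt0 al01 t_gt0 dut iut cP dP.
Let statE := stationary_estimate dfE df1E f2_gt0 al01 t_gt0 dut iut cP dP.

Lemma solution_fun_le (C : R) (n0 : R) :
  (forall n : R, n0 <= n -> N (P n - P (- n)) <= C) ->
  N (solution_fun f u0hat t x) <= (2 * pi)^-1 * C.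
Proof.
move=> hC; rewrite /solution_fun Normc.normcM normc_real ger0_norm; last first.
  by rewrite invr_ge0 mulr_ge0 ?pi_ge0.
rewrite ler_wpM2l ?invr_ge0 ?mulr_ge0 ?pi_ge0//.
apply: ccvg_le (cprimitive_cvg ig) _; near=> n; apply: hC.
by near: n; exact: nbhs_infty_ger.
Unshelve. all: by end_near. Qed.

(** The line is cut at [p1 - eta], [p1] and [p1 + eta]. The stationary point is
    within [eps] of [p1], so on the outer half-lines the phase speed is bounded
    below by the increments of [f'] between [eps] and [eta]. *)
Lemma near_cone_estimate eps eta : 0 < eps < eta ->
  derive1 f (p1 - eps) < x / t < derive1 f (p1 + eps) ->
  N (solution_fun f u0hat t x) <=
    near_c1 f al p1 ut eta * t `^ (- (al / 2)) +
    near_c2 f al p1 ut eps eta * t^-1.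
Proof.
move=> /andP[eps0 epseta] cone; have [p0 _ hp0] := stationary_point cone.
have eta0 : 0 < eta := lt_trans eps0 epseta.
have [M hM] := ut_bounded; move: cone => /andP[c1 c2].
pose m1 := min_f2 f (p1 - eta) p1; pose m2 := min_f2 f p1 (p1 + eta).
pose S1 := cLnorm +oo%E `[p1 - eta, p1] ut; pose S2 := cLnorm +oo%E `[p1, p1 + eta] ut.
pose W1 := cLnorm 1%E `[p1 - eta, p1] (cderiv ut).
pose W2 := cLnorm 1%E `[p1, p1 + eta] (cderiv ut).
pose mt1 := near_mt1 f p1 eps eta; pose mt2 := near_mt2 f p1 eps eta.
have mt10 : 0 < mt1 by rewrite subr_gt0 derive1_increasing// ltrD2l.
have mt20 : 0 < mt2 by rewrite subr_gt0 derive1_increasing// ltrD2l ltrN2.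
have m10 : 0 < m1 by apply: min_f2_gt0; lra.
have m20 : 0 < m2 by apply: min_f2_gt0; lra.
have ul : unit_sign (-1 : R) by right.
have ur : unit_sign (1 : R) by left.
pose B m s w := t `^ (- (al / 2)) * (3 / al * s + 2 * m^-1 * (4 * s + w)).
pose C m := t^-1 * eta `^ (al - 1) * m^-1 * (4 * S + W).
apply: le_trans (solution_fun_le (C := B m1 S1 W1 + C mt2 + (B m2 S2 W2 + C mt1))
  (n0 := `|p1| + eta) _) _.
  move=> n hn; have hp1 : p1 <= `|p1| := ler_norm _.
  have hp1' : - p1 <= `|p1| by rewrite -normrN ler_norm.
  have h1 : N (P (p1 + -1 * eta) - P p1) <= B m1 S1 W1.
    apply: (nearE ul eta0 m10 _ hp0).
    - by move=> p /andP[h1 h2]; apply: min_f2_le; apply/andP; split; lra.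
    - move=> p /andP[h1 h2]; apply: (le_cLnorm_itv _ cut hM); first by lra.
      by apply/andP; split; lra.
    - move=> a b hab; rewrite /W1 cLnorm1E//; apply: le_Rintegral_norm => //.
      move=> z /=; rewrite !in_itv /= => /hab/andP[h1 h2].
      by apply/andP; split; lra.
  have h2 : N (P (p1 + 1 * eta) - P p1) <= B m2 S2 W2.
    apply: (nearE ur eta0 m20 _ hp0).
    - by move=> p /andP[h1' h2]; apply: min_f2_le; apply/andP; split; lra.
    - move=> p /andP[h1' h2]; apply: (le_cLnorm_itv _ cut hM); first by lra.
      by apply/andP; split; lra.
    - move=> a b hab; rewrite /W2 cLnorm1E//; apply: le_Rintegral_norm => //.
      move=> z /=; rewrite !in_itv /= => /hab/andP[h1' h2].
      by apply/andP; split; lra.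
  have h3 : N (P (p1 + -1 * (n + p1)) - P (p1 + -1 * eta)) <= C mt2.
    apply: (oscE ul ul eta0 _ mt20 _ (fun p _ => leS p) leW); first by lra.
    move=> p /andP[h3 _]; have : derive1 f p <= derive1 f (p1 - eta).
      by apply: derive1_nondecreasing; lra.
    by rewrite /mt2 /near_mt2; lra.
  have h4 : N (P (p1 + 1 * (n - p1)) - P (p1 + 1 * eta)) <= C mt1.
    apply: (oscE ur ur eta0 _ mt10 _ (fun p _ => leS p) leW); first by lra.
    move=> p /andP[h4 _]; have : derive1 f (p1 + eta) <= derive1 f p.
      by apply: derive1_nondecreasing; lra.
    by rewrite /mt1 /near_mt1; lra.
  have h5 := split_increment h1 h3; have h6 := split_increment h2 h4.
  move: h5 h6; rewrite (_ : p1 + -1 * (n + p1) = - n); last by ring.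
  rewrite (_ : p1 + 1 * (n - p1) = n); last by ring.
  rewrite normcB => h5 h6; exact: split_increment h5 h6.
rewrite le_eqVlt; apply/orP; left; apply/eqP.
rewrite /B /C /near_c1 /near_c2 /near_term -/m1 -/m2 -/S1 -/S2 -/W1 -/W2 -/mt1 -/mt2 -/S -/W.
move: m1 m2 mt1 mt2 m10 m20 mt10 mt20 => m1 m2 mt1 mt2 m10 m20 mt10 mt20.
have /andP[al0 _] := al01.
have := pi_gt0 R; move: (@pi R) => PI PI_gt0.
by field; rewrite !gt_eqF.
Qed.

Variables (pt1 pt2 eta : R).
Hypotheses (pt12 : pt1 < pt2) (eta_gt0 : 0 < eta).
Hypothesis cone : derive1 f pt1 < x / t < derive1 f pt2.

Let dl := t `^ (- (1 / 2)).
Let dl_gt0 : 0 < dl. Proof. exact: powR_gt0. Qed.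
Let dl_sqr : t^-1 = dl * dl.
Proof.
rewrite /dl -powRD; last by rewrite (gt_eqF t_gt0) implybT.
by rewrite (_ : _ + _ = -1) ?powR_inv1 ?(ltW t_gt0)//; field.
Qed.

Let m1 := far_m1 f pt1 pt2 eta.
Let mt2 := far_mt2 f pt1 eta.
Let mt3 := far_mt3 f pt2 eta.
Let m1_gt0 : 0 < m1. Proof. by apply: min_f2_gt0; have := pt12; have := eta_gt0; lra. Qed.
Let mt2_gt0 : 0 < mt2. Proof. by rewrite subr_gt0 derive1_increasing// gtrBl. Qed.
Let mt3_gt0 : 0 < mt3. Proof. by rewrite subr_gt0 derive1_increasing// ltrDl. Qed.

Let far_stationary s d : unit_sign s -> 0 < d ->
  (forall p, pt1 - eta <= p <= pt2 + eta -> d <= s * (p - p1)) ->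
  N (P (pt2 + eta) - P (pt1 - eta)) <=
    2 * dl * d `^ (al - 1) * S + 2 * (t^-1 * d `^ (al - 1) * (m1 * dl)^-1 * (4 * S + W)).
Proof.
move=> hs d0 hd; have [p0 _ hp0] := stationary_point cone.
have h12 := pt12; have heta := eta_gt0.
have [|p|q hq] := @phase_gap _ _ _ df1E f2_gt0 m1 (pt1 - eta) (pt2 + eta) (x / t) p0 _ _ hp0.
- by lra.
- exact: min_f2_le.
apply: (statE hs _ d0 m1_gt0 dl_gt0 hd hq (fun p _ => leS p)); first by lra.
by apply: le_trans leW; apply: le_Rintegral_norm.
Qed.

(** The line is cut at [p1], [pt1 - eta] and [pt2 + eta]. The stationary point
    lies in the middle interval, at positive distance of [p1], and the singularity
    is felt only where the phase speed is at least [mt2]. *)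
Lemma far_cone_estimate_right_of_p1 : p1 < pt1 -> eta < pt1 - p1 ->
  N (solution_fun f u0hat t x) <=
    far_c1 f al p1 ut pt1 pt2 eta * t `^ (- (1 / 2)) +
    far_c2 f al p1 ut pt1 pt2 eta * t `^ (- al) +
    far_c3 f al p1 ut pt1 pt2 eta * t^-1.
Proof.
move=> p1pt1 heta; have h12 := pt12; have eta0 := eta_gt0.
have /andP[c1 c2] := cone.
have ul : unit_sign (-1 : R) by right.
have ur : unit_sign (1 : R) by left.
pose d := pt1 - eta - p1; have d0 : 0 < d by rewrite /d; lra.
pose d' := pt2 + eta - p1; have d'0 : 0 < d' by rewrite /d'; lra.
pose H := t `^ (- al) * (al^-1 * S + mt2^-1 * (4 * S + W)).
pose Z := 2 * dl * d `^ (al - 1) * S + 2 * (t^-1 * d `^ (al - 1) * (m1 * dl)^-1 * (4 * S + W)).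
pose C := t^-1 * d' `^ (al - 1) * mt3^-1 * (4 * S + W).
have lo p : p <= pt1 - eta -> mt2 <= -1 * (derive1 f p - x / t).
  by move=> /derive1_nondecreasing; rewrite /mt2 /far_mt2; lra.
apply: le_trans (solution_fun_le (C := H + H + Z + C) (n0 := `|p1| + `|pt2| + eta) _) _.
  move=> n hn; have q1 : p1 <= `|p1| := ler_norm _.
  have q2 : - p1 <= `|p1| by rewrite -normrN ler_norm.
  have q3 : pt2 <= `|pt2| := ler_norm _.
  have q4 : 0 <= `|p1| := normr_ge0 _; have q5 : 0 <= `|pt2| := normr_ge0 _.
  have h1 : N (P (p1 + -1 * (n + p1)) - P p1) <= H.
    apply: (halfE ul ul _ mt2_gt0 _ (fun p _ => leS p) leW); first by lra.
    by move=> p /andP[h1 _]; apply: lo; lra.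
  have h2 : N (P (p1 + 1 * d) - P p1) <= H.
    apply: (halfE ur ul (ltW d0) mt2_gt0 _ (fun p _ => leS p) leW).
    by move=> p /andP[_ h2]; apply: lo; rewrite /d in h2; lra.
  have h3 : N (P (pt2 + eta) - P (pt1 - eta)) <= Z.
    by apply: (far_stationary ur d0) => p /andP[h3 _]; rewrite /d; lra.
  have h4 : N (P (p1 + 1 * (n - p1)) - P (p1 + 1 * d')) <= C.
    apply: (oscE ur ur d'0 _ mt3_gt0 _ (fun p _ => leS p) leW); first by rewrite /d'; lra.
    move=> p /andP[h4 _]; have : derive1 f (pt2 + eta) <= derive1 f p.
      by apply: derive1_nondecreasing; rewrite /d' in h4; lra.
    by rewrite /mt3 /far_mt3; lra.
  move: h1 h2 h4; rewrite (_ : p1 + -1 * (n + p1) = - n); last by ring.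
  rewrite (_ : p1 + 1 * (n - p1) = n); last by ring.
  rewrite (_ : p1 + 1 * d = pt1 - eta); last by rewrite /d; ring.
  rewrite (_ : p1 + 1 * d' = pt2 + eta); last by rewrite /d'; ring.
  rewrite normcB => h1 h2 h4.
  exact: split_increment (split_increment (split_increment h1 h2) h3) h4.
rewrite le_eqVlt; apply/orP; left; apply/eqP.
rewrite /H /Z /C /far_c1 /far_c2 /far_c3 p1pt1 -/m1 -/mt2 -/mt3 -/S -/W -/dl -/d -/d'.
rewrite dl_sqr; have /andP[al0 _] := al01.
move: m1_gt0 mt2_gt0 mt3_gt0 dl_gt0.
move: m1 mt2 mt3 dl {c1 c2 C Z H lo} => k1 k2 k3 k4 k10 k20 k30 k40.
have := pi_gt0 R; move: (@pi R) => PI PI_gt0.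
by field; rewrite !gt_eqF.
Qed.

(** The mirror image of the previous case, with the singularity on the right. *)
Lemma far_cone_estimate_left_of_p1 : pt2 < p1 -> eta < p1 - pt2 ->
  N (solution_fun f u0hat t x) <=
    far_c1 f al p1 ut pt1 pt2 eta * t `^ (- (1 / 2)) +
    far_c2 f al p1 ut pt1 pt2 eta * t `^ (- al) +
    far_c3 f al p1 ut pt1 pt2 eta * t^-1.
Proof.
move=> p1pt2 heta; have h12 := pt12; have eta0 := eta_gt0.
have /andP[c1 c2] := cone.
have ul : unit_sign (-1 : R) by right.
have ur : unit_sign (1 : R) by left.
pose d := p1 - pt2 - eta; have d0 : 0 < d by rewrite /d; lra.
pose d' := p1 - pt1 + eta; have d'0 : 0 < d' by rewrite /d'; lra.
pose H := t `^ (- al) * (al^-1 * S + mt3^-1 * (4 * S + W)).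
pose Z := 2 * dl * d `^ (al - 1) * S + 2 * (t^-1 * d `^ (al - 1) * (m1 * dl)^-1 * (4 * S + W)).
pose C := t^-1 * d' `^ (al - 1) * mt2^-1 * (4 * S + W).
have hi p : pt2 + eta <= p -> mt3 <= 1 * (derive1 f p - x / t).
  by move=> /derive1_nondecreasing; rewrite /mt3 /far_mt3; lra.
apply: le_trans (solution_fun_le (C := C + Z + H + H) (n0 := `|p1| + `|pt1| + eta) _) _.
  move=> n hn; have q1 : p1 <= `|p1| := ler_norm _.
  have q2 : - pt1 <= `|pt1| by rewrite -normrN ler_norm.
  have q4 : 0 <= `|p1| := normr_ge0 _; have q5 : 0 <= `|pt1| := normr_ge0 _.
  have h1 : N (P (p1 + 1 * (n - p1)) - P p1) <= H.
    apply: (halfE ur ur _ mt3_gt0 _ (fun p _ => leS p) leW); first by lra.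
    by move=> p /andP[h1 _]; apply: hi; lra.
  have h2 : N (P (p1 + -1 * d) - P p1) <= H.
    apply: (halfE ul ur (ltW d0) mt3_gt0 _ (fun p _ => leS p) leW).
    by move=> p /andP[_ h2]; apply: hi; rewrite /d in h2; lra.
  have h3 : N (P (pt2 + eta) - P (pt1 - eta)) <= Z.
    by apply: (far_stationary ul d0) => p /andP[_ h3]; rewrite /d; lra.
  have h4 : N (P (p1 + -1 * (n + p1)) - P (p1 + -1 * d')) <= C.
    apply: (oscE ul ul d'0 _ mt2_gt0 _ (fun p _ => leS p) leW); first by rewrite /d'; lra.
    move=> p /andP[h4 _]; have : derive1 f p <= derive1 f (pt1 - eta).
      by apply: derive1_nondecreasing; rewrite /d' in h4; lra.
    by rewrite /mt2 /far_mt2; lra.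
  move: h1 h2 h4; rewrite (_ : p1 + -1 * (n + p1) = - n); last by ring.
  rewrite (_ : p1 + 1 * (n - p1) = n); last by ring.
  rewrite (_ : p1 + -1 * d = pt2 + eta); last by rewrite /d; ring.
  rewrite (_ : p1 + -1 * d' = pt1 - eta); last by rewrite /d'; ring.
  rewrite [X in _ -> X <= _ -> _]normcB [X in _ -> _ -> X <= _ -> _]normcB => h1 h2 h4.
  exact: split_increment (split_increment (split_increment h4 h3) h2) h1.
rewrite le_eqVlt; apply/orP; left; apply/eqP.
have np1 : (p1 < pt1) = false by apply/negP => ?; lra.
rewrite /H /Z /C /far_c1 /far_c2 /far_c3 np1 -/m1 -/mt2 -/mt3 -/S -/W -/dl -/d -/d'.
rewrite dl_sqr; have /andP[al0 _] := al01.
move: m1_gt0 mt2_gt0 mt3_gt0 dl_gt0.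
move: m1 mt2 mt3 dl {c1 c2 C Z H hi} => k1 k2 k3 k4 k10 k20 k30 k40.
have := pi_gt0 R; move: (@pi R) => PI PI_gt0.
by field; rewrite !gt_eqF.
Qed.

End Estimates.

(** * Families of Schwartz functions and of multipliers *)

Section Families.
Context {R : realType}.
Implicit Types (f h : R -> R) (x y p : R).
Local Notation N := (@Normc.normc R).

Lemma cderivD (a b : R -> R[i]) : cdifferentiable a -> cdifferentiable b ->
  cderiv (fun x => a x + b x) = (fun x => cderiv a x + cderiv b x).
Proof.
move=> /cis_deriveP da /cis_deriveP db; apply/funext => x.
exact: cderivE (cis_deriveD (da x) (db x)).
Qed.

Lemma cdifferentiableD (a b : R -> R[i]) : cdifferentiable a -> cdifferentiable b ->
  cdifferentiable (fun x => a x + b x).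
Proof.
move=> /cis_deriveP da /cis_deriveP db; apply/cis_deriveP => x.
by have h := cis_deriveD (da x) (db x); rewrite (cderivE h).
Qed.

Lemma cderivM (a b : R -> R[i]) : cdifferentiable a -> cdifferentiable b ->
  cderiv (fun x => a x * b x) = (fun x => cderiv a x * b x + a x * cderiv b x).
Proof.
move=> /cis_deriveP da /cis_deriveP db; apply/funext => x.
exact: cderivE (cis_deriveM (da x) (db x)).
Qed.

Lemma cdifferentiableM (a b : R -> R[i]) : cdifferentiable a -> cdifferentiable b ->
  cdifferentiable (fun x => a x * b x).
Proof.
move=> /cis_deriveP da /cis_deriveP db; apply/cis_deriveP => x.
by have h := cis_deriveM (da x) (db x); rewrite (cderivE h).
Qed.

Lemma cis_derive_cdifferentiable (g g' : R -> R[i]) :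
  (forall x, cis_derive g x (g' x)) -> cdifferentiable g /\ cderiv g = g'.
Proof.
move=> dg; split; first by apply/cis_deriveP => x; rewrite (cderivE (dg x)).
by apply/funext => x; exact: cderivE.
Qed.

Section Index.
Variable I : Type.
Implicit Types (G H : I -> R -> R[i]).

Definition rapidly_decreasing G : Prop :=
  forall k : nat, exists M, forall i x, `|x| ^+ k * N (G i x) <= M.

Definition polynomially_bounded G : Prop :=
  exists (K : R) (n : nat), forall i x, N (G i x) <= K * (1 + `|x|) ^+ n.

(** Uniform control of the derivatives up to order [n] of the members of a family,
    which stands for a bounded set of functions. The recursion goes through the
    derived family, so that closure under products needs the Leibniz rule for one
    derivative only. *)
Fixpoint smooth_family (sz : (I -> R -> R[i]) -> Prop) (n : nat) G : Prop :=
  [/\ forall i, cdifferentiable (G i), sz G &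
      if n is n'.+1 then smooth_family sz n' (fun i => cderiv (G i)) else True].

Definition schwartz_family G : Prop :=
  forall n, smooth_family rapidly_decreasing n G.

Definition multiplier_family G : Prop :=
  forall n, smooth_family polynomially_bounded n G.

Lemma smooth_familyW sz n G : smooth_family sz n.+1 G -> smooth_family sz n G.
Proof.
elim: n G => [|n IH] G [dG sG hG]; first by split.
by split => //; exact: IH.
Qed.

Lemma smooth_familyS sz n G (G' : I -> R -> R[i]) :
  (forall i x, cis_derive (G i) x (G' i x)) -> sz G -> smooth_family sz n G' ->
  smooth_family sz n.+1 G.
Proof.
move=> dG sG hG'; split => //.
  by move=> i; have [] := cis_derive_cdifferentiable (dG i).
suff -> : (fun i => cderiv (G i)) = G' by [].
by apply/funext => i; have [] := cis_derive_cdifferentiable (dG i).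
Qed.

Lemma smooth_familyD (sz : (I -> R -> R[i]) -> Prop) n G H :
  (forall G H, sz G -> sz H -> sz (fun i x => G i x + H i x)) ->
  smooth_family sz n G -> smooth_family sz n H ->
  smooth_family sz n (fun i x => G i x + H i x).
Proof.
move=> szD; elim: n G H => [|n IH] G H [dG sG hG] [dH sH hH].
  by split=> [i||]; [exact: cdifferentiableD|exact: szD|].
split => [i||]; [exact: cdifferentiableD|exact: szD|].
under eq_fun do rewrite cderivD//.
exact: IH.
Qed.

Lemma smooth_familyM (s1 s2 : (I -> R -> R[i]) -> Prop) n G H :
  (forall G H, s2 G -> s2 H -> s2 (fun i x => G i x + H i x)) ->
  (forall G H, s1 G -> s2 H -> s2 (fun i x => G i x * H i x)) ->
  smooth_family s1 n G -> smooth_family s2 n H ->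
  smooth_family s2 n (fun i x => G i x * H i x).
Proof.
move=> s2D s12; elim: n G H => [|n IH] G H hG hH.
  have [dG sG _] := hG; have [dH sH _] := hH.
  by split=> [i||]; [exact: cdifferentiableM|exact: s12|].
have [dG sG hG'] := hG; have [dH sH hH'] := hH.
split => [i||]; [exact: cdifferentiableM|exact: s12|].
under eq_fun do rewrite cderivM//.
apply: smooth_familyD => //; apply: IH => //; exact: smooth_familyW.
Qed.

Lemma rapidly_decreasingD G H : rapidly_decreasing G -> rapidly_decreasing H ->
  rapidly_decreasing (fun i x => G i x + H i x).
Proof.
move=> hG hH k; have [M1 h1] := hG k; have [M2 h2] := hH k.
exists (M1 + M2) => i x; apply: le_trans (lerD (h1 i x) (h2 i x)).
by rewrite -mulrDr ler_wpM2l ?exprn_ge0// normcD.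
Qed.

Lemma polynomially_bounded_le G : polynomially_bounded G ->
  exists (K : R) (n : nat), 0 <= K /\ forall m i x, (n <= m)%N ->
    N (G i x) <= K * (1 + `|x|) ^+ m.
Proof.
move=> [K [n hG]]; exists `|K|, n; split => // m i x nm.
apply: le_trans (hG i x) _; apply: (@le_trans _ _ (`|K| * (1 + `|x|) ^+ n)).
  by rewrite ler_wpM2r ?ler_norm// exprn_ge0// addr_ge0.
by rewrite ler_wpM2l// ler_weXn2l// lerDl.
Qed.

Lemma polynomially_boundedD G H : polynomially_bounded G -> polynomially_bounded H ->
  polynomially_bounded (fun i x => G i x + H i x).
Proof.
move=> /polynomially_bounded_le[K1 [n1 [K10 h1]]].
move=> /polynomially_bounded_le[K2 [n2 [K20 h2]]].
exists (K1 + K2), (n1 + n2)%N => i x; rewrite mulrDl.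
apply: le_trans (normcD _ _) (lerD (h1 _ _ _ _) (h2 _ _ _ _)).
  exact: leq_addr.
exact: leq_addl.
Qed.

Lemma polynomially_boundedM G H : polynomially_bounded G -> polynomially_bounded H ->
  polynomially_bounded (fun i x => G i x * H i x).
Proof.
move=> [K1 [n1 h1]] [K2 [n2 h2]].
exists (K1 * K2), (n1 + n2)%N => i x; rewrite Normc.normcM exprD mulrACA.
by rewrite ler_pM ?normc_ge0.
Qed.

Lemma rapidly_decreasingM G H : polynomially_bounded G -> rapidly_decreasing H ->
  rapidly_decreasing (fun i x => G i x * H i x).
Proof.
move=> /polynomially_bounded_le[K [n [K0 hG]]] hH k.
have [M1 h1] := hH k; have [M2 h2] := hH (k + n)%N.
exists (K * 2 ^+ n * (M1 + M2)) => i x.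
have A0 : 0 <= `|x| by [].
have B0 : 0 <= N (H i x) := normc_ge0 _.
apply: (@le_trans _ _ (K * 2 ^+ n * (`|x| ^+ k * N (H i x) + `|x| ^+ (k + n) * N (H i x)))); last first.
  by rewrite ler_wpM2l ?mulr_ge0 ?exprn_ge0// lerD.
rewrite Normc.normcM.
apply: (@le_trans _ _ (`|x| ^+ k * ((K * (1 + `|x|) ^+ n) * N (H i x)))).
  by rewrite ler_wpM2l ?exprn_ge0// ler_wpM2r// hG.
have hx : (1 + `|x|) ^+ n <= 2 ^+ n * (1 + `|x| ^+ n).
  have [x1|x1] := leP `|x| 1.
    apply: (@le_trans _ _ (2 ^+ n)).
      by rewrite lerXn2r ?nnegrE ?addr_ge0//; lra.
    by rewrite ler_peMr ?exprn_ge0// lerDl exprn_ge0.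
  apply: (@le_trans _ _ ((2 * `|x|) ^+ n)).
    by rewrite lerXn2r ?nnegrE ?addr_ge0 ?mulr_ge0//; lra.
  by rewrite exprMn ler_wpM2l ?exprn_ge0// lerDr.
rewrite [leRHS](_ : _ = `|x| ^+ k * ((K * (2 ^+ n * (1 + `|x| ^+ n))) * N (H i x))); last first.
  by rewrite exprD; ring.
by rewrite ler_wpM2l ?exprn_ge0// ler_wpM2r// ler_wpM2l.
Qed.

Lemma schwartz_familyD G H : schwartz_family G -> schwartz_family H ->
  schwartz_family (fun i x => G i x + H i x).
Proof. by move=> hG hH n; apply: smooth_familyD => //; exact: rapidly_decreasingD. Qed.

Lemma multiplier_familyM G H : multiplier_family G -> multiplier_family H ->
  multiplier_family (fun i x => G i x * H i x).
Proof.
move=> hG hH n; apply: smooth_familyM (hG n) (hH n).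
  exact: polynomially_boundedD.
exact: polynomially_boundedM.
Qed.

Lemma schwartz_familyM G H : multiplier_family G -> schwartz_family H ->
  schwartz_family (fun i x => G i x * H i x).
Proof.
move=> hG hH n; apply: smooth_familyM (hG n) (hH n).
  exact: rapidly_decreasingD.
exact: rapidly_decreasingM.
Qed.

Lemma schwartz_family_deriv G : schwartz_family G ->
  schwartz_family (fun i => cderiv (G i)).
Proof. by move=> hG n; have [] := hG n.+1. Qed.

Lemma schwartz_family_rapid G : schwartz_family G -> rapidly_decreasing G.
Proof. by move=> /(_ 0%N)[]. Qed.

Lemma schwartz_family_differentiable G i : schwartz_family G -> cdifferentiable (G i).
Proof. by move=> /(_ 0%N)[]. Qed.

Lemma multiplier_family_cst (z : I -> R[i]) (C : R) : (forall i, N (z i) <= C) ->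
  multiplier_family (fun i _ => z i).
Proof.
have h0 n : smooth_family polynomially_bounded n (fun _ _ => 0 : R[i]).
  have sz0 : polynomially_bounded (fun _ _ => 0).
    by exists 0, 0%N => i x; rewrite mul0r normc0.
  elim: n => [|n IH].
    by split => // i; have [] := cis_derive_cdifferentiable (cis_derive_cst (0 : R[i])).
  by apply: (smooth_familyS (G' := fun _ _ => 0)) IH => // i x; exact: cis_derive_cst.
move=> zC n; apply: smooth_familyW; apply: (smooth_familyS (G' := fun _ _ => 0)) (h0 n).
  by move=> i x; exact: cis_derive_cst.
by exists C, 0%N => i x; rewrite expr0 mulr1.
Qed.

Lemma multiplier_family_real f : smooth_poly_growth f ->
  multiplier_family (fun _ x => (f x)%:C).
Proof.
move=> [df sf] n; rewrite -[f]/(derive1n 0 f); elim: n 0%N => [|n IH] m.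
  split => //.
    move=> i; apply: (cis_derive_cdifferentiable
      (g' := fun x => (derive1n m.+1 f x)%:C) _).1 => x; apply: cis_derive_real.
    by rewrite derive1nS derive1E; apply: DeriveDef => //; exact: df.
  by have [K [k h]] := sf m; exists K, k => i x; rewrite normc_real.
apply: (smooth_familyS (G' := fun _ x => (derive1n m.+1 f x)%:C)); last exact: IH.
  move=> i x; apply: cis_derive_real.
  by rewrite derive1nS derive1E; apply: DeriveDef => //; exact: df.
by have [K [k h]] := sf m; exists K, k => i x; rewrite normc_real.
Qed.

Lemma multiplier_family_id : multiplier_family (fun _ x => x%:C).
Proof.
move=> n; apply: smooth_familyW.
apply: (smooth_familyS (G' := fun _ _ => 1)) => //.
- by move=> i x; apply: cis_derive_real; exact: is_derive_id.
- by exists 1, 1%N => i x; rewrite normc_real mul1r expr1 lerDr.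
- by apply: (multiplier_family_cst (C := 1)) => i; rewrite normc_real normr1.
Qed.

End Index.

(** * Remainders of the exponential *)

Lemma normc_expiB1 y : N (expi y - 1) <= 2 * `|y|.
Proof.
wlog y0 : y / 0 <= y.
  move=> H; have [|/ltW yN] := leP 0 y; first exact: H.
  have := H (- y); rewrite oppr_ge0 => /(_ yN); rewrite normrN; apply: le_trans.
  by rewrite !normcE_sqrt !ReImE /= cosN sinN subr0 oppr0 !addr0 sqrrN.
have [c _ hc] := @mvt_closed R (@cos R) (fun x => - sin x) 0 y y0 (fun x _ => is_derive_cos x).
have [d _ hd] := @mvt_closed R (@sin R) (@cos R) 0 y y0 (fun x _ => is_derive_sin x).
apply: le_trans (normc_le _) _; rewrite !ReImE /= oppr0 addr0 mulr_natl mulr2n.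
rewrite cos0 subr0 in hc; rewrite sin0 !subr0 in hd.
rewrite hc hd !normrM normrN lerD// ler_piMl//.
  by rewrite ler_norml sin_geN1 sin_le1.
by rewrite ler_norml cos_geN1 cos_le1.
Qed.

Lemma normc_expi_taylor2 y : N (expi y - 1 - 'i%C * y%:C) <= 4 * y ^+ 2.
Proof.
have hb (z : R) : `|cos z - 1| <= 2 * `|z| /\ `|sin z| <= 2 * `|z|.
  have := normc_expiB1 z; set w := expi z - 1.
  have := normRe w; have := normIm w; rewrite /w !ReImE /= subr0 => h1 h2 h3.
  by split; [exact: le_trans h2 h3|exact: le_trans h1 h3].
wlog y0 : y / 0 <= y.
  move=> H; have [|/ltW yN] := leP 0 y; first exact: H.
  have := H (- y); rewrite oppr_ge0 => /(_ yN); rewrite sqrrN; apply: le_trans.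
  rewrite !normcE_sqrt !ReImE /= cosN sinN !(mul0r, mul1r, subr0, oppr0, addr0, add0r, mulr0).
  by rewrite opprK -(sqrrN (- sin y + y)) opprD opprK.
have dc x : is_derive x 1 (fun z => cos z - 1) (- sin x).
  by apply: is_derive_eq (is_deriveB (is_derive_cos x) (is_derive_cst (1 : R) x 1)) _; rewrite subr0.
have ds x : is_derive x 1 (fun z => sin z - z) (cos x - 1).
  exact: is_derive_eq (is_deriveB (is_derive_sin x) (is_derive_id x 1)) _.
have [c /andP[c0 cy] hc] := @mvt_closed R _ _ 0 y y0 (fun x _ => dc x).
have [d /andP[d0 dy] hd] := @mvt_closed R _ _ 0 y y0 (fun x _ => ds x).
apply: le_trans (normc_le _) _; rewrite !ReImE /=.
rewrite !(mul0r, mul1r, subr0, oppr0, addr0, add0r, mulr0).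
rewrite cos0 subrr !subr0 in hc; rewrite sin0 !subr0 in hd.
rewrite hc hd !normrM normrN (ger0_norm y0).
have [_ hs] := hb c; have [hcos _] := hb d.
rewrite (ger0_norm c0) in hs; rewrite (ger0_norm d0) in hcos.
have : `|sin c| * y <= 2 * y * y by rewrite ler_wpM2r//; lra.
have : `|cos d - 1| * y <= 2 * y * y by rewrite ler_wpM2r//; lra.
by rewrite expr2; lra.
Qed.

Section ExponentialFamilies.
Variables (I : Type) (h : I -> R) (f : R -> R) (C : R).
Hypothesis hf : smooth_poly_growth f.
Hypothesis hC : forall i, `|h i| <= C.

Let df x : is_derive x 1 f (derive1 f x).
Proof. by rewrite derive1E; apply: DeriveDef => //; exact: (hf.1 0%N). Qed.

Let hf1 : smooth_poly_growth (derive1 f).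
Proof.
have E n : derive1n n (derive1 f) = derive1n n.+1 f by rewrite /derive1n -iterSr.
by split=> [n x|n]; rewrite E; [exact: hf.1|exact: hf.2].
Qed.

Let de i x : cis_derive (fun y => expi (h i * f y)) x
  ('i%C * (h i)%:C * (derive1 f x)%:C * expi (h i * f x)).
Proof.
have d1 : is_derive x 1 (fun y => h i * f y) (h i * derive1 f x).
  apply: is_derive_eq (is_deriveM (is_derive_cst (h i) x 1) (df x)) _.
  by rewrite /GRing.scale /= mulr0 addr0.
by apply: cis_derive_eq (cis_derive_expi d1) _; rewrite rmorphM /= mulrA.
Qed.

Let ih_family : multiplier_family (fun i (_ : R) => 'i%C * (h i)%:C).
Proof.
by apply: multiplier_family_cst => i; rewrite Normc.normcM normc_i mul1r normc_real; exact: hC.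
Qed.

(** The derived family is a multiplier times the family itself, so control of
    [n] derivatives gives control of [n + 1]. *)
Lemma multiplier_family_expi : multiplier_family (fun i x => expi (h i * f x)).
Proof.
have sz : polynomially_bounded (fun i x => expi (h i * f x)).
  by exists 1, 0%N => i x; rewrite normc_expi expr0 mulr1.
elim=> [|n IH].
  by split => // i; have [] := cis_derive_cdifferentiable (de i).
apply: smooth_familyS (de) sz _.
apply: smooth_familyM IH.
- exact: polynomially_boundedD.
- exact: polynomially_boundedM.
- by apply: multiplier_familyM; [exact: ih_family|exact: multiplier_family_real].
Qed.

Hypothesis h_neq0 : forall i, h i != 0.

Let hE i : 'i%C * (h i)%:C * ((h i)^-1)%:C = 'i%C.
Proof. by rewrite -mulrA -rmorphM /= divff// mulr1. Qed.

(** The division by [h] is compensated: the derived family no longer contains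
    [1 / h]. *)
Lemma multiplier_family_expiB1 :
  multiplier_family (fun i x => ((h i)^-1)%:C * (expi (h i * f x) - 1)).
Proof.
move=> n; apply: smooth_familyW.
apply: (smooth_familyS (G' := fun i x => 'i%C * (derive1 f x)%:C * expi (h i * f x))).
- move=> i x; apply: cis_derive_eq (cis_deriveZ _ (cis_deriveB (de i x) (cis_derive_cst 1 x))) _.
  rewrite subr0 -[in RHS](hE i); ring.
- have [K [k hk]] := (hf.2 0%N); exists (2 * K), k => i x.
  rewrite Normc.normcM normc_real normfV.
  have h0 : 0 < `|h i| by rewrite normr_gt0.
  rewrite mulrC ler_pdivrMr//; apply: le_trans (normc_expiB1 _) _.
  rewrite normrM mulrCA mulrC ler_wpM2r//.
  by rewrite -mulrA ler_wpM2l//; exact: hk.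
- apply: multiplier_familyM; last exact: multiplier_family_expi.
  apply: multiplier_familyM; last exact: multiplier_family_real.
  by apply: (multiplier_family_cst (C := 1)) => i; rewrite normc_i.
Qed.

(** The derived family is a multiplier times the previous family; this makes the
    flow differentiable in time, with a quadratic remainder, in the Schwartz
    space. *)
Lemma multiplier_family_expi_taylor2 :
  multiplier_family (fun i x => ((h i)^-1)%:C ^+ 2 *
    (expi (h i * f x) - 1 - 'i%C * (h i * f x)%:C)).
Proof.
move=> n; apply: smooth_familyW.
apply: (smooth_familyS (G' := fun i x => 'i%C * (derive1 f x)%:C *
  (((h i)^-1)%:C * (expi (h i * f x) - 1)))).
- move=> i x.
  have d1 : is_derive x 1 (fun y => h i * f y) (h i * derive1 f x).
    apply: is_derive_eq (is_deriveM (is_derive_cst (h i) x 1) (df x)) _.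
    by rewrite /GRing.scale /= mulr0 addr0.
  apply: cis_derive_eq (cis_deriveZ _ (cis_deriveB
    (cis_deriveB (de i x) (cis_derive_cst 1 x)) (cis_deriveZ 'i%C (cis_derive_real d1)))) _.
  rewrite subr0 -[in RHS](hE i) rmorphM /=; ring.
- have [K [k hk]] := (hf.2 0%N); exists (4 * K ^+ 2), (k + k)%N => i x.
  rewrite Normc.normcM expr2 Normc.normcM normc_real normfV.
  have h0 : 0 < `|h i| by rewrite normr_gt0.
  rewrite -invfM mulrC ler_pdivrMr ?mulr_gt0//; apply: le_trans (normc_expi_taylor2 _) _.
  rewrite [leRHS](_ : _ = 4 * ((K * (1 + `|x|) ^+ k) ^+ 2 * (`|h i| * `|h i|))); last first.
    by rewrite exprD; ring.
  rewrite (_ : (h i * f x) ^+ 2 = `|f x| ^+ 2 * (`|h i| * `|h i|)); last first.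
    by rewrite -expr2 !real_normK ?num_real// exprMn mulrC.
  have hkx := hk x; rewrite ler_wpM2l// ler_wpM2r ?mulr_ge0//.
  by rewrite lerXn2r ?nnegrE ?(le_trans _ hkx)//.
- apply: multiplier_familyM; last exact: multiplier_family_expiB1.
  apply: multiplier_familyM; last exact: multiplier_family_real.
  by apply: (multiplier_family_cst (C := 1)) => i; rewrite normc_i.
Qed.

End ExponentialFamilies.

(** * Families and seminorms *)

Lemma schwartz_family_of (phi : R -> R[i]) : schwartz phi ->
  schwartz_family (fun _ : unit => phi).
Proof.
move=> [dphi sphi] n; rewrite -[phi]/(iter 0 cderiv phi).
have rd m : rapidly_decreasing (fun _ : unit => iter m cderiv phi).
  move=> k; have [M hM] := sphi (maxn k m); exists M => _ x.
  by apply: hM; rewrite ?leq_maxl ?leq_maxr.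
elim: n 0%N => [|n IH] m; first by split => // _; exact: dphi.
by split => [_||]; [exact: dphi|exact: rd|exact: (IH m.+1)].
Qed.

Lemma schwartz_family_iter (I : Type) (G : I -> R -> R[i]) n : schwartz_family G ->
  schwartz_family (fun i => iter n cderiv (G i)).
Proof. by move=> hG; elim: n => [//|n IH]; exact: schwartz_family_deriv. Qed.

Lemma schwartz_family_le (I : Type) (G : I -> R -> R[i]) : schwartz_family G ->
  forall m, exists M, forall i, schwartz_le m M (G i).
Proof.
move=> hG m.
have /choice[B hB] (kn : nat * nat) : exists M, forall i x,
    `|x| ^+ kn.1 * N (iter kn.2 cderiv (G i) x) <= M.
  exact: schwartz_family_rapid (schwartz_family_iter kn.2 hG) kn.1.
exists (\sum_(k < m.+1) \sum_(n < m.+1) `|B (k : nat, n : nat)|) => i k n x km nm.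
have ltk : (k < m.+1)%N by []; have ltn : (n < m.+1)%N by [].
apply: le_trans (hB (k, n) i x) _; apply: le_trans (ler_norm _) _.
rewrite (bigD1 (Ordinal ltk))//= (bigD1 (Ordinal ltn))//= -addrA lerDl addr_ge0//.
  by apply: sumr_ge0.
by apply: sumr_ge0 => ? _; apply: sumr_ge0.
Qed.

Lemma schwartz_family_schwartz (I : Type) (G : I -> R -> R[i]) i :
  schwartz_family G -> schwartz (G i).
Proof.
move=> hG; split=> [n|m].
  exact: schwartz_family_differentiable (schwartz_family_iter n hG).
by have [M hM] := schwartz_family_le hG m; exists M; exact: hM.
Qed.

End Families.

(** * The multiplication formula *)

Section FubiniAndPrimitives.
Context {R : realType}.
Implicit Types (x y p : R) (a b k : R -> R) (g H : R -> R[i]).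
Local Notation N := (@Normc.normc R).
Local Notation mu := (@lebesgue_measure R).

Section RealFubini.
Variables (a b : R -> R) (K : R * R -> R).
Hypotheses (ia : mu.-integrable setT (EFin \o a)) (ib : mu.-integrable setT (EFin \o b)).
Hypotheses (mK : measurable_fun setT K) (K1 : forall z, `|K z| <= 1).

Let F (z : R * R) : \bar R := (a z.1 * (b z.2 * K z))%:E.

Let ma : measurable_fun setT a.
Proof. by move/measurable_int/measurable_EFinP : ia. Qed.
Let mb : measurable_fun setT b.
Proof. by move/measurable_int/measurable_EFinP : ib. Qed.

Let mF : measurable_fun setT F.
Proof.
apply/measurable_EFinP; apply: measurable_funM.
  exact: (measurableT_comp ma measurable_fst).
by apply: measurable_funM => //; exact: (measurableT_comp mb measurable_snd).
Qed.

Let iF : (mu \x mu)%E.-integrable setT F.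
Proof.
apply/integrable12ltyP => //.
apply: (@le_lt_trans _ _ (\int[mu]_x (`|a x| * (\int[mu]_y `|b y|))%:E)%E).
  apply: ge0_le_integral => //.
  - by move=> x _; exact: integral_ge0.
  - have mabs : measurable_fun setT (abse \o F) by exact: measurableT_comp.
    have F0 z : (0 <= (abse \o F) z)%E by exact: abse_ge0.
    exact: (@measurable_fun_fubini_tonelli_F _ _ _ _ R mu (abse \o F) mabs F0).
  - apply/measurable_EFinP; apply: measurable_funM => //.
    exact: measurableT_comp.
  - move=> x _; apply: (@le_trans _ _ (\int[mu]_y (`|a x| * `|b y|)%:E)%E).
      apply: ge0_le_integral => //.
      + apply: measurableT_comp => //.
        exact: (measurableT_comp mF (pair1_measurable x)).
      + by apply/measurable_EFinP; apply: measurable_funM => //; exact: measurableT_comp.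
      + move=> y _ /=; rewrite lee_fin !normrM ler_wpM2l// ler_piMr//.
    under eq_integral do rewrite EFinM.
    rewrite integralZl//; last exact: integrable_norm.
    rewrite EFinM /Rintegral fineK//; apply: integrable_fin_num => //.
    exact: integrable_norm.
have iab : mu.-integrable setT (EFin \o (fun x => (\int[mu]_y `|b y|) * `|a x|)).
  by apply: integrable_scale; exact: integrable_norm.
under eq_integral do rewrite mulrC.
exact: integrable_lty iab.
Qed.

Let ibK x : mu.-integrable setT (EFin \o (fun y => b y * K (x, y))).
Proof.
apply: le_integrable ib => //.
  apply/measurable_EFinP; apply: measurable_funM => //.
  exact: (measurableT_comp mK (pair1_measurable x)).
by move=> y _ /=; rewrite lee_fin normrM ler_piMr.
Qed.

Let iaK y : mu.-integrable setT (EFin \o (fun x => a x * K (x, y))).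
Proof.
apply: le_integrable ia => //.
  apply/measurable_EFinP; apply: measurable_funM => //.
  exact: (measurableT_comp mK (pair2_measurable y)).
by move=> x _ /=; rewrite lee_fin normrM ler_piMr.
Qed.

Let inner1 x : (\int[mu]_y F (x, y) = (a x * \int[mu]_y (b y * K (x, y)))%:E)%E.
Proof.
rewrite -RintegralZl// /Rintegral fineK//.
by apply: integrable_fin_num => //; exact: integrable_scale.
Qed.

Let inner2 y : (\int[mu]_x F (x, y) = (b y * \int[mu]_x (a x * K (x, y)))%:E)%E.
Proof.
under eq_integral do rewrite /F /= mulrCA.
rewrite -RintegralZl// /Rintegral fineK//.
by apply: integrable_fin_num => //; exact: integrable_scale.
Qed.

Lemma integrable_fubini_real :
  mu.-integrable setT (EFin \o (fun x => a x * \int[mu]_y (b y * K (x, y)))).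
Proof.
have := integrable_fubini_F iF; apply: eq_integrable => // x _.
by rewrite /fubini_F inner1.
Qed.

Lemma fubini_real : \int[mu]_x (a x * \int[mu]_y (b y * K (x, y))) =
  \int[mu]_y (b y * \int[mu]_x (a x * K (x, y))).
Proof.
apply: (congr1 fine).
under eq_integral do rewrite -inner1.
by rewrite (Fubini iF); apply: eq_integral => y _; rewrite inner2.
Qed.

End RealFubini.

(** The Fourier transform and its inverse, up to constants, are the cases
    [s = -1] and [s = 1]. *)
Definition signed_fourier (s : R) g : R -> R[i] :=
  fun p => cintegral (fun x => g x * expi (s * (x * p))).

Lemma cmeasurable_expi (s p : R) : cmeasurable (fun x => expi (s * (x * p))).
Proof.
apply: cmeasurable_continuous => x; apply: cis_derive_continuous.
apply: cis_derive_expi; apply: is_derive_eq (is_deriveM (is_derive_cst s x 1)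
  (is_deriveM (is_derive_id x 1) (is_derive_cst p x 1))) _; reflexivity.
Qed.

Lemma cintegrable_fourier (s p : R) g : cintegrable g ->
  cintegrable (fun x => g x * expi (s * (x * p))).
Proof.
move=> ig; apply: (cintegrableM (C := 1)) => //; first exact: cmeasurable_expi.
by move=> x; rewrite normc_expi.
Qed.

Lemma signed_fourierD s g h : cintegrable g -> cintegrable h ->
  signed_fourier s (fun x => g x + h x) =
  (fun p => signed_fourier s g p + signed_fourier s h p).
Proof.
move=> ig ih; apply/funext => p; rewrite /signed_fourier.
rewrite -cintegralD; [|exact: cintegrable_fourier..].
by congr cintegral; apply/funext => x; exact: mulrDl.
Qed.

Lemma signed_fourierZ s (z : R[i]) g : cintegrable g ->
  signed_fourier s (fun x => z * g x) = (fun p => z * signed_fourier s g p).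
Proof.
move=> ig; apply/funext => p; rewrite /signed_fourier.
rewrite -cintegralZ; last exact: cintegrable_fourier.
by congr cintegral; apply/funext => x; exact/esym/mulrA.
Qed.

Let measurable_phase (s : R) : measurable_fun setT (fun z : R * R => s * (z.2 * z.1)).
Proof.
apply: measurable_funM => //; apply: measurable_funM.
  exact: measurable_snd.
exact: measurable_fst.
Qed.

Let mcos s : measurable_fun setT (fun z : R * R => cos (s * (z.2 * z.1))).
Proof.
by apply: measurableT_comp (measurable_phase s);
   apply: continuous_measurable_fun; exact: continuous_cos.
Qed.

Let msin s : measurable_fun setT (fun z : R * R => sin (s * (z.2 * z.1))).
Proof.
by apply: measurableT_comp (measurable_phase s);
   apply: continuous_measurable_fun; exact: continuous_sin.
Qed.

Let cos1 s (z : R * R) : `|cos (s * (z.2 * z.1)) : R| <= 1.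
Proof. by rewrite ler_norml cos_geN1 cos_le1. Qed.

Let sin1 s (z : R * R) : `|sin (s * (z.2 * z.1)) : R| <= 1.
Proof. by rewrite ler_norml sin_geN1 sin_le1. Qed.

Lemma signed_fourier_real s b p : signed_fourier s (fun x => (b x)%:C) p =
  (\int[mu]_y (b y * cos (s * (y * p)))) +i* (\int[mu]_y (b y * sin (s * (y * p)))).
Proof.
apply: complexP => /=; apply: eq_Rintegral => y _; rewrite ?Re_mul ?Im_mul /=.
  by rewrite mul0r subr0.
by rewrite mul0r addr0.
Qed.

Let real_pairing a b s : mu.-integrable setT (EFin \o a) -> mu.-integrable setT (EFin \o b) ->
  let A x := (a x)%:C in let B x := (b x)%:C in
  cintegrable (fun x => A x * signed_fourier s B x) /\
  cintegral (fun x => A x * signed_fourier s B x) =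
  cintegral (fun y => B y * signed_fourier s A y).
Proof.
move=> ia ib; cbv zeta.
have RE c d x : complex.Re ((c x)%:C * signed_fourier s (fun y => (d y)%:C) x) =
    c x * \int[mu]_y (d y * cos (s * (y * x))).
  by rewrite signed_fourier_real Re_mul /= mul0r subr0.
have IE c d x : complex.Im ((c x)%:C * signed_fourier s (fun y => (d y)%:C) x) =
    c x * \int[mu]_y (d y * sin (s * (y * x))).
  by rewrite signed_fourier_real Im_mul /= mul0r addr0.
split.
  split.
    under eq_fun do rewrite RE.
    exact: (integrable_fubini_real ia ib (mcos s) (cos1 s)).
  under eq_fun do rewrite IE.
  exact: (integrable_fubini_real ia ib (msin s) (sin1 s)).
have reP c d : complex.Re (cintegral (fun x => (c x)%:C * signed_fourier s (fun y => (d y)%:C) x))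
    = \int[mu]_x (c x * \int[mu]_y (d y * cos (s * (y * x)))).
  by apply: eq_Rintegral => x _; exact: RE.
have imP c d : complex.Im (cintegral (fun x => (c x)%:C * signed_fourier s (fun y => (d y)%:C) x))
    = \int[mu]_x (c x * \int[mu]_y (d y * sin (s * (y * x)))).
  by apply: eq_Rintegral => x _; exact: IE.
apply: complexP.
  have fr := fubini_real ia ib (mcos s) (cos1 s).
  apply: etrans (reP a b) _.
  apply: etrans _ (esym (reP b a)).
  apply: (etrans fr).
  by apply: eq_Rintegral => y _; congr (_ * _); apply: eq_Rintegral => x _; rewrite (mulrC y x).
have fr := fubini_real ia ib (msin s) (sin1 s).
apply: etrans (imP a b) _.
apply: etrans _ (esym (imP b a)).
apply: (etrans fr).
by apply: eq_Rintegral => y _; congr (_ * _); apply: eq_Rintegral => x _; rewrite (mulrC y x).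
Qed.

(** An interchange of integrals, reduced to real functions by bilinearity. *)
Lemma fourier_pairing s g h : cintegrable g -> cintegrable h ->
  cintegral (fun x => g x * signed_fourier s h x) =
  cintegral (fun y => h y * signed_fourier s g y).
Proof.
move=> ig ih; have [gr gi] := ig; have [hr hi] := ih.
pose re (u : R -> R[i]) (x : R) : R[i] := (complex.Re (u x))%:C.
pose im (u : R -> R[i]) (x : R) : R[i] := (complex.Im (u x))%:C.
have dec u x : u x = re u x + 'i%C * im u x.
  by apply: complexP; rewrite !ReImE /=; ring.
have ire u : cintegrable u -> cintegrable (re u).
  by move=> [ur _]; split => //; exact: integrable0.
have iim u : cintegrable u -> cintegrable (im u).
  by move=> [_ ui]; split => //; exact: integrable0.
have [irr err] := real_pairing s gr hr; have [iri eri] := real_pairing s gr hi.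
have [iir eir] := real_pairing s gi hr; have [iii eii] := real_pairing s gi hi.
have [irr' _] := real_pairing s hr gr; have [iri' _] := real_pairing s hr gi.
have [iir' _] := real_pairing s hi gr; have [iii' _] := real_pairing s hi gi.
have fdec u p : cintegrable u -> signed_fourier s u p =
    signed_fourier s (re u) p + 'i%C * signed_fourier s (im u) p.
  move=> iu; have uE : u = fun x => re u x + 'i%C * im u x by apply/funext.
  rewrite [in LHS]uE (signed_fourierD s (ire _ iu) (cintegrableZ 'i%C (iim _ iu))).
  by rewrite (signed_fourierZ s 'i%C (iim _ iu)).
have expand u v : cintegrable u -> cintegrable v ->
  cintegrable (fun x => re u x * signed_fourier s (re v) x) ->
  cintegrable (fun x => re u x * signed_fourier s (im v) x) ->
  cintegrable (fun x => im u x * signed_fourier s (re v) x) ->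
  cintegrable (fun x => im u x * signed_fourier s (im v) x) ->
  cintegral (fun x => u x * signed_fourier s v x) =
    cintegral (fun x => re u x * signed_fourier s (re v) x) +
    'i%C * cintegral (fun x => re u x * signed_fourier s (im v) x) +
    'i%C * cintegral (fun x => im u x * signed_fourier s (re v) x) +
    ('i%C * 'i%C) * cintegral (fun x => im u x * signed_fourier s (im v) x).
  move=> iu iv i1 i2 i3 i4.
  have j2 := cintegrableZ 'i%C i2; have j3 := cintegrableZ 'i%C i3.
  have j4 := cintegrableZ ('i%C * 'i%C) i4.
  have j12 := cintegrableD i1 j2; have j123 := cintegrableD j12 j3.
  have -> : (fun x => u x * signed_fourier s v x) = (fun x =>
      ((re u x * signed_fourier s (re v) x + 'i%C * (re u x * signed_fourier s (im v) x)) +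
      'i%C * (im u x * signed_fourier s (re v) x)) +
      'i%C * 'i%C * (im u x * signed_fourier s (im v) x)).
    apply/funext => x; rewrite (fdec v x iv) {1}(dec u x).
    move: (re u x) (im u x) (signed_fourier s (re v) x) (signed_fourier s (im v) x) => A B C D.
    by ring.
  apply: etrans (cintegralD j123 j4) _; congr (_ + _); last exact: cintegralZ i4.
  apply: etrans (cintegralD j12 j3) _; congr (_ + _); last exact: cintegralZ i3.
  apply: etrans (cintegralD i1 j2) _; congr (_ + _); exact: cintegralZ i2.
apply: etrans (expand g h ig ih irr iri iir iii) _.
apply: etrans _ (esym (expand h g ih ig irr' iri' iir' iii')).
have swap (z1 z2 z3 z4 w1 w2 w3 w4 : R[i]) : z1 = w1 -> z2 = w3 -> z3 = w2 -> z4 = w4 ->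
    z1 + 'i%C * z2 + 'i%C * z3 + 'i%C * 'i%C * z4 =
    w1 + 'i%C * w2 + 'i%C * w3 + 'i%C * 'i%C * w4.
  by move=> -> -> -> ->; ring.
exact: swap err eri eir eii.
Qed.

(** * Increments of primitives *)

(** The difference of the two primitives is continuous with derivative zero
    inside. The endpoints may be points where [g] jumps. *)
Lemma cprimitive_increment g H (x y : R) : x <= y -> cintegrable g ->
  ccontinuous_on x y H ->
  (forall p, x < p < y -> ccontinuous_at g p) ->
  (forall p, x < p < y -> cis_derive H p (g p)) ->
  cprimitive g y - cprimitive g x = H y - H x.
Proof.
move=> xy ig cH cg dH.
pose T p := cprimitive g p - H p.
have cT : ccontinuous_on x y T.
  move=> p pxy e e0; have e20 : 0 < e / 2 by rewrite divr_gt0.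
  have [d1 d10 h1] := (@cprimitive_continuous _ g p ig) _ e20.
  have [d2 d20 h2] := cH p pxy _ e20.
  exists (Num.min d1 d2); first by rewrite lt_min d10.
  move=> q qxy; rewrite lt_min => /andP[/h1 hq1 /(h2 q qxy) hq2].
  rewrite /T (_ : _ - _ = (cprimitive g q - cprimitive g p) - (H q - H p)); last by ring.
  by have := normcD (cprimitive g q - cprimitive g p) (- (H q - H p)); rewrite normcN; lra.
have : N (T y - T x) <= 0.
  have := @mean_value_le R x y T (fun=> 0) (fun=> 0) (fun=> 0) (fun=> 0) xy cT.
  rewrite Rintegral_cst// mul0r subrr addr0; apply => //.
  - move=> p pxy; apply: cis_derive_eq (cis_deriveB
      (cprimitive_derive ig (cg p pxy)) (dH p pxy)) _; exact: subrr.
  - exact: integrable0.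
  - by move=> p _; rewrite normc0 ?addr0.
move=> T0; have /normc_eq0 : N (T y - T x) = 0.
  by apply/eqP; rewrite eq_le T0 normc_ge0.
rewrite /T => h; apply/eqP; rewrite -subr_eq0; apply/eqP; rewrite -h; ring.
Qed.

Lemma ccvgD (u v : nat -> R[i]) (z w : R[i]) : ccvg u z -> ccvg v w ->
  ccvg (fun n => u n + v n) (z + w).
Proof.
move=> hu hv e e0; have e20 : 0 < e / 2 by rewrite divr_gt0.
near=> n; rewrite (_ : _ - _ = (u n - z) + (v n - w)); last by ring.
apply: le_trans (normcD _ _) _; rewrite [e in leRHS]splitr lerD//; near: n.
  exact: hu.
exact: hv.
Unshelve. all: by end_near. Qed.

Lemma ccvgZ (c : R[i]) (u : nat -> R[i]) (z : R[i]) : ccvg u z ->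
  ccvg (fun n => c * u n) (c * z).
Proof.
move=> hu e e0; have c0 : 0 < N c + 1 by rewrite ltr_wpDl ?normc_ge0.
have e1 : 0 < e / (N c + 1) by rewrite divr_gt0.
near=> n; rewrite -mulrBr Normc.normcM.
apply: (@le_trans _ _ ((N c + 1) * (e / (N c + 1)))).
  rewrite ler_pM ?normc_ge0//; first by rewrite lerDl.
  by near: n; exact: hu.
by rewrite mulrC divfK// gt_eqF.
Unshelve. all: by end_near. Qed.

Lemma ccvg_cst (z : R[i]) : ccvg (fun=> z) z.
Proof. by move=> e e0; apply: nearW => n; rewrite subrr normc0 ltW. Qed.

(** One integrable weight that dominates all Schwartz functions. *)
Definition cauchy_weight x : R := (1 + x ^+ 2)^-1.

Lemma cauchy_weight_gt0 x : 0 < cauchy_weight x.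
Proof. by rewrite invr_gt0 ltr_pwDl ?sqr_ge0. Qed.

Lemma integrable_cauchy_weight : mu.-integrable setT (EFin \o cauchy_weight).
Proof.
have c : continuous cauchy_weight := @continuous_oneDsqrV R.
apply/integrableP; split.
  by apply/measurable_EFinP; exact: continuous_measurable_fun.
under eq_integral do rewrite /= ger0_norm ?(ltW (cauchy_weight_gt0 _))//.
rewrite ge0_symfun_integralT//.
- have -> : [set x : R | 0 <= x] = `[0, +oo[.
    by apply/seteqP; split => x /=; rewrite in_itv /= andbT.
  by rewrite integral0y_oneDsqr -EFinM ltry.
- by move=> x; rewrite ltW ?cauchy_weight_gt0.
- by move=> x; rewrite /cauchy_weight /= sqrrN.
Qed.

Lemma cauchy_weight_cvg0 (M e : R) : 0 < e ->
  \forall n \near \oo, M * cauchy_weight n%:R <= e.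
Proof.
move=> e0; near=> n.
have n1 : 1 <= n%:R :> R by near: n; exact: nbhs_infty_ger.
have nM : `|M| / e <= n%:R by near: n; exact: nbhs_infty_ger.
rewrite /cauchy_weight ler_pdivrMr ?ltr_pwDl ?sqr_ge0//.
apply: le_trans (ler_norm _) _; move: nM; rewrite ler_pdivrMr// mulrC => /le_trans; apply.
rewrite ler_wpM2l ?(ltW e0)// expr2.
have : n%:R * 1 <= n%:R * n%:R :> R by rewrite ler_wpM2l.
by lra.
Unshelve. all: by end_near. Qed.

Lemma ccvg_decay H (M : R) : (forall x, N (H x) <= M * cauchy_weight x) ->
  ccvg (fun n => H n%:R) 0 /\ ccvg (fun n => H (- n%:R)) 0.
Proof.
move=> hM; split => e e0; near=> n; rewrite subr0; apply: le_trans (hM _) _.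
  by near: n; exact: cauchy_weight_cvg0.
rewrite /cauchy_weight sqrrN -/(cauchy_weight _).
by near: n; exact: cauchy_weight_cvg0.
Unshelve. all: by end_near. Qed.

Lemma cintegral_derivative g H (M : R) : (forall p, cis_derive H p (g p)) ->
  cintegrable g -> (forall p, ccontinuous_at g p) ->
  (forall x, N (H x) <= M * cauchy_weight x) -> cintegral g = 0.
Proof.
move=> dH ig cg /ccvg_decay[h1 h2].
apply: ccvg_unique (cprimitive_cvg ig) _.
have -> : (fun n => cprimitive g n%:R - cprimitive g (- n%:R)) =
    (fun n => H n%:R + (-1) * H (- n%:R)).
  apply/funext => n; rewrite mulN1r; apply: cprimitive_increment => //.
    by rewrite (@le_trans _ _ 0) ?oppr_le0.
  by apply: ccontinuous_on_at => p _; exact: cis_derive_continuous (dH p).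
by have := ccvgD h1 (ccvgZ (-1) h2); rewrite mulr0 addr0.
Qed.

End FubiniAndPrimitives.

(** * The Fourier transform on Schwartz functions *)

Section FourierSchwartz.
Context {R : realType}.
Implicit Types (x y p q z s : R) (g phi : R -> R[i]).
Local Notation N := (@Normc.normc R).
Local Notation mu := (@lebesgue_measure R).

Lemma normc_realB x y : N (x%:C - y%:C) = `|x - y|.
Proof. by rewrite normcE_sqrt !ReImE /= subrr expr0n addr0 sqrtr_sqr. Qed.

Lemma ccontinuous_atM g phi x : ccontinuous_at g x -> ccontinuous_at phi x ->
  ccontinuous_at (fun y => g y * phi y) x.
Proof.
move=> /ccontinuous_atP[gr gi] /ccontinuous_atP[hr hi]; apply/ccontinuous_atP; split.
  rewrite (_ : (fun y => _) = fun y => complex.Re (g y) * complex.Re (phi y) -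
    complex.Im (g y) * complex.Im (phi y)); last by apply/funext => y; rewrite Re_mul.
  by apply: cvgB; apply: cvgM.
rewrite (_ : (fun y => _) = fun y => complex.Re (g y) * complex.Im (phi y) +
  complex.Im (g y) * complex.Re (phi y)); last by apply/funext => y; rewrite Im_mul.
by apply: cvgD; apply: cvgM.
Qed.

Lemma ccontinuous_atD g phi x : ccontinuous_at g x -> ccontinuous_at phi x ->
  ccontinuous_at (fun y => g y + phi y) x.
Proof.
move=> /ccontinuous_atP[gr gi] /ccontinuous_atP[hr hi]; apply/ccontinuous_atP; split.
  rewrite (_ : (fun y => _) = fun y => complex.Re (g y) + complex.Re (phi y)).
    exact: cvgD.
  by apply/funext => y; rewrite Re_add.
rewrite (_ : (fun y => _) = fun y => complex.Im (g y) + complex.Im (phi y)).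
  exact: cvgD.
by apply/funext => y; rewrite Im_add.
Qed.

Lemma ccontinuous_at_real (h : R -> R) x : {for x, continuous h} ->
  ccontinuous_at (fun y => (h y)%:C) x.
Proof. by move=> hx; apply/ccontinuous_atP; split => //=; exact: cvg_cst. Qed.

Lemma cdifferentiable_continuous g x : cdifferentiable g -> ccontinuous_at g x.
Proof. by move=> /cis_deriveP /(_ x); exact: cis_derive_continuous. Qed.

Lemma rapidly_decreasing_cauchy (I : Type) (G : I -> R -> R[i]) :
  rapidly_decreasing G ->
  exists M, 0 <= M /\ forall i x, N (G i x) <= M * cauchy_weight x.
Proof.
move=> hG; have [M0 h0] := hG 0%N; have [M2 h2] := hG 2%N.
exists `|M0 + M2|; split => // i x.
rewrite /cauchy_weight ler_pdivlMr ?ltr_pwDl ?sqr_ge0//.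
apply: le_trans (ler_norm _); have := h0 i x; have := h2 i x.
by rewrite expr0 mul1r real_normK ?num_real// mulrDr mulr1 mulrC; lra.
Qed.

Lemma decay_integrable g M : (forall x, ccontinuous_at g x) ->
  (forall x, N (g x) <= M * cauchy_weight x) -> cintegrable g.
Proof.
move=> cg hM; apply: cintegrable_le hM; first exact: cmeasurable_continuous.
exact: integrable_scale integrable_cauchy_weight.
Qed.

Lemma signed_fourier_bound s g M p : (forall x, ccontinuous_at g x) ->
  (forall x, N (g x) <= M * cauchy_weight x) ->
  N (signed_fourier s g p) <= 2 * (\int[mu]_x (M * cauchy_weight x)).
Proof.
move=> cg hM; apply: cintegral_bound.
- by apply: cmeasurableM; [exact: cmeasurable_continuous|exact: cmeasurable_expi].
- exact: integrable_scale integrable_cauchy_weight.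
- by move=> x; rewrite Normc.normcM normc_expi mulr1.
Qed.

(** The second-order Taylor remainder of the exponential is at most the square of
    the increment times [x^2], which is integrable against [g]. *)
Lemma signed_fourier_is_derive s g M p : (forall x, ccontinuous_at g x) ->
  (forall x, N (g x) * (1 + x ^+ 2) <= M * cauchy_weight x) ->
  cis_derive (signed_fourier s g) p
    (signed_fourier s (fun x => 'i%C * s%:C * (x%:C * g x)) p).
Proof.
move=> cg hM.
have w0 := @cauchy_weight_gt0 R.
have hg x : N (g x) <= M * cauchy_weight x.
  apply: le_trans (hM x); rewrite mulrDr mulr1 lerDl.
  by rewrite mulr_ge0 ?normc_ge0 ?sqr_ge0.
have hxg x : `|x| * N (g x) <= M * cauchy_weight x.
  apply: le_trans (hM x); rewrite mulrC ler_wpM2l ?normc_ge0//.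
  have := sqr_ge0 (`|x| - 1); rewrite sqrrB1 real_normK ?num_real//.
  by have := sqr_ge0 x; have := normr_ge0 x; nra.
have hx2g x : x ^+ 2 * N (g x) <= M * cauchy_weight x.
  by apply: le_trans (hM x); rewrite mulrC mulrDr mulr1 lerDr normc_ge0.
have ig := decay_integrable cg hg.
have cxg x : ccontinuous_at (fun y => y%:C * g y) x.
  by apply: ccontinuous_atM => //; apply: ccontinuous_at_real; exact: cvg_id.
have ixg : cintegrable (fun x => x%:C * g x).
  by apply: (decay_integrable cxg (M := M)) => x; rewrite Normc.normcM normc_real.
have ig' := cintegrableZ ('i%C * s%:C) ixg.
pose C := 8 * s ^+ 2 * (\int[mu]_x (M * cauchy_weight x)).
have M0 : 0 <= M.
  have := hg 0; rewrite /cauchy_weight expr0n addr0 invr1 mulr1.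
  exact: le_trans (normc_ge0 _).
have C0 : 0 <= C.
  apply: mulr_ge0; first by rewrite mulr_ge0 ?sqr_ge0.
  by apply: Rintegral_ge0 => x _; rewrite mulr_ge0// ltW.
have key q : N (signed_fourier s g q - signed_fourier s g p - (q - p)%:C *
    signed_fourier s (fun x => 'i%C * s%:C * (x%:C * g x)) p) <= C * (q - p) ^+ 2.
  rewrite /signed_fourier -cintegralZ; last exact: cintegrable_fourier.
  rewrite -cintegralB; [|exact: cintegrable_fourier..].
  rewrite -cintegralB; last 2 first.
  - by apply: cintegrableB; exact: cintegrable_fourier.
  - by apply: cintegrableZ; exact: cintegrable_fourier.
  pose k x := 4 * s ^+ 2 * (q - p) ^+ 2 * (M * cauchy_weight x).
  have ik : mu.-integrable setT (EFin \o k).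
    by apply: integrable_scale; exact: integrable_scale integrable_cauchy_weight.
  have -> : C * (q - p) ^+ 2 = 2 * (\int[mu]_x k x).
    rewrite /k RintegralZl//; last exact: integrable_scale integrable_cauchy_weight.
    by rewrite /C; ring.
  have E x : g x * expi (s * (x * q)) - g x * expi (s * (x * p)) -
      (q - p)%:C * ('i%C * s%:C * (x%:C * g x) * expi (s * (x * p))) =
      g x * expi (s * (x * p)) * (expi (s * x * (q - p)) - 1 - 'i%C * (s * x * (q - p))%:C).
    rewrite (_ : s * (x * q) = s * (x * p) + s * x * (q - p)); last by ring.
    by rewrite expiD !rmorphM /=; ring.
  apply: cintegral_bound ik _.
    apply: cintegrable_measurable; apply: cintegrableB.
      by apply: cintegrableB; exact: cintegrable_fourier.
    by apply: cintegrableZ; exact: cintegrable_fourier.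
  move=> x; rewrite E !Normc.normcM normc_expi mulr1.
  apply: (@le_trans _ _ (N (g x) * (4 * (s * x * (q - p)) ^+ 2))).
    by rewrite ler_wpM2l ?normc_ge0 ?normc_expi_taylor2.
  rewrite [leLHS](_ : _ = 4 * s ^+ 2 * (q - p) ^+ 2 * (x ^+ 2 * N (g x))); last by ring.
  apply: ler_wpM2l; last exact: hx2g.
  by apply: mulr_ge0; [apply: mulr_ge0|]; rewrite ?sqr_ge0.
apply: expansion_cis_derive => e e0.
have C1 : 0 < C + 1 by rewrite ltr_wpDl.
exists (e / (C + 1)); first by rewrite divr_gt0.
move=> q qd; apply: le_trans (key q) _.
rewrite -real_normK ?num_real// expr2 mulrA ler_wpM2r//.
apply: (@le_trans _ _ ((C + 1) * `|q - p|)); first by rewrite ler_wpM2r// lerDl.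
by rewrite mulrC -ler_pdivlMr// ltW.
Qed.

Lemma signed_fourier_of_derivative s g M p : cdifferentiable g ->
  (forall x, ccontinuous_at (cderiv g) x) ->
  (forall x, N (g x) <= M * cauchy_weight x) ->
  (forall x, N (cderiv g x) <= M * cauchy_weight x) ->
  signed_fourier s (cderiv g) p = - ('i%C * (s * p)%:C) * signed_fourier s g p.
Proof.
move=> dg cg' hg hg'.
have cg x := cdifferentiable_continuous x dg.
have ig := decay_integrable cg hg; have ig' := decay_integrable cg' hg'.
have de x : cis_derive (fun y => expi (s * (y * p))) x ('i%C * (s * p)%:C * expi (s * (x * p))).
  apply: cis_derive_expi; apply: is_derive_eq (is_deriveM (is_derive_cst s x 1)
    (is_deriveM (is_derive_id x 1) (is_derive_cst p x 1))) _.
  by rewrite /GRing.scale /= !mulr0 addr0 add0r mulr1.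
have ce x := cis_derive_continuous (de x).
have : cintegral (fun x => cderiv g x * expi (s * (x * p)) +
    g x * ('i%C * (s * p)%:C * expi (s * (x * p)))) = 0.
  apply: (cintegral_derivative (H := fun x => g x * expi (s * (x * p))) (M := M)).
  - by move=> x; apply: cis_deriveM (de x); exact: (cis_deriveP _).1.
  - apply: cintegrableD; first exact: cintegrable_fourier.
    under eq_fun do rewrite mulrCA.
    by apply: cintegrableZ; exact: cintegrable_fourier.
  - move=> x; apply: ccontinuous_atD; first exact: ccontinuous_atM.
    apply: ccontinuous_atM => //; apply: ccontinuous_atM => //.
    by move=> e e0; exists 1 => // y _; rewrite subrr normc0 ltW.
  - by move=> x; rewrite Normc.normcM normc_expi mulr1.
under eq_fun do rewrite (mulrCA (g _)).
rewrite cintegralD; last 2 first.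
- exact: cintegrable_fourier.
- by apply: cintegrableZ; exact: cintegrable_fourier.
rewrite cintegralZ; last exact: cintegrable_fourier.
by rewrite -/(signed_fourier s (cderiv g) p) -/(signed_fourier s g p) mulNr => /eqP;
  rewrite addr_eq0 => /eqP.
Qed.

Lemma schwartz_family_cauchy (I : Type) (G : I -> R -> R[i]) : schwartz_family G ->
  exists M, 0 <= M /\ forall i x, N (G i x) <= M * cauchy_weight x.
Proof. by move=> /schwartz_family_rapid; exact: rapidly_decreasing_cauchy. Qed.

Lemma schwartz_family_continuous (I : Type) (G : I -> R -> R[i]) i x :
  schwartz_family G -> ccontinuous_at (G i) x.
Proof. by move=> hG; apply: cdifferentiable_continuous; exact: schwartz_family_differentiable. Qed.

Lemma schwartz_family_integrable (I : Type) (G : I -> R -> R[i]) i :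
  schwartz_family G -> cintegrable (G i).
Proof.
move=> hG; have [M [_ hM]] := schwartz_family_cauchy hG.
by apply: (decay_integrable _ (hM i)) => x; exact: schwartz_family_continuous.
Qed.

Lemma schwartz_family_scale (I : Type) (G : I -> R -> R[i]) (c : R[i]) : schwartz_family G ->
  schwartz_family (fun i x => c * G i x).
Proof. by apply: schwartz_familyM; apply: (multiplier_family_cst (C := N c)). Qed.

Lemma schwartz_family_moment (I : Type) (G : I -> R -> R[i]) : schwartz_family G ->
  schwartz_family (fun i x => x%:C * G i x).
Proof. by apply: schwartz_familyM; exact: multiplier_family_id. Qed.

Lemma signed_fourier_family_derive (I : Type) (G : I -> R -> R[i]) s i p : schwartz_family G ->
  cis_derive (signed_fourier s (G i)) p
    (signed_fourier s (fun x => 'i%C * s%:C * (x%:C * G i x)) p).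
Proof.
move=> hG; have hG2 := schwartz_family_moment (schwartz_family_moment hG).
have [M [_ hM]] := schwartz_family_cauchy (schwartz_familyD hG hG2).
apply: (@signed_fourier_is_derive s (G i) M p).
  by move=> x; exact: schwartz_family_continuous.
move=> x; apply: le_trans (hM i x).
rewrite (_ : G i x + _ = (1 + x ^+ 2)%:C * G i x).
  by rewrite Normc.normcM normc_real ger0_norm ?addr_ge0 ?sqr_ge0// mulrC.
by rewrite rmorphD /= rmorphXn /= rmorph1; ring.
Qed.

(** The Fourier transform exchanges derivation and multiplication by the
    variable, so it maps bounded families to bounded families. *)
Lemma schwartz_family_fourier (I : Type) (G : I -> R -> R[i]) s : unit_sign s ->
  schwartz_family G -> schwartz_family (fun i => signed_fourier s (G i)).
Proof.
move=> hs hG n.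
have rd (H : I -> R -> R[i]) : schwartz_family H ->
    rapidly_decreasing (fun i => signed_fourier s (H i)).
  move=> hH k; elim: k H hH => [|k IH] H hH.
    have [M [_ hM]] := schwartz_family_cauchy hH.
    exists (2 * (\int[mu]_x (M * cauchy_weight x))) => i p.
    rewrite expr0 mul1r; apply: signed_fourier_bound => // x.
    exact: schwartz_family_continuous.
  have hH' := schwartz_family_deriv hH.
  have [B hB] := IH _ hH'; exists B => i p; apply: le_trans (hB i p).
  have [M1 [M10 h1]] := schwartz_family_cauchy hH.
  have [M2 [M20 h2]] := schwartz_family_cauchy hH'.
  have w0 := @cauchy_weight_gt0 R.
  rewrite (@signed_fourier_of_derivative s (H i) (M1 + M2)).
  - rewrite Normc.normcM normcN Normc.normcM normc_i mul1r normc_real normrM.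
    have -> : `|s| = 1 by case: hs => ->; rewrite ?normrN normr1.
    by rewrite mul1r exprSr mulrA.
  - exact: schwartz_family_differentiable.
  - by move=> x; exact: (schwartz_family_continuous _ _ hH').
  - by move=> x; apply: le_trans (h1 i x) _; rewrite ler_wpM2r ?(ltW (w0 x))// lerDl.
  - by move=> x; apply: le_trans (h2 i x) _; rewrite ler_wpM2r ?(ltW (w0 x))// lerDr.
elim: n G hG => [|n IH] G hG.
  split => //; last exact: rd.
  move=> i; exact: (cis_derive_cdifferentiable (fun p => signed_fourier_family_derive s i p hG)).1.
apply: smooth_familyS (fun i p => signed_fourier_family_derive s i p hG) (rd _ hG) _.
by apply: IH; apply: schwartz_family_scale; exact: schwartz_family_moment.
Qed.

(** * Fourier inversion *)

Lemma expR_abel_le ep p : 0 < ep <= 1 ->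
  expR (- (ep * `|p|)) <= 4 / ep ^+ 2 * cauchy_weight p.
Proof.
move=> /andP[ep0 ep1]; pose y := ep * `|p| / 2.
have y0 : 0 <= y by rewrite divr_ge0 ?mulr_ge0 ?(ltW ep0).
have e2 : 0 < ep ^+ 2 by rewrite exprn_gt0.
have -> : - (ep * `|p|) = - (y + y) by rewrite /y; field.
have -> : 4 / ep ^+ 2 * cauchy_weight p = (ep ^+ 2 / 4 * (1 + p ^+ 2))^-1.
  by rewrite /cauchy_weight; field; rewrite !gt_eqF// ltr_pwDl ?sqr_ge0.
rewrite expRN expRD lef_pV2 ?posrE; last 2 first.
- by rewrite mulr_gt0 ?expR_gt0.
- by apply: mulr_gt0; [exact: divr_gt0|rewrite ltr_pwDl ?sqr_ge0].
apply: (@le_trans _ _ ((1 + y) * (1 + y))); last first.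
  by rewrite ler_pM ?addr_ge0 ?expR_ge1Dx.
have -> : ep ^+ 2 / 4 * (1 + p ^+ 2) = ep ^+ 2 / 4 + y * y.
  by rewrite /y -[p ^+ 2]real_normK ?num_real//; field.
have : ep ^+ 2 <= 1 by rewrite exprn_ile1 ?(ltW ep0).
by lra.
Qed.

Let expR_derive (c : R) p : is_derive p 1 (fun q => expR (c * q)) (c * expR (c * p)).
Proof.
have d1 : is_derive p 1 (fun q : R => c * q) c.
  apply: is_derive_eq (is_deriveM (is_derive_cst c p 1) (is_derive_id p 1)) _.
  by rewrite /GRing.scale /= mulr0 addr0 mulr1.
by apply: is_derive_eq (is_derive1_comp (is_derive_expR (c * p)) d1) _; rewrite mulrC.
Qed.

Let abel_continuous ep p : {for p, continuous (fun q => expR (- (ep * `|q|)))}.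
Proof.
apply: continuous_comp; last exact: continuous_expR.
by apply: cvgN; apply: cvgM; [exact: cvg_cst|exact: norm_continuous].
Qed.

Lemma cintegrable_abel ep (h : R -> R[i]) : 0 < ep <= 1 -> cmeasurable h ->
  (forall p, N (h p) <= 1) ->
  cintegrable (fun p => (expR (- (ep * `|p|)))%:C * h p).
Proof.
move=> hep mh h1; apply: (cintegrableM (C := 1)) => //.
apply: (@decay_integrable _ (4 / ep ^+ 2)).
  by move=> p; apply: ccontinuous_at_real; exact: abel_continuous.
by move=> p; rewrite normc_real ger0_norm ?expR_ge0// expR_abel_le.
Qed.

(** On each half-line the integrand has an explicit primitive that vanishes at
    infinity; the integral is the jump between the two primitives at 0. *)
Lemma abel_kernel ep z : 0 < ep <= 1 ->
  cintegral (fun p => (expR (- (ep * `|p|)))%:C * expi (z * p)) =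
  (2 * ep / (ep ^+ 2 + z ^+ 2))%:C.
Proof.
move=> hep; have /andP[ep0 ep1] := hep.
pose g p := (expR (- (ep * `|p|)))%:C * expi (z * p).
have de p : cis_derive (fun q => expi (z * q)) p ('i%C * z%:C * expi (z * p)).
  apply: cis_derive_expi.
  apply: is_derive_eq (is_deriveM (is_derive_cst z p 1) (is_derive_id p 1)) _.
  by rewrite /GRing.scale /= mulr0 addr0 mulr1.
have ig : cintegrable g.
  apply: cintegrable_abel => //; last by move=> p; rewrite normc_expi.
  by apply: cmeasurable_continuous => p; exact: cis_derive_continuous (de p).
pose D := ep ^+ 2 + z ^+ 2.
have D0 : 0 < D by rewrite ltr_pwDl ?exprn_gt0 ?sqr_ge0.
pose G c p : R[i] := (expR (c * p))%:C * expi (z * p).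
pose H c p : R[i] := (c / D -i* (z / D)) * G c p.
have dG c p : cis_derive (G c) p ((c +i* z) * G c p).
  apply: cis_derive_eq (cis_deriveM (cis_derive_real (expR_derive c p)) (de p)) _.
  by rewrite /G; apply: complexP; rewrite !ReImE /=; ring.
have dH c p : c ^+ 2 = ep ^+ 2 -> cis_derive (H c) p (G c p).
  move=> c2; apply: cis_derive_eq (cis_deriveZ _ (dG c p)) _.
  rewrite mulrA (_ : _ * (c +i* z) = 1) ?mul1r//.
  apply: complexP; rewrite !ReImE /=; last by field; rewrite gt_eqF.
  have -> : c / D * c - - (z / D) * z = (c ^+ 2 + z ^+ 2) / D by field; rewrite gt_eqF.
  by rewrite c2 divff// gt_eqF.
have incr c a b : a <= b -> c ^+ 2 = ep ^+ 2 ->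
    (forall p, a < p < b -> 0 < `|p| /\ forall q, `|q - p| < `|p| -> g q = G c q) ->
    cprimitive g b - cprimitive g a = H c b - H c a.
  move=> ab c2 hg; apply: cprimitive_increment => //.
  - by apply: ccontinuous_on_at => p _; exact: cis_derive_continuous (dH c p c2).
  - move=> p /hg[p0 gG]; apply: (ccontinuous_at_near p0 gG).
    exact: cis_derive_continuous (dG c p).
  - move=> p /hg[p0 gG]; have -> : g p = G c p by apply: gG; rewrite subrr normr0.
    exact: dH.
have incr1 (n : nat) : cprimitive g n%:R - cprimitive g 0 = H (- ep) n%:R - H (- ep) 0.
  apply: incr => //; first by rewrite sqrrN.
  move=> p /andP[p0 _]; rewrite gtr0_norm//; split => // q.
  rewrite ltr_norml => /andP[h1 _]; have q0 : 0 < q by lra.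
  by rewrite /g /G gtr0_norm// mulNr.
have incr2 (n : nat) : cprimitive g 0 - cprimitive g (- n%:R) = H ep 0 - H ep (- n%:R).
  apply: incr; [by rewrite oppr_le0|by []|].
  move=> p /andP[_ p0]; rewrite ltr0_norm// oppr_gt0; split => // q.
  rewrite ltr_norml => /andP[_ h1]; have q0 : q < 0 by lra.
  by rewrite /g /G ltr0_norm// mulrN opprK.
have H0 c : H c 0 = c / D -i* (z / D).
  by rewrite /H /G !mulr0 expR0 expi0 !mulr1.
have Hle c p : c * p = - (ep * `|p|) ->
    N (H c p) <= N (c / D -i* (z / D)) * (4 / ep ^+ 2) * cauchy_weight p.
  move=> cp; rewrite /H /G !Normc.normcM normc_expi mulr1 normc_real ger0_norm ?expR_ge0//.
  by rewrite -mulrA ler_wpM2l ?normc_ge0// cp expR_abel_le.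
have lim1 : ccvg (fun n => H (- ep) n%:R) 0.
  move=> e e0; near=> n; rewrite subr0; apply: le_trans (Hle _ _ _) _.
    by rewrite ger0_norm// mulNr.
  by near: n; exact: cauchy_weight_cvg0.
have lim2 : ccvg (fun n => H ep (- n%:R)) 0.
  move=> e e0; near=> n; rewrite subr0; apply: le_trans (Hle _ _ _) _.
    by rewrite normrN ger0_norm// mulrN.
  rewrite {1}/cauchy_weight sqrrN -/(cauchy_weight _).
  by near: n; exact: cauchy_weight_cvg0.
apply: ccvg_unique (cprimitive_cvg ig) _.
have -> : (fun n => cprimitive g n%:R - cprimitive g (- n%:R)) =
    (fun n => (H (- ep) n%:R + (-1) * H ep (- n%:R)) + (H ep 0 - H (- ep) 0)).
  apply/funext => n.
  have -> : cprimitive g n%:R - cprimitive g (- n%:R) = (cprimitive g n%:R -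
    cprimitive g 0) + (cprimitive g 0 - cprimitive g (- n%:R)) by ring.
  by rewrite incr1 incr2; ring.
have := ccvgD (ccvgD lim1 (ccvgZ (-1) lim2)) (@ccvg_cst R (H ep 0 - H (- ep) 0)).
rewrite mulr0 addr0 add0r (_ : H ep 0 - H (- ep) 0 = (2 * ep / D)%:C)//.
by rewrite !H0; apply: complexP; rewrite !ReImE /=; field; rewrite gt_eqF.
Unshelve. all: by end_near. Qed.

Lemma ccvg_near (u v : nat -> R[i]) (l : R[i]) : (\forall n \near \oo, u n = v n) ->
  ccvg u l -> ccvg v l.
Proof.
move=> uv hu e e0; near=> n.
have <- : u n = v n by near: n.
by near: n; exact: hu.
Unshelve. all: by end_near. Qed.

Lemma cmeasurable_sign x : cmeasurable (fun y => (Num.sg (y - x))%:C).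
Proof.
split => //=; apply: nondecreasing_measurable => // y w yw.
by case: (sgrP (y - x)) => h1; case: (sgrP (w - x)) => h2; lra.
Qed.

(** Both sides of [x] contribute [- phi x]. *)
Lemma integral_derivative_sign phi M x : cdifferentiable phi ->
  (forall y, ccontinuous_at (cderiv phi) y) ->
  (forall y, N (phi y) <= M * cauchy_weight y) ->
  (forall y, N (cderiv phi y) <= M * cauchy_weight y) ->
  cintegral (fun y => cderiv phi y * (Num.sg (y - x))%:C) = - 2 * phi x.
Proof.
move=> dphi cphi' hphi hphi'.
pose g y := cderiv phi y * (Num.sg (y - x))%:C.
have ig : cintegrable g.
  apply: (cintegrableM (C := 1)); first exact: decay_integrable cphi' hphi'.
    exact: cmeasurable_sign.
  move=> y; rewrite normc_real normr_sg; case: (_ == 0); rewrite ?ler01//.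
have [lim1 lim2] := ccvg_decay hphi.
have incr1 (n : nat) : x <= n%:R -> cprimitive g n%:R - cprimitive g x = phi n%:R - phi x.
  move=> xn; apply: cprimitive_increment => //.
  - by apply: ccontinuous_on_at => p _; exact: cdifferentiable_continuous.
  - move=> p /andP[xp _]; apply: (@ccontinuous_at_near _ _ (cderiv phi) _ (p - x)) => //.
      by rewrite subr_gt0.
    move=> y; rewrite ltr_norml => /andP[h _]; rewrite /g gtr0_sg ?mulr1//; lra.
  - move=> p /andP[xp _]; rewrite /g gtr0_sg ?subr_gt0// mulr1.
    exact: (cis_deriveP _).1.
have incr2 (n : nat) : - n%:R <= x ->
    cprimitive g x - cprimitive g (- n%:R) = - phi x - - phi (- n%:R).
  move=> xn; apply: (@cprimitive_increment _ g (fun y => - phi y)) => //.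
  - apply: ccontinuous_on_at => p _.
    exact: cis_derive_continuous (cis_deriveN ((cis_deriveP _).1 dphi p)).
  - move=> p /andP[_ px]; apply: (@ccontinuous_at_near _ _ (fun y => -1 * cderiv phi y) _ (x - p)).
    + by rewrite subr_gt0.
    + move=> y; rewrite ltr_norml => /andP[_ h]; rewrite /g ltr0_sg; last by lra.
      by rewrite mulrC rmorphN1.
    + apply: ccontinuous_atM => //.
      by move=> e e0; exists 1 => // y _; rewrite subrr normc0 ltW.
  - move=> p /andP[_ px]; rewrite /g ltr0_sg ?subr_lt0// rmorphN1 mulrN1.
    by apply: cis_deriveN; exact: (cis_deriveP _).1.
apply: ccvg_unique (cprimitive_cvg ig) _.
apply: (@ccvg_near (fun n => phi n%:R + phi (- n%:R) + - 2 * phi x)).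
  near=> n.
  have xn : `|x| < n%:R by near: n; exact: nbhs_infty_gtr.
  move: xn; rewrite ltr_norml => /andP[h1 h2].
  have -> : cprimitive g n%:R - cprimitive g (- n%:R) = (cprimitive g n%:R -
    cprimitive g x) + (cprimitive g x - cprimitive g (- n%:R)) by ring.
  by rewrite incr1 ?incr2 ?(ltW h1) ?(ltW h2)//; ring.
by have := ccvgD (ccvgD lim1 lim2) (@ccvg_cst R (- 2 * phi x)); rewrite !add0r.
Unshelve. all: by end_near. Qed.

Lemma atan_sign_cvg x y :
  ccvg (fun n => (2 * atan ((y - x) * n.+1%:R))%:C) (pi * Num.sg (y - x))%:C.
Proof.
have main d : 0 < d -> forall e : R, 0 < e ->
    \forall n \near \oo, `|2 * atan (d * n.+1%:R) - pi| <= e.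
  move=> d0 e e0; have e2 : 0 < e / 2 by rewrite divr_gt0.
  have /cvgrPdist_le /(_ _ e2) [A [_ hA]] := @cvgy_atan R.
  near=> n; have : `|pi / 2 - atan (d * n.+1%:R)| <= e / 2.
    apply: hA; rewrite mulrC -ltr_pdivrMr//.
    have : A / d < n%:R by near: n; exact: nbhs_infty_gtr.
    by move/lt_trans; apply; rewrite ltr_nat.
  rewrite (_ : 2 * _ - pi = - (2 * (pi / 2 - atan (d * n.+1%:R)))); last by field.
  by rewrite normrN normrM ger0_norm//; lra.
move=> e e0; have [yx|xy|->] := ltgtP y x.
- have d0 : 0 < x - y by rewrite subr_gt0.
  near=> n; rewrite normc_realB ltr0_sg ?subr_lt0//.
  rewrite (_ : _ - _ = - (2 * atan ((x - y) * n.+1%:R) - pi)).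
    by rewrite normrN; near: n; exact: main.
  by rewrite -(opprB x y) mulNr atanN; ring.
- have d0 : 0 < y - x by rewrite subr_gt0.
  near=> n; rewrite normc_realB gtr0_sg ?subr_gt0// mulr1.
  by near: n; exact: main.
- by apply: nearW => n; rewrite subrr mul0r atan0 sgr0 !mulr0 subrr normc0 ltW.
Unshelve. all: by end_near. Qed.

(** Abel summation: the transform is damped by [e^(-ep |p|)], which turns the
    double transform into a convolution with the Poisson kernel; its primitive
    is an arctangent, and an integration by parts gives the limit. *)
Lemma fourier_inversion phi s x : unit_sign s -> schwartz phi ->
  signed_fourier (- s) (signed_fourier s phi) x = (2 * pi)%:C * phi x.
Proof.
move=> hs hphi; have fphi := schwartz_family_of hphi.
have fF := schwartz_family_fourier hs fphi.
have iphi : cintegrable phi := schwartz_family_integrable tt fphi.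
have iF : cintegrable (signed_fourier s phi) := schwartz_family_integrable tt fF.
have dphi : cdifferentiable phi := schwartz_family_differentiable tt fphi.
have cphi y : ccontinuous_at phi y := cdifferentiable_continuous y dphi.
have fphi' := schwartz_family_deriv fphi.
have cphi' y : ccontinuous_at (cderiv phi) y := schwartz_family_continuous tt y fphi'.
have iphi' : cintegrable (cderiv phi) := schwartz_family_integrable tt fphi'.
have [M1 [M10 hM1]] := schwartz_family_cauchy fphi.
have [M2 [M20 hM2]] := schwartz_family_cauchy fphi'.
pose M := M1 + M2; have w0 := @cauchy_weight_gt0 R.
have hphiM y : N (phi y) <= M * cauchy_weight y.
  by apply: le_trans (hM1 tt y) _; rewrite ler_wpM2r ?(ltW (w0 _))// lerDl.
have hphiM' y : N (cderiv phi y) <= M * cauchy_weight y.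
  by apply: le_trans (hM2 tt y) _; rewrite ler_wpM2r ?(ltW (w0 _))// lerDr.
pose ep (n : nat) : R := n.+1%:R^-1.
have hep n : 0 < ep n <= 1.
  by rewrite /ep invr_gt0 ltr0n /= invf_le1 ?ltr0n// ler1n.
have mexp : cmeasurable (fun p => expi (- s * (p * x))) := cmeasurable_expi (- s) x.
pose a n p : R[i] := (expR (- (ep n * `|p|)))%:C * expi (- s * (p * x)).
have ia n : cintegrable (a n).
  by apply: cintegrable_abel => // p; rewrite normc_expi.
pose J n := cintegral (fun p => a n p * signed_fourier s phi p).
have J1 : ccvg J (signed_fourier (- s) (signed_fourier s phi) x).
  apply: (cintegral_dominated (k := fun p => N (signed_fourier s phi p))).
  - by move=> n; apply: cmeasurableM; exact: cintegrable_measurable.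
  - by apply: cmeasurableM => //; exact: cintegrable_measurable.
  - exact: cintegrable_norm.
  - move=> n p; rewrite /a !Normc.normcM normc_expi mulr1 normc_real.
    rewrite ger0_norm ?expR_ge0// ler_piMl ?normc_ge0//.
    rewrite -expR0 ler_expR oppr_le0 mulr_ge0//.
    by have /andP[/ltW] := hep n.
  - move=> p e e0; near=> n.
    rewrite /a -mulrA (mulrC (expi _)) -[X in _ - X]mul1r -mulrBl.
    rewrite !Normc.normcM normc_expi mulr1 (normc_realB _ 1).
    have yy : 0 <= ep n * `|p| by rewrite mulr_ge0//; have /andP[/ltW] := hep n.
    rewrite ler0_norm; last by rewrite subr_le0 -expR0 ler_expR oppr_le0.
    rewrite opprB; have := expR_ge1Dx (- (ep n * `|p|)) => h1.
    set F := N _; have F0 : 0 <= F := normc_ge0 _.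
    apply: (@le_trans _ _ (ep n * `|p| * F)); first by rewrite ler_wpM2r//; lra.
    rewrite (_ : ep n * _ * F = `|p| * F / n.+1%:R); last by rewrite /ep; ring.
    rewrite ler_pdivrMr ?ltr0n// [leRHS]mulrC -ler_pdivrMr//.
    have : `|p| * F / e < n%:R by near: n; exact: nbhs_infty_gtr.
    by move=> /ltW /le_trans; apply; rewrite ler_nat.
have J2 n : J n = - cintegral (fun y => cderiv phi y * (2 * atan ((y - x) * n.+1%:R))%:C).
  rewrite /J fourier_pairing//.
  have n0 : n.+1%:R != 0 :> R by rewrite pnatr_eq0.
  pose k y : R := 2 * ep n / (ep n ^+ 2 + (y - x) ^+ 2).
  have kE y : signed_fourier s (a n) y = (k y)%:C.
    rewrite /signed_fourier /k.
    have <- : (s * (y - x)) ^+ 2 = (y - x) ^+ 2.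
      by rewrite exprMn expr2 unit_sign_sqr// mul1r.
    rewrite -abel_kernel//; congr cintegral; apply/funext => p.
    rewrite /a -mulrA -expiD; congr (_ * expi _); ring.
  have at_derive y : is_derive y 1 (fun w => 2 * atan ((w - x) * n.+1%:R)) (k y).
    have d1 : is_derive y 1 (fun w : R => (w - x) * n.+1%:R) n.+1%:R.
      apply: is_derive_eq (is_deriveM (is_deriveB (is_derive_id y 1) (is_derive_cst x y 1))
        (is_derive_cst (n.+1%:R : R) y 1)) _.
      by rewrite /GRing.scale /= subr0 mulr1 mulr0 add0r.
    apply: is_derive_eq (is_deriveM (is_derive_cst (2 : R) y 1)
      (@is_derive1_comp _ _ (fun w : R => (w - x) * n.+1%:R) y _ _ (is_derive1_atan _) d1)) _.
    rewrite /GRing.scale /= mulr0 addr0 /k /ep; field.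
    have p0 : 0 < 1 + ((y - x) * n.+1%:R) ^+ 2 by rewrite ltr_pwDl ?sqr_ge0.
    rewrite !gt_eqF ?ltr0n//=.
    by move: p0; congr (0 < _); ring.
  have kc y : ccontinuous_at (fun w => (k w)%:C) y.
    apply: ccontinuous_at_real.
    apply: cvgM; first exact: cvg_cst.
    apply: cvgV.
      by rewrite gt_eqF// ltr_pwDl ?sqr_ge0// exprn_gt0//; have /andP[] := hep n.
    apply: cvgD; first exact: cvg_cst.
    by apply: cvgM; apply: cvgB; (exact: cvg_id || exact: cvg_cst).
  have atan_le y : `|2 * atan ((y - x) * n.+1%:R)| <= pi :> R.
    have := atan_gtNpi2 ((y - x) * n.+1%:R); have := atan_ltpi2 ((y - x) * n.+1%:R).
    by rewrite ler_norml => h1 h2; apply/andP; split; lra.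
  have atc y : ccontinuous_at (fun w => (2 * atan ((w - x) * n.+1%:R))%:C) y.
    exact: cis_derive_continuous (cis_derive_real (at_derive y)).
  have i1 : cintegrable (fun y => cderiv phi y * (2 * atan ((y - x) * n.+1%:R))%:C).
    apply: (cintegrableM (C := pi)) => //; first exact: cmeasurable_continuous.
    by move=> y; rewrite normc_real.
  have i2 : cintegrable (fun y => phi y * (k y)%:C).
    apply: (cintegrableM (C := 2 / ep n)) => //; first exact: cmeasurable_continuous.
    move=> y; have /andP[e0 _] := hep n; rewrite normc_real ger0_norm; last first.
      by rewrite divr_ge0 ?mulr_ge0 ?(ltW e0)// addr_ge0 ?sqr_ge0.
    rewrite /k ler_pdivrMr; last by rewrite ltr_pwDl ?exprn_gt0 ?sqr_ge0.
    rewrite mulrDr (_ : 2 / ep n * ep n ^+ 2 = 2 * ep n); last by field; rewrite gt_eqF.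
    by rewrite lerDl mulr_ge0 ?sqr_ge0 ?divr_ge0 ?(ltW e0).
  under eq_fun do rewrite kE.
  have : cintegral (fun y => cderiv phi y * (2 * atan ((y - x) * n.+1%:R))%:C +
      phi y * (k y)%:C) = 0.
    apply: (cintegral_derivative (H := fun y => phi y * (2 * atan ((y - x) * n.+1%:R))%:C)
      (M := pi * M)).
    - move=> y; apply: cis_deriveM; first exact: (cis_deriveP _).1.
      exact: cis_derive_real.
    - exact: cintegrableD.
    - by move=> y; apply: ccontinuous_atD; exact: ccontinuous_atM.
    - move=> y; rewrite Normc.normcM normc_real mulrC -mulrA ler_pM ?normc_ge0//.
  by rewrite cintegralD// => /eqP; rewrite addrC addr_eq0 => /eqP.
have J3 : ccvg J (- (pi%:C * (- 2 * phi x))).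
  rewrite (_ : J = fun n => -1 * cintegral (fun y => cderiv phi y *
    (2 * atan ((y - x) * n.+1%:R))%:C)); last by apply/funext => n; rewrite J2 mulN1r.
  rewrite -(mulN1r (pi%:C * _)).
  suff K : ccvg (fun n => cintegral (fun y => cderiv phi y *
      (2 * atan ((y - x) * n.+1%:R))%:C)) (pi%:C * (- 2 * phi x)) by exact: ccvgZ K.
  rewrite -(integral_derivative_sign x dphi cphi' hphiM hphiM').
  have msg := cmeasurable_sign x.
  have isg : cintegrable (fun y => cderiv phi y * (Num.sg (y - x))%:C).
    apply: (cintegrableM (C := 1)) => // y.
    by rewrite normc_real normr_sg; case: (_ == 0); rewrite ?ler01.
  rewrite -cintegralZ//.
  apply: (cintegral_dominated (k := fun y => pi * N (cderiv phi y))).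
  - move=> n; apply: cmeasurableM; first exact: cintegrable_measurable.
    apply: cmeasurable_continuous => y; apply: ccontinuous_at_real.
    apply: cvgM; first exact: cvg_cst.
    apply: continuous_comp; last exact: continuous_atan.
    by apply: cvgM; [apply: cvgB; [exact: cvg_id|exact: cvg_cst]|exact: cvg_cst].
  - by apply: cintegrable_measurable; exact: cintegrableZ.
  - by apply: integrable_scale; exact: cintegrable_norm.
  - move=> n y; rewrite Normc.normcM normc_real mulrC ler_wpM2r ?normc_ge0//.
    have := atan_gtNpi2 ((y - x) * n.+1%:R); have := atan_ltpi2 ((y - x) * n.+1%:R).
    by rewrite ler_norml => h1 h2; apply/andP; split; lra.
  - move=> y; have := ccvgZ (cderiv phi y) (atan_sign_cvg x y).
    by rewrite rmorphM /= mulrCA.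
rewrite (ccvg_unique J1 J3) rmorphM /=; rewrite -[(2 : R)%:C]/(2%:R%:C) rmorph_nat; ring.
Unshelve. all: by end_near. Qed.

End FourierSchwartz.

(** * Uniqueness for the evolution equation *)

Section Evolution.
Context {R : realType}.
Implicit Types (x y p q s t : R) (phi psi : R -> R[i]).
Local Notation N := (@Normc.normc R).

Lemma fourierE phi : fourier phi = signed_fourier (-1) phi.
Proof.
apply/funext => p; rewrite /fourier /signed_fourier; congr cintegral.
by apply/funext => x; rewrite mulN1r.
Qed.

Lemma inv_fourierE phi :
  inv_fourier phi = (fun x => ((2 * pi)^-1)%:C * signed_fourier 1 phi x).
Proof.
apply/funext => x; rewrite /inv_fourier /signed_fourier; congr (_ * cintegral _).
by apply/funext => p; rewrite mul1r (mulrC x).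
Qed.

Let ul : unit_sign (-1 : R). Proof. by right. Qed.
Let ur : unit_sign (1 : R). Proof. by left. Qed.

Let pi2 : ((2 * pi)^-1)%:C * (2 * pi)%:C = 1 :> R[i].
Proof. by rewrite -rmorphM /= mulVf// gt_eqF// mulr_gt0// pi_gt0. Qed.

Lemma schwartz_family_fourier_transform (I : Type) (G : I -> R -> R[i]) : schwartz_family G ->
  schwartz_family (fun i => fourier (G i)).
Proof.
by move=> hG; under eq_fun do rewrite fourierE; exact: schwartz_family_fourier.
Qed.

Lemma schwartz_inv_fourier phi : schwartz phi -> schwartz (inv_fourier phi).
Proof.
move=> hphi; rewrite inv_fourierE.
have h := schwartz_family_scale ((2 * pi)^-1)%:C
  (schwartz_family_fourier ur (schwartz_family_of hphi)).
exact: (schwartz_family_schwartz tt h).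
Qed.

Lemma fourierK phi : schwartz phi -> inv_fourier (fourier phi) = phi.
Proof.
move=> hphi; rewrite inv_fourierE fourierE; apply/funext => x.
have := fourier_inversion x ul hphi; rewrite opprK => ->.
by rewrite mulrA pi2 mul1r.
Qed.

Lemma inv_fourierK phi : schwartz phi -> fourier (inv_fourier phi) = phi.
Proof.
move=> hphi; rewrite inv_fourierE fourierE.
have i1 : cintegrable (signed_fourier 1 phi).
  exact: (schwartz_family_integrable tt (schwartz_family_fourier ur (schwartz_family_of hphi))).
rewrite signed_fourierZ//; apply/funext => x.
by have := fourier_inversion x ur hphi => ->; rewrite mulrA pi2 mul1r.
Qed.

Lemma fourier_linear phi psi (c : R[i]) : cintegrable phi -> cintegrable psi ->
  fourier (fun x => c * phi x + psi x) = (fun p => c * fourier phi p + fourier psi p).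
Proof.
move=> h1 h2; rewrite !fourierE signed_fourierD//; last exact: cintegrableZ.
by rewrite signed_fourierZ.
Qed.

Lemma schwartz_family_reindex (I J : Type) (r : I -> J) (G : J -> R -> R[i]) :
  schwartz_family G -> schwartz_family (fun i => G (r i)).
Proof.
move=> hG n; have := hG n; elim: n G {hG} => [|n IH] G [dG sG hG'].
  by split => // k; have [M hM] := sG k; exists M => i x; exact: hM.
split => //; last exact: IH hG'.
by move=> k; have [M hM] := sG k; exists M => i x; exact: hM.
Qed.

Variables (f : R -> R) (u0 : (R -> R[i]) -> R[i]) (u v : R -> (R -> R[i]) -> R[i]).
Hypothesis hf : smooth_poly_growth f.
Hypothesis uv_C1 : C1S u v.
Hypothesis uv_equation : forall t, 0 <= t ->
  eqS (fun phi => ('i)%C * v t phi - multiplier f (u t) phi) (fun=> 0).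

(** The flow of the adjoint equation, on the Fourier side. *)
Let E (G : R -> R[i]) (r : R) p : R[i] := expi (r * f p) * G p.

Let schwartz_family_flow (G : R -> R[i]) (C : R) : schwartz G ->
  schwartz_family (fun i : {r : R | `|r| <= C} => E G (sval i)).
Proof.
move=> hG; apply: schwartz_familyM.
  by apply: (@multiplier_family_expi _ _ _ f C) => // i; exact: svalP i.
exact: (schwartz_family_reindex (fun=> tt) (schwartz_family_of hG)).
Qed.

Let schwartz_flow (G : R -> R[i]) r : schwartz G -> schwartz (E G r).
Proof.
move=> hG; have h := @schwartz_family_flow G `|r| hG.
exact: (schwartz_family_schwartz (exist _ r (lexx _) : {q : R | `|q| <= `|r|}) h).
Qed.

Let schwartz_fmul (G : R -> R[i]) : schwartz G -> schwartz (fun p => (f p)%:C * G p).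
Proof.
move=> hG; have h := schwartz_familyM (multiplier_family_real unit hf) (schwartz_family_of hG).
exact: (schwartz_family_schwartz tt h).
Qed.

Let remainder (G : R -> R[i]) (h : R) p : R[i] :=
  (h^-1)%:C ^+ 2 * (expi (h * f p) - 1 - 'i%C * (h * f p)%:C) * G p.

Let schwartz_family_remainder (G : R -> R[i]) : schwartz G ->
  schwartz_family (fun i : {h : R | h != 0 /\ `|h| <= 1} => remainder G (sval i)).
Proof.
move=> hG; apply: schwartz_familyM.
  by apply: (@multiplier_family_expi_taylor2 _ _ _ f 1) => // i; have [] := svalP i.
exact: (schwartz_family_reindex (fun=> tt) (schwartz_family_of hG)).
Qed.

Let flow_taylor (G : R -> R[i]) r h p : h != 0 -> E G (r + h) p =
  h%:C * ('i%C * ((f p)%:C * E G r p)) + (E G r p + (h ^+ 2)%:C * remainder (E G r) h p).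
Proof.
move=> h0; rewrite /E /remainder mulrDl expiD.
have hh : (h ^+ 2)%:C * (h^-1)%:C ^+ 2 = 1 :> R[i].
  by rewrite -rmorphXn -rmorphM /= -exprMn divff// expr1n.
set a := expi (r * f p); set b := expi (h * f p); set k := (h^-1)%:C in hh *.
set h2 := (h ^+ 2)%:C in hh *; rewrite rmorphM /=.
transitivity (h%:C * ('i%C * ((f p)%:C * (a * G p))) +
  (a * G p + (h2 * k ^+ 2) * (b - 1 - 'i%C * (h%:C * (f p)%:C)) * (a * G p))).
  by rewrite hh; ring.
by ring.
Qed.

Lemma tempered_linear (T : (R -> R[i]) -> R[i]) (c : R[i]) phi psi : tempered T ->
  schwartz phi -> schwartz psi -> T (fun x => c * phi x + psi x) = c * T phi + T psi.
Proof. by move=> [+ _]; exact. Qed.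

Lemma tempered_bounded (I : Type) (T : (R -> R[i]) -> R[i]) (G : I -> R -> R[i]) :
  tempered T -> schwartz_family G -> exists C, 0 <= C /\ forall i, N (T (G i)) <= C.
Proof.
move=> [_ [m [K hK]]] hG; have [M hM] := schwartz_family_le hG m.
exists `|K * M|; split => // i; apply: le_trans (ler_norm _); apply: hK => //.
exact: schwartz_family_schwartz.
Qed.

Lemma temperedZ (T : (R -> R[i]) -> R[i]) (c : R[i]) phi : tempered T ->
  schwartz phi -> T (fun x => c * phi x) = c * T phi.
Proof.
move=> hT hphi.
have h0 : schwartz (fun=> 0 : R[i]).
  rewrite (_ : (fun=> 0) = fun x => 0 * phi x); last by apply/funext => x; rewrite mul0r.
  exact: (schwartz_family_schwartz tt (schwartz_family_scale 0 (schwartz_family_of hphi))).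
have T0 : T (fun=> 0) = 0.
  rewrite (_ : (fun=> 0) = fun x => (- 1) * phi x + phi x).
    by rewrite tempered_linear// mulN1r addNr.
  by apply/funext => x; rewrite mulN1r addNr.
have := tempered_linear c hT hphi h0.
by rewrite T0 addr0; under eq_fun do rewrite addr0.
Qed.

Section Duality.
Variables (phi : R -> R[i]) (t : R).
Hypotheses (hphi : schwartz phi) (t0 : 0 <= t).

Let G := inv_fourier phi.
Let hG : schwartz G := schwartz_inv_fourier hphi.

Let Phi s := fourier (E G (s - t)).
Let w s := u s (Phi s).

Let hE r : schwartz (E G r) := schwartz_flow r hG.
Let hPhi s : schwartz (Phi s).
Proof.
have h := schwartz_family_fourier_transform (schwartz_family_of (hE (s - t))).
exact: (schwartz_family_schwartz tt h).
Qed.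
Let hfE r : schwartz (fun p => (f p)%:C * E G r p) := schwartz_fmul (hE r).
Let Psi s := fourier (fun p => (f p)%:C * E G (s - t) p).
Let hPsi s : schwartz (Psi s).
Proof.
have h := schwartz_family_fourier_transform (schwartz_family_of (hfE (s - t))).
exact: (schwartz_family_schwartz tt h).
Qed.

Let schwartz_int psi : schwartz psi -> cintegrable psi.
Proof. by move=> h; exact: (schwartz_family_integrable tt (schwartz_family_of h)). Qed.

Let equation_at s : 0 <= s -> v s (Phi s) = - ('i%C * u s (Psi s)).
Proof.
move=> s0; have := uv_equation s0 (hPhi s).
rewrite /multiplier /inv_fourierS /mulS /fourierS fourierK; last exact: hE.
rewrite -/(Psi s) => /eqP; rewrite subr_eq0 => /eqP <-.
by rewrite mulrA -expr2 sqr_i mulN1r opprK.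
Qed.

Let Phi_taylor s h : h != 0 -> `|h| <= 1 ->
  Phi (s + h) = (fun p => h%:C * ('i%C * Psi s p) +
    (1 * Phi s p + (h ^+ 2)%:C * fourier (remainder (E G (s - t)) h) p)).
Proof.
move=> h0 h1.
have hR : schwartz (remainder (E G (s - t)) h).
  exact: (schwartz_family_schwartz (exist _ h (conj h0 h1) : {h : R | h != 0 /\ `|h| <= 1})
    (schwartz_family_remainder (hE (s - t)))).
have i1 := schwartz_int (hfE (s - t)); have i2 := schwartz_int (hE (s - t)).
have i3 := schwartz_int hR; have i4 := cintegrableZ 'i%C i1.
have i5 := cintegrableZ (h ^+ 2)%:C i3.
have -> : Phi (s + h) = fourier (fun p => h%:C * ('i%C * ((f p)%:C * E G (s - t) p)) +
    (1 * E G (s - t) p + (h ^+ 2)%:C * remainder (E G (s - t)) h p)).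
  rewrite /Phi; congr fourier; apply/funext => p.
  have -> : s + h - t = s - t + h by ring.
  by rewrite (flow_taylor G (s - t) p h0) mul1r.
rewrite (fourier_linear _ i4); last by apply: cintegrableD => //; exact: cintegrableZ.
rewrite (fourier_linear _ i2 i5); apply/funext => p; congr (_ + (_ + _)).
  by rewrite fourierE signed_fourierZ// -fourierE.
by rewrite fourierE signed_fourierZ// -fourierE.
Qed.

Let pairing_expansion (T : (R -> R[i]) -> R[i]) s : tempered T ->
  exists C, 0 <= C /\ forall h, h != 0 -> `|h| <= 1 ->
    N (T (Phi (s + h)) - T (Phi s) - h%:C * ('i%C * T (Psi s))) <= C * h ^+ 2.
Proof.
move=> hT.
have hfam := schwartz_family_fourier_transform (schwartz_family_remainder (hE (s - t))).
have [C [C0 hC]] := tempered_bounded hT hfam.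
exists C; split => // h h0 h1.
pose i : {h : R | h != 0 /\ `|h| <= 1} := exist _ h (conj h0 h1).
have hRF : schwartz (fourier (remainder (E G (s - t)) h)) := schwartz_family_schwartz i hfam.
have hcRF : schwartz (fun p => (h ^+ 2)%:C * fourier (remainder (E G (s - t)) h) p).
  exact: (schwartz_family_schwartz i (schwartz_family_scale (h ^+ 2)%:C hfam)).
have hiPsi : schwartz (fun p => 'i%C * Psi s p).
  exact: (schwartz_family_schwartz tt (schwartz_family_scale 'i%C (schwartz_family_of (hPsi s)))).
have hsum : schwartz (fun p => 1 * Phi s p + (h ^+ 2)%:C * fourier (remainder (E G (s - t)) h) p).
  have h2 := schwartz_familyD (schwartz_family_scale 1 (schwartz_family_of (hPhi s)))
    (schwartz_family_of hcRF).
  exact: (schwartz_family_schwartz tt h2).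
rewrite (Phi_taylor s h0 h1) (tempered_linear _ hT hiPsi hsum).
rewrite (tempered_linear _ hT (hPhi s) hcRF) (temperedZ _ hT (hPsi s)) (temperedZ _ hT hRF).
rewrite (_ : _ - _ - _ = (h ^+ 2)%:C * T (fourier (remainder (E G (s - t)) h))); last by ring.
by rewrite Normc.normcM normc_real ger0_norm ?sqr_ge0// mulrC ler_wpM2r ?sqr_ge0// (hC i).
Qed.

Let bounded_flow : schwartz_bounded [set psi | exists2 s, 0 <= s <= t & psi = Phi s].
Proof.
have hfam := schwartz_family_fourier_transform (schwartz_family_flow t hG).
split; first by move=> _ [s _ ->]; exact: hPhi.
move=> m; have [M hM] := schwartz_family_le hfam m; exists M => _ [s /andP[s0 st] ->].
have st' : `|s - t| <= t by rewrite ler_norml; apply/andP; split; lra.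
exact: hM (exist _ (s - t) st' : {r : R | `|r| <= t}).
Qed.

(** Differentiability of [u] at [s] is used at the moving point [Phi s'], which is
    legitimate because it holds uniformly on the bounded set of the [Phi s']. *)
Let w_derivative0 s e : 0 <= s <= t -> 0 < e -> exists2 d, 0 < d &
  forall s', 0 <= s' <= t -> `|s' - s| < d -> N (w s' - w s) <= e * `|s' - s|.
Proof.
move=> /andP[s0 st] e0.
have [hu hv hcu _] := uv_C1 s0.
have [C1 [C10 h1]] := pairing_expansion s hu.
have [C2 [C20 h2]] := pairing_expansion s hv.
have e3 : 0 < e / 3 by rewrite divr_gt0.
have := hcu _ bounded_flow _ e3; rewrite /within /= => /nbhs_ballP[d0 /= d00 hd].
pose B := N ('i%C * v s (Psi s)); have B0 : 0 <= B := normc_ge0 _.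
pose D := C1 + C2 + B + 1; have D0 : 0 < D by rewrite /D; lra.
exists (Num.min 1 (Num.min d0 (e / 3 / D))); first by rewrite !lt_min d00 ltr01 divr_gt0.
move=> s' /andP[s'0 s't]; rewrite !lt_min => /and3P[/ltW ss1 ssd sse].
have [->|ss'] := eqVneq s' s; first by rewrite !subrr normc0 normr0 mulr0.
pose h := s' - s; have h0 : h != 0 by rewrite subr_eq0.
have s'E : s' = s + h by rewrite /h; ring.
have hn : 0 < `|h| by rewrite normr_gt0.
have k1 : N (u s' (Phi s') - u s (Phi s') - h%:C * v s (Phi s')) <= e / 3 * `|h|.
  have ball_s' : ball s d0 s' by rewrite /ball /= distrC.
  have := hd _ ball_s' ss' s'0 (Phi s') (ex_intro2 _ _ s' _ erefl).
  rewrite s'0 s't => /(_ isT); rewrite -(ler_pM2r hn) => k.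
  apply: le_trans k; rewrite [X in _ <= _ * X](_ : _ = N h%:C); last by rewrite normc_real.
  rewrite -Normc.normcM mulrBl -/h mulrAC -rmorphM /= mulVf// rmorph1 mul1r.
  by rewrite (mulrC (v s _)).
have := h1 h h0 ss1; rewrite -s'E => {}h1.
have := h2 h h0 ss1; rewrite -s'E => {}h2.
have k2 : N (v s (Phi s') - v s (Phi s)) <= (C2 + B) * `|h|.
  rewrite (_ : _ - _ = (v s (Phi s') - v s (Phi s) - h%:C * ('i%C * v s (Psi s))) +
     h%:C * ('i%C * v s (Psi s))); last by ring.
  apply: le_trans (normcD _ _) _; rewrite Normc.normcM normc_real mulrDl.
  rewrite lerD//; last by rewrite mulrC.
  apply: le_trans h2 _; rewrite ler_wpM2l// -real_normK ?num_real// expr2.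
  by rewrite ler_piMr.
(* The first-order terms in [u] and in [Phi] cancel, by the equation. *)
have key : w s' - w s = (u s' (Phi s') - u s (Phi s') - h%:C * v s (Phi s')) +
    h%:C * (v s (Phi s') - v s (Phi s)) +
    (u s (Phi s') - u s (Phi s) - h%:C * ('i%C * u s (Psi s))).
  by rewrite /w (equation_at s0); ring.
rewrite key; apply: le_trans (normcD _ _) _.
apply: le_trans (lerD (normcD _ _) (lexx _)) _; rewrite Normc.normcM normc_real -/h.
have k3 : `|h| * N (v s (Phi s') - v s (Phi s)) <= `|h| * ((C2 + B) * `|h|).
  by rewrite ler_wpM2l.
have k4 : C1 * h ^+ 2 = `|h| * (C1 * `|h|) by rewrite -real_normK ?num_real//; ring.
have k5 : `|h| * (D * `|h|) <= `|h| * (e / 3).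
  by rewrite ler_wpM2l// mulrC -ler_pdivlMr// ltW.
have k6 : 0 <= `|h| * `|h| by rewrite mulr_ge0.
move: k5; rewrite /D => k5.
by nra.
Qed.

(** Holmgren's principle: the solution paired with the flow of the adjoint
    equation, run backwards from [phi] at time [t], does not depend on time. *)
Lemma duality : u t phi = u 0 (fourier (E G (- t))).
Proof.
have wt : w t = u t phi.
  rewrite /w /Phi subrr; congr (u t _).
  rewrite (_ : E G 0 = G) ?inv_fourierK//.
  by apply/funext => p; rewrite /E mul0r expi0 mul1r.
rewrite -wt (_ : fourier _ = Phi 0); last by rewrite /Phi sub0r.
rewrite -/(w 0); apply/eqP; rewrite -subr_eq0; apply/eqP; apply: normc_eq0.
apply/eqP; rewrite eq_le normc_ge0 andbT; apply/ler_addgt0Pr => e e0; rewrite add0r.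
have e1 : 0 < e / (t + 1) by rewrite divr_gt0// ltr_wpDl.
apply: (@le_trans _ _ (e / (t + 1) * t - e / (t + 1) * 0)); last first.
  by rewrite mulr0 subr0 mulrAC ler_pdivrMr ?ltr_wpDl// mulrDr mulr1 lerDl ltW.
apply: (@increment_le_halfopen R 0 t w (fun x => e / (t + 1) * x)) => //.
- move=> s st r r0; have [d d0 hd] := w_derivative0 st (@ltr01 R).
  exists (Num.min d r); first by rewrite lt_min d0.
  move=> y yt; rewrite lt_min => /andP[/(hd y yt) h1 h2].
  by apply: le_trans h1 _; rewrite mul1r ltW.
- by move=> x y _ xy _; rewrite ler_wpM2l ?(ltW e1).
- move=> s /andP[s0 st].
  have [|d d0 hd] := @w_derivative0 s (e / (t + 1)) _ e1; first by rewrite s0 ltW.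
  exists d => // y sy yd yt; rewrite -mulrBr -[X in _ <= _ * X]gtr0_norm ?subr_gt0//.
  apply: hd; first by rewrite yt (le_trans s0 (ltW sy)).
  by rewrite gtr0_norm ?subr_gt0// ltrBlDl.
Qed.

End Duality.

(** At time 0 the pairing involves only the Fourier transform of [u0], which is a
    function, and the multiplication formula carries the flow back to the variable
    [x]. *)
Lemma solution_is_function (u0hat : R -> R[i]) t : 0 <= t -> eqS (u 0) u0 ->
  cintegrable u0hat -> eqS (fourierS u0) (regular_dist u0hat) ->
  eqS (u t) (regular_dist (solution_fun f u0hat t)).
Proof.
move=> t0 uu0 iu hu0 phi hphi; rewrite duality//.
have hE := schwartz_flow (- t) (schwartz_inv_fourier hphi).
have hF : schwartz (fourier (E (inv_fourier phi) (- t))).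
  exact: (schwartz_family_schwartz tt (schwartz_family_fourier_transform (schwartz_family_of hE))).
rewrite (uu0 _ hF); have := hu0 _ hE; rewrite /fourierS => ->.
pose c : R[i] := ((2 * pi)^-1)%:C.
pose a p := u0hat p * expi (- t * f p).
have ia : cintegrable a.
  apply: (cintegrableM (C := 1)) => //; last by move=> p; rewrite normc_expi.
  apply: cmeasurable_continuous => p; apply: cis_derive_continuous.
  apply: cis_derive_expi.
  have df : is_derive p 1 f (derive1 f p).
    by rewrite derive1E; apply: DeriveDef => //; exact: (hf.1 0%N).
  exact: is_deriveM (is_derive_cst (- t) p 1) df.
have ica := cintegrableZ c ia.
have iphi : cintegrable phi := schwartz_family_integrable tt (schwartz_family_of hphi).
transitivity (cintegral (fun p => (c * a p) * signed_fourier 1 phi p)).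
  rewrite /regular_dist; congr cintegral; apply/funext => p.
  by rewrite /E inv_fourierE /a -/c; ring.
rewrite (fourier_pairing 1 ica iphi) /regular_dist; congr cintegral; apply/funext => x.
rewrite (signed_fourierZ 1 c ia) mulrC /solution_fun -/c; congr (_ * cintegral _ * _).
apply/funext => p; rewrite /a -mulrA -expiD; congr (_ * expi _); ring.
Qed.

End Evolution.

Theorem theorem2p4 (R : realType) (f : R -> R) (mu p1 : R)
    (u0 : (R -> R[i]) -> R[i]) (u0hat ut : R -> R[i])
    (u : R -> (R -> R[i]) -> R[i]) (eps pt1 pt2 : R)
    (hf : smooth_poly_growth f)
    (hf2 : forall p, 0 < f^`(2) p)
    (hmu : 0 < mu < 1)
    (hu0 : tempered u0)
    (hC2 : condC2 p1 mu u0 u0hat ut)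
    (hu : evolution_solution f u0 u)
    (heps : 0 < eps)
    (hq : pt1 < pt2)
    (hp1 : ~ (pt1 <= p1 <= pt2)) :
  [/\ (* the solution is the function u_f *)
      (forall t, 0 <= t -> eqS (u t) (regular_dist (solution_fun f u0hat t))),
      (* (i) *)
      (forall eta, eps < eta ->
        [/\ 0 < min_f2 f (p1 - eta) p1, 0 < min_f2 f p1 (p1 + eta),
            0 < near_mt1 f p1 eps eta, 0 < near_mt2 f p1 eps eta &
            forall t x, cone f (p1 - eps) (p1 + eps) (t, x) ->
              Normc.normc (solution_fun f u0hat t x) <=
                near_c1 f mu p1 ut eta * t `^ (- (mu / 2)) +
                near_c2 f mu p1 ut eps eta * t^-1]) &
      (* (ii) *)
      (forall eta, 0 < eta < Num.min `|pt1 - p1| `|pt2 - p1| ->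
        [/\ 0 < far_m1 f pt1 pt2 eta, 0 < far_mt2 f pt1 eta,
            0 < far_mt3 f pt2 eta &
            forall t x, cone f pt1 pt2 (t, x) ->
              Normc.normc (solution_fun f u0hat t x) <=
                far_c1 f mu p1 ut pt1 pt2 eta * t `^ (- (1 / 2)) +
                far_c2 f mu p1 ut pt1 pt2 eta * t `^ (- mu) +
                far_c3 f mu p1 ut pt1 pt2 eta * t^-1])].
Proof.
have [[iu eu] [utb dut] _ iut utE] := hC2.
have [v [hC1 heq hu00]] := hu.
have /andP[mu0 mu1] := hmu.
split.
- by move=> t t0; exact: (solution_is_function hf hC1 heq t0 hu00 iu eu).
- move=> eta epseta; split.
  + by apply: min_f2_gt0 => //; lra.
  + by apply: min_f2_gt0 => //; lra.
  + by rewrite subr_gt0 derive1_increasing// ltrD2l.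
  + by rewrite subr_gt0 derive1_increasing// ltrD2l ltrN2.
  + move=> t x [/= t0 ht].
    apply: (near_cone_estimate hf hf2 hmu t0 iu utb dut iut utE _ ht).
    by rewrite heps epseta.
- move=> eta /andP[eta0]; rewrite lt_min => /andP[h1 h2]; split.
  + by apply: min_f2_gt0 => //; lra.
  + by rewrite subr_gt0 derive1_increasing// gtrBl.
  + by rewrite subr_gt0 derive1_increasing// ltrDl.
  + move=> t x [/= t0 ht].
    have [p1pt1|pt1p1] := ltP p1 pt1.
      apply: (far_cone_estimate_right_of_p1 hf hf2 hmu t0 iu utb dut iut utE hq eta0 ht p1pt1).
      by move: h1; rewrite gtr0_norm ?subr_gt0.
    have pt2p1 : pt2 < p1.
      by rewrite ltNge; apply/negP => p1pt2; apply: hp1; rewrite pt1p1 p1pt2.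
    apply: (far_cone_estimate_left_of_p1 hf hf2 hmu t0 iu utb dut iut utE hq eta0 ht pt2p1).
    by move: h2; rewrite ltr0_norm ?subr_lt0// opprB.
Qed.
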